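(* Let $(\mathbf X,Y)$ be an $\mathbb R^d\times\mathbb R$-valued random pair such that $\mathbf X$ has a probability density with respect to Lebesgue measure on $\mathbb R^d$ and $Y$ is bounded, let $\mu$ be the distribution of $\mathbf X$, and assume that the regression function $r(\mathbf x)=\mathbb E[Y\mid \mathbf X=\mathbf x]$ is $\mu$-almost surely continuous (i.e. $r$ is continuous at $\mu$-almost every point of $\mathbb R^d$). Let $r_n$ be the $k_n$-nearest neighbor regression estimate based on the empirical distance $\rho_n$ and the sample $(\mathbf X_1,Y_1),\dots,(\mathbf X_n,Y_n)$. Then, for all $p\ge 1$, if $k_n\to\infty$ and $k_n/n\to 0$ as $n\to\infty$, $$\mathbb E\left|r_n(\mathbf X)-r(\mathbf X)\right|^p\to 0\quad\text{as } n\to\infty.$$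
   Context: Data: $(\mathbf X_1,Y_1),(\mathbf X_2,Y_2),\dots$ are i.i.d. $\mathbb R^d\times\mathbb R$-valued random pairs, independent of and with the same distribution as $(\mathbf X,Y)$; $n\ge d$ throughout. The $k_n$ are integers with $1\le k_n\le n$. Hyperplanes: since $\mathbf X$ has a density, with probability 1 any $d$ points $\mathbf X_{i_1},\dots,\mathbf X_{i_d}$ ($1\le i_1<\dots<i_d\le n$) lie on a unique hyperplane of $\mathbb R^d$, denoted $\mathcal H(\mathbf X_{i_1},\dots,\mathbf X_{i_d})$. Empirical distance: for $\mathbf x,\mathbf x'\in\mathbb R^d$, $$\rho_n(\mathbf x,\mathbf x')=\sum_{1\le i_1<\dots<i_d\le n}\mathbf 1_{\{\text{segment }(\mathbf x,\mathbf x')\text{ intersects the hyperplane }\mathcal H(\mathbf X_{i_1},\dots,\mathbf X_{i_d})\}},$$ where the segment $(\mathbf x,\mathbf x')$ is the line segment joining $\mathbf x$ and $\mathbf x'$; that is, $\rho_n(\mathbf x,\mathbf x')$ counts the hyperplanes through $d$ of the points $\mathbf X_1,\dots,\mathbf X_n$ that separate $\mathbf x$ and $\mathbf x'$. Estimate: for $\mathbf x\in\mathbb R^d$, let $(\mathbf X_{(1)}(\mathbf x),Y_{(1)}(\mathbf x)),\dots,(\mathbf X_{(n)}(\mathbf x),Y_{(n)}(\mathbf x))$ be the reordering of the data $(\mathbf X_1,Y_1),\dots,(\mathbf X_n,Y_n)$ according to increasing values of $\rho_n(\mathbf x,\mathbf X_i)$, ties being broken by indices (if $\rho_n(\mathbf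 x,\mathbf X_i)=\rho_n(\mathbf x,\mathbf X_j)$ and $i<j$, then $\mathbf X_i$ is declared closer). The estimate is $$r_n(\mathbf x)=\frac1{k_n}\sum_{i=1}^{k_n}Y_{(i)}(\mathbf x).$$ In $r_n(\mathbf X)$ the estimate is evaluated at the point $\mathbf X$, which is independent of the sample, and the expectation is over both $\mathbf X$ and the sample. *)

(* Defs.v *)
From HB Require Import structures.
From mathcomp Require Import all_boot all_order all_algebra.
From mathcomp Require Import all_classical all_reals all_analysis.

Set Implicit Arguments.
Unset Strict Implicit.
Unset Printing Implicit Defensive.

Import Order.TTheory GRing.Theory Num.Theory.
Import numFieldNormedType.Exports.

Local Open Scope classical_set_scope.
Local Open Scope ring_scope.

(* The product sigma-algebra on row vectors; on 'rV[R]_n it is the Borel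
   sigma-algebra of R^n.                                                    *)
Section measurable_rV.
Context {disp : measure_display} {T : measurableType disp}.
Variable n : nat.

Let coord : 'I_n -> 'rV[T]_n -> T := fun i v => v 0 i.

Let rV_set0 : g_sigma_preimage coord set0.
Proof. exact: sigma_algebra0. Qed.

Let rV_setC A : g_sigma_preimage coord A -> g_sigma_preimage coord (~` A).
Proof. exact: sigma_algebraC. Qed.

Let rV_bigcup (F : (set 'rV[T]_n)^nat) :
  (forall i, g_sigma_preimage coord (F i)) ->
  g_sigma_preimage coord (\bigcup_i (F i)).
Proof. exact: sigma_algebra_bigcup. Qed.

HB.instance Definition _ := @isMeasurable.Build (measure_tuple_display disp)
  'rV[T]_n (g_sigma_preimage coord) rV_set0 rV_setC rV_bigcup.

Lemma measurable_rV_coord (i : 'I_n) :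
  measurable_fun [set: 'rV[T]_n] (fun v => v 0 i).
Proof.
move=> _ Y mY; rewrite setTI; apply: sub_sigma_algebra => /=.
rewrite -bigcup_seq/=; exists i => /=; first by rewrite mem_index_enum.
by exists Y => //; rewrite setTI.
Qed.

Lemma measurable_fun_rVP d1 (T1 : measurableType d1) (f : T1 -> 'rV[T]_n) :
  (forall i, measurable_fun [set: T1] (fun x => f x 0 i)) ->
  measurable_fun [set: T1] f.
Proof.
move=> mf _ B mB; rewrite setTI.
pose S := [set B : set 'rV[T]_n | measurable (f @^-1` B)].
have SS : sigma_algebra [set: 'rV[T]_n] S.
  split; first by rewrite /S/= preimage_set0.
  - by move=> A mA; rewrite /S/= setTD preimage_setC; exact: measurableC.
  - by move=> F mF; rewrite /S/= preimage_bigcup; exact: bigcupT_measurable.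
apply: (@smallest_sub _ _ _ S SS _ _ mB) => A.
rewrite -bigcup_seq => -[i _ [C mC <-]]; rewrite /S/= setTI.
by rewrite -[X in measurable X]setTI; exact: mf.
Qed.

End measurable_rV.

Section lebesgue_rV.
Variable R : realType.

Definition rV_cons n (xv : measurableTypeR R * 'rV[R]_n) : 'rV[R]_n.+1 :=
  \row_i (if unlift ord0 i is Some j then xv.2 0 j else xv.1).

Lemma measurable_rV_cons n : measurable_fun [set: _] (@rV_cons n).
Proof.
apply: measurable_fun_rVP => i.
under eq_fun do rewrite mxE.
case: unliftP => [j _|_]; last exact: measurable_fst.
apply: (measurableT_comp (measurable_rV_coord j)); exact: measurable_snd.
Qed.

Section step.
Variables (n : nat) (m : {sigma_finite_measure set 'rV[R]_n -> \bar R}).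

Definition lebesgue_rV_step : set 'rV[R]_n.+1 -> \bar R :=
  pushforward (@lebesgue_measure R \x m)%E (@rV_cons n).

Let step0 : lebesgue_rV_step set0 = 0%E.
Proof. by rewrite /lebesgue_rV_step /pushforward preimage_set0 measure0. Qed.

Let step_ge0 A : (0 <= lebesgue_rV_step A)%E.
Proof. by rewrite /lebesgue_rV_step /pushforward; exact: measure_ge0. Qed.

Let step_sigma_additive : semi_sigma_additive lebesgue_rV_step.
Proof.
move=> F mF tF mUF; rewrite /lebesgue_rV_step /pushforward preimage_bigcup.
have mpre A : measurable A -> measurable (@rV_cons n @^-1` A).
  by move=> mA; rewrite -[X in measurable X]setTI; exact: measurable_rV_cons.
apply: measure_semi_sigma_additive.
- by move=> k; exact: mpre.
- apply/trivIsetP => /= i j _ _ ij; rewrite -preimage_setI.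
  by move/trivIsetP : tF => /(_ _ _ _ _ ij) ->//; rewrite preimage_set0.
- by rewrite -preimage_bigcup; exact: mpre.
Qed.

HB.instance Definition _ := isMeasure.Build _ _ _
  lebesgue_rV_step step0 step_ge0 step_sigma_additive.

Lemma lebesgue_rV_stepE (A : set R) (B : set 'rV[R]_n) :
  measurable A -> measurable B ->
  lebesgue_rV_step [set v | A (v 0 ord0) /\ B (\row_j v 0 (lift ord0 j))] =
    (lebesgue_measure A * m B)%E.
Proof.
move=> mA mB; rewrite -product_measure1E// /lebesgue_rV_step /pushforward; congr (_ _).
have tailE xv : \row_j rV_cons xv 0 (lift ord0 j) = xv.2.
  by apply/rowP => j; rewrite !mxE liftK.
by apply/seteqP; split=> -[x v] /=; rewrite tailE mxE unlift_none.
Qed.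

Let step_sigma_finite : sigma_finite setT lebesgue_rV_step.
Proof.
have /sigma_finiteP[F [TF ndF Foo]] := sigma_finiteT (@lebesgue_measure R).
have /sigma_finiteP[G [TG ndG Goo]] := sigma_finiteT m.
exists (fun k => [set v : 'rV[R]_n.+1 |
    F k (v 0 ord0) /\ G k (\row_j v 0 (lift ord0 j))]).
  rewrite predeqE => v; split=> // _.
  have [k _ Fk] : (\bigcup_k F k) (v 0 ord0) by rewrite -TF.
  have [l _ Gl] : (\bigcup_k G k) (\row_j v 0 (lift ord0 j)) by rewrite -TG.
  exists (maxn k l) => //; split.
  - by move: Fk; exact/subsetPset/ndF/leq_maxl.
  - by move: Gl; exact/subsetPset/ndG/leq_maxr.
move=> k; have [mF Foo'] := Foo k; have [mG Goo'] := Goo k; split.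
  apply: measurableI.
    rewrite -[X in measurable X]setTI.
    exact: (measurable_rV_coord (T := R) ord0).
  rewrite -[X in measurable X]setTI.
  have mtail : measurable_fun [set: 'rV[R]_n.+1]
      (fun v => \row_j v 0 (lift ord0 j) : 'rV[R]_n).
    apply: measurable_fun_rVP => j; under eq_fun do rewrite mxE.
    exact: measurable_rV_coord.
  exact: mtail.
by rewrite lebesgue_rV_stepE// lte_mul_pinfty// ge0_fin_numE.
Qed.

HB.instance Definition _ := Measure_isSigmaFinite.Build _ _ _
  lebesgue_rV_step step_sigma_finite.

End step.

Fixpoint lebesgue_rV n : {sigma_finite_measure set 'rV[R]_n -> \bar R} :=
  if n is n'.+1 then lebesgue_rV_step (lebesgue_rV n') else \d_(0 : 'rV[R]_0).

(* lebesgue_rV n is the Lebesgue measure: the volume of a box is the product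
   of its side lengths.                                                     *)
Lemma lebesgue_rV_box n (a b : 'rV[R]_n) : (forall i, a 0 i <= b 0 i) ->
  lebesgue_rV n [set v | forall i, a 0 i <= v 0 i <= b 0 i] =
    (\prod_(i < n) (b 0 i - a 0 i))%:E.
Proof.
elim: n => [|n IHn] in a b *.
  by move=> _; rewrite big_ord0 /= diracE mem_set// => -[].
move=> ab; pose tl (v : 'rV[R]_n.+1) : 'rV[R]_n := \row_j v 0 (lift ord0 j).
have tlE v j : tl v 0 j = v 0 (lift ord0 j) by rewrite mxE.
transitivity (lebesgue_rV_step (lebesgue_rV n)
    [set v : 'rV[R]_n.+1 | [set` `[a 0 ord0, b 0 ord0]] (v 0 ord0) /\
      [set u : 'rV[R]_n | forall i, tl a 0 i <= u 0 i <= tl b 0 i] (tl v)]).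
  congr (lebesgue_rV_step _ _); apply/seteqP; split=> v /=.
    move=> vab; split; first by rewrite in_itv/=; exact: vab.
    by move=> i; rewrite !tlE.
  rewrite in_itv/= => -[v0 vab] i.
  by case: (unliftP ord0 i) => [j ->|-> //]; rewrite -!tlE.
rewrite lebesgue_rV_stepE//.
- rewrite IHn => [|i]; last by rewrite !tlE.
  rewrite lebesgue_measure_itv/= lte_fin big_ord_recl EFinM; congr (_ * _)%E.
    case: ltP => // ba; apply/esym/eqP; rewrite eqe subr_eq0 eq_le ba.
    exact: ab.
  by congr EFin; apply: eq_bigr => j _; rewrite !tlE.
- rewrite [X in measurable X](_ : _ = \bigcap_(i in [set: 'I_n])
      ((fun u : 'rV[R]_n => u 0 i) @^-1` [set` `[tl a 0 i, tl b 0 i]])).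
    apply: fin_bigcap_measurable => // i _.
    rewrite -[X in measurable X]setTI.
    by apply: (measurable_rV_coord (T := R) i).
  apply/seteqP; split=> u /= uab i; first by move=> _; rewrite /= in_itv/=.
  by have := uab i I; rewrite /= in_itv/=.
Qed.

End lebesgue_rV.

Section probability.
Context {R : realType} {disp : measure_display} {Omega : measurableType disp}.
Variable P : probability Omega R.

Definition identically_distributed d (T : measurableType d)
    (Z1 Z2 : Omega -> T) :=
  forall A : set T, measurable A -> P (Z1 @^-1` A) = P (Z2 @^-1` A).

Definition mutually_independent d (T : measurableType d) (I : eqType)
    (Z : I -> Omega -> T) :=
  forall (s : seq I) (A : I -> set T), uniq s -> (forall i, measurable (A i)) ->
    P (\bigcap_(i in [set` s]) (Z i @^-1` A i)) =
      (\prod_(i <- s) P (Z i @^-1` A i))%E.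

Definition has_density d (X : Omega -> 'rV[R]_d) :=
  exists f : 'rV[R]_d -> R,
    [/\ measurable_fun setT f, forall x, 0 <= f x &
      forall A : set 'rV[R]_d, measurable A ->
        P (X @^-1` A) = (\int[lebesgue_rV R d]_(x in A) (f x)%:E)%E].

(* r is a version of the regression function x |-> E[Y | X = x]. *)
Definition is_regression_function d (X : Omega -> 'rV[R]_d) (Y : Omega -> R)
    (r : 'rV[R]_d -> R) :=
  [/\ measurable_fun setT r,
      P.-integrable setT (fun w => (r (X w))%:E) &
      forall A : set 'rV[R]_d, measurable A ->
        (\int[P]_(w in X @^-1` A) (Y w)%:E =
         \int[P]_(w in X @^-1` A) (r (X w))%:E)%E].

End probability.

Section nearest_neighbors.
Context {R : realType} {d : nat}.
Implicit Types (x y z : 'rV[R]_d) (xs : nat -> 'rV[R]_d) (ys : nat -> R).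

Definition is_hyperplane (H : set 'rV[R]_d) :=
  exists (a : 'rV[R]_d) (b : R), a != 0 /\
    H = [set z | \sum_(i < d) a 0 i * z 0 i = b].

(* The intersection of all hyperplanes containing S; this is the hyperplane
   through S whenever there is exactly one such hyperplane.                 *)
Definition hyperplane_through (S : set 'rV[R]_d) : set 'rV[R]_d :=
  \bigcap_(H in [set H | is_hyperplane H /\ S `<=` H]) H.

Lemma hyperplane_throughE (S H : set 'rV[R]_d) :
  is_hyperplane H -> S `<=` H ->
  (forall H', is_hyperplane H' -> S `<=` H' -> H' = H) ->
  hyperplane_through S = H.
Proof.
move=> hH SH uH; apply/seteqP; split=> z; first by move/(_ H); exact.
by move=> Hz H' [hH' SH']; rewrite (uH H').
Qed.

Definition line_segment x y : set 'rV[R]_d :=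
  [set z | exists2 t : R, 0 <= t <= 1 & z = (1 - t) *: x + t *: y].

(* The sample is xs 0, ..., xs n.-1; the index sets i_1 < ... < i_d are the
   d-element subsets I of 'I_n.                                             *)
Definition empirical_distance xs (n : nat) x y : nat :=
  \sum_(I : {set 'I_n} | #|I| == d)
    `[< line_segment x y `&`
        hyperplane_through [set xs i | i in [set` I]] !=set0 >].

Definition closer xs n x : rel nat := fun i j =>
  let rho := fun i => empirical_distance xs n x (xs i) in
  (rho i < rho j)%N || (rho i == rho j) && (i <= j)%N.

Definition neighbors xs n x : seq nat := sort (closer xs n x) (iota 0 n).

Definition knn_estimate xs ys (n k : nat) x : R :=
  k%:R^-1 * \sum_(i < k) ys (nth 0%N (neighbors xs n x) i).

End nearest_neighbors.

(* Main.v *)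
Require Import Defs.
From mathcomp Require Import all_boot all_order all_algebra.
From mathcomp Require Import all_classical all_reals all_analysis.
From mathcomp Require Import measurable_realfun ring lra zify.

Import Order.TTheory GRing.Theory Num.Theory.
Import numFieldNormedType.Exports.

(** The error splits into a variance part, the average of Y_i - r(X_i) over the
    k_n selected indices, and a bias part, the average of r(X_i) - r(X).

    Variance.  The selection depends on the points only, so, all other data
    being frozen, the residual Y_i - r(X_i) of a selected index is centered:
    distinct residuals are orthogonal, only k_n of them are present, and
    Chebyshev's inequality bounds the deviation of their average by a multiple
    of 1 / k_n ([nearest_average_deviation]).  Conditional expectations are
    replaced by [resampling]: the law of a finite family of independent
    variables is unchanged when one of them is replaced by a copy living on a
    second factor of the probability space.  This requires the selection to be
    a measurable function of the data.  Almost surely the sample is in general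
    position ([general_position_ae], because the zero set of a nonzero affine
    function is Lebesgue-null), and then a hyperplane separates two points
    exactly when an affine determinant takes opposite signs at them, so that
    the selection is determined by finitely many signs ([nearest_by_sidesE]).

    Bias.  It suffices that, with high probability, all the selected points lie
    in a box around X on which r oscillates little ([bias_vanishes]).  Two facts
    are compared.

    - Points outside the box are far.  Around almost every x, each of the 2^d
      open orthants at x carries mass inside the box ([lebesgue_rV_orthant]).
      One sample point in each orthant gives a polytope that contains x and
      stays in the box ([hull_orthants]); a segment leaving the box leaves the
      polytope, hence meets the affine hull of d of its vertices
      ([caratheodory_exit]).  A positive proportion of the sample falls in each
      orthant, so a positive proportion theta of the n^d hyperplanes separates
      x from every point outside the box, simultaneously ([far_distance]).

    - Points very close to X are near.  The distance from X to any point within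
      delta is at most the number of hyperplanes passing within delta of X,
      whose expectation is at most n^d q(delta), where q(delta) tends to zero
      with delta because X almost surely avoids a hyperplane through d other
      points ([near_hyperplane_small]).  Markov's inequality makes this number
      smaller than theta n^d ([near_count_small]), and as k_n / n tends to zero
      there are at least k_n sample points within delta of X.

    Boxes, orthants and cells range over countable families with rational
    parameters ([config]), of which finitely many suffice up to an event of
    small probability ([countable_cover]); only laws of large numbers for fixed
    sets are then needed.  Since Y and r(X) are bounded, convergence in
    probability of the error gives convergence of all its absolute moments
    ([estimate_Lp_cvg]). *)

Set Implicit Arguments.
Unset Strict Implicit.
Unset Printing Implicit Defensive.

Local Open Scope classical_set_scope.
Local Open Scope ring_scope.

(** * Hyperplanes through d points as zero sets of determinants *)

Section hyperplanes.
Context {R : realType} {d : nat}.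
Implicit Types (u : nat -> 'rV[R]_d) (x y z : 'rV[R]_d).

(** Homogeneous coordinates turn affine functions of z into linear forms. *)
Definition hom z : 'rV[R]_d.+1 := rV_cons (1 : R, z).

Lemma hom0 z : hom z 0 ord0 = 1.
Proof. by rewrite mxE unlift_none. Qed.

Lemma homS z i : hom z 0 (lift ord0 i) = z 0 i.
Proof. by rewrite mxE liftK. Qed.

Lemma hom_conv t x y : hom ((1 - t) *: x + t *: y) = (1 - t) *: hom x + t *: hom y.
Proof.
apply/rowP => j; rewrite !mxE; case: unliftP => [i _|_]; rewrite ?mxE//=.
by rewrite !mulr1 subrK.
Qed.

(** Padding with rows of the identity makes the determinant the leading
    principal minor of the rows [hom (u i)]; minors of consecutive sizes are
    then determinants of matrices that differ in one row. *)
Definition minor_mx m u : 'M[R]_d.+1 :=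
  \matrix_(i, j) if (i < m)%N then hom (u i) 0 j else (i == j)%:R.

Lemma minor_mx0 u : \det (minor_mx 0 u) = 1.
Proof.
rewrite (_ : minor_mx 0 u = 1%:M) ?det1//.
by apply/matrixP => i j; rewrite !mxE.
Qed.

Definition minor_cof m u (j : 'I_d.+1) : R := cofactor (minor_mx m u) (inord m) j.

(** Row m is the only one that changes from size m to size m.+1, so the
    cofactors along it depend on the first m points only: the next minor is an
    affine function of the next point, with coefficients fixed by the others. *)
Lemma det_minor_mxS m u : (m <= d)%N ->
  \det (minor_mx m.+1 u) = \sum_j hom (u m) 0 j * minor_cof m u j.
Proof.
move=> md; rewrite (expand_det_row _ (inord m)); apply: eq_bigr => j _.
rewrite mxE inordK// ltnSn; congr (_ * _).
rewrite /minor_cof /cofactor; congr (_ * \det _).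
apply/matrixP => i k; rewrite !mxE/= -[bump _ _]/(val (lift (inord m) i)).
have : lift (inord m) i != inord m by rewrite eq_sym neq_lift.
by rewrite -val_eqE/= inordK// ltnS leq_eqVlt => /negbTE ->.
Qed.

(** Row m is still a row of the identity at size m, so a nonzero minor of size m
    provides a nonzero coefficient in the expansion of the minor of size m.+1. *)
Lemma minor_cof_diag m u : (m <= d)%N -> minor_cof m u (inord m) = \det (minor_mx m u).
Proof.
move=> md; rewrite [RHS](expand_det_row _ (inord m)) (bigD1 (inord m))//= big1.
  by rewrite mxE inordK// ltnn eqxx mul1r addr0.
by move=> j jm; rewrite mxE inordK// ltnn eq_sym (negbTE jm) mul0r.
Qed.

Lemma minor_cof_ext m u v j : (forall i, (i < m)%N -> u i = v i) ->
  minor_cof m u j = minor_cof m v j.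
Proof.
move=> uv; rewrite /minor_cof; congr (cofactor _ _ _).
by apply/matrixP => i k; rewrite !mxE; case: ltnP => // /uv ->.
Qed.

Lemma minor_mx_ext m u v : (forall i, (i < m)%N -> u i = v i) ->
  minor_mx m u = minor_mx m v.
Proof.
by move=> uv; apply/matrixP => i k; rewrite !mxE; case: ltnP => // /uv ->.
Qed.

Definition with_last u z : nat -> 'rV[R]_d := fun i => if (i < d)%N then u i else z.

(** An affine function of z vanishing at the first d points of u; its sign tells
    the two half-spaces apart. *)
Definition side u z : R := \det (minor_mx d.+1 (with_last u z)).

(** The coefficient of z i in [side u z]. *)
Definition normal u (i : 'I_d) : R := minor_cof d u (lift ord0 i).

Lemma sideE u z : side u z = \sum_j hom z 0 j * minor_cof d u j.
Proof.
rewrite /side det_minor_mxS//; apply: eq_bigr => j _; congr (_ * _).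
  by rewrite /with_last ltnn.
by apply: minor_cof_ext => i id; rewrite /with_last id.
Qed.

Lemma side_affine u z :
  side u z = minor_cof d u ord0 + \sum_(i < d) normal u i * z 0 i.
Proof.
rewrite sideE big_ord_recl hom0 mul1r; congr (_ + _).
by apply: eq_bigr => i _; rewrite homS mulrC.
Qed.

Lemma side_vertex u (i : 'I_d) : side u (u i) = 0.
Proof.
have iS : (i < d.+1)%N by rewrite ltnS ltnW.
apply: (@determinant_alternate _ _ _ (Ordinal iS) ord_max).
  by rewrite -val_eqE/= neq_ltn ltn_ord.
move=> j; rewrite !mxE/= iS ltnSn; by rewrite /with_last ltn_ord ltnn.
Qed.

Lemma side_conv u t x y :
  side u ((1 - t) *: x + t *: y) = (1 - t) * side u x + t * side u y.
Proof.
rewrite !sideE hom_conv !mulr_sumr -big_split/=; apply: eq_bigr => j _.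
by rewrite !mxE; ring.
Qed.

Definition general_position u := exists i, normal u i != 0.

(** Without linear part, [side u] is constant, and it is zero at a vertex. *)
Lemma side_degenerate u : (0 < d)%N -> ~ general_position u -> forall z, side u z = 0.
Proof.
move=> d0 /forallNP ngp z.
have n0 i : normal u i = 0 by apply/eqP; apply: contra_notT (ngp i).
have sE w : side u w = minor_cof d u ord0.
  by rewrite side_affine big1 ?addr0// => i _; rewrite n0 mul0r.
by rewrite sE -(sE (u (Ordinal d0))) side_vertex.
Qed.

Lemma det_minor_mx_gp u : (0 < d)%N -> \det (minor_mx d u) != 0 -> general_position u.
Proof.
move=> d0 D0; apply: contrapT => ngp.
have n0 i : normal u i = 0.
  by apply/eqP; apply: contra_notT ngp => ni; exists i.
have c0 : minor_cof d u ord0 = 0.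
  have := side_degenerate d0 ngp (u (Ordinal d0)).
  by rewrite side_affine big1 ?addr0// => i _; rewrite n0 mul0r.
move: D0; rewrite -minor_cof_diag// => /eqP; apply.
by case: (unliftP ord0 (inord d : 'I_d.+1)) => [j|] ->; [exact: n0|exact: c0].
Qed.

Definition vertices u : set 'rV[R]_d := [set u i | i in [set i | (i < d)%N]].

Lemma is_hyperplane_side u : general_position u ->
  is_hyperplane [set z | side u z = 0].
Proof.
move=> [i ni]; exists (\row_j normal u j), (- minor_cof d u ord0); split.
  by apply: contraNneq ni => /rowP/(_ i); rewrite !mxE => ->.
apply/seteqP; split=> z /=; under eq_bigr do rewrite mxE.
  by rewrite side_affine => /eqP; rewrite addrC addr_eq0 => /eqP.
by rewrite side_affine => ->; rewrite subrr.
Qed.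

(** A zero of the determinant gives a linear dependency between [hom z] and the
    [hom (u i)].  In general position [hom z] occurs in it, so every affine
    function that vanishes at the u i vanishes at z. *)
Lemma side0_hyperplane u z (H : set 'rV[R]_d) : general_position u ->
  side u z = 0 -> is_hyperplane H -> vertices u `<=` H -> H z.
Proof.
move=> [i0 ni0] sz [a [b [a0 HE]]] uH.
have /eqP/det0P[v v0 vM] := sz.
pose l (w : 'rV[R]_d) := \sum_(i < d) a 0 i * w 0 i - b.
have l0 w : (l w = 0) = H w.
  rewrite HE/=; apply/propext; rewrite /l; split; last by move=> ->; rewrite subrr.
  by move=> /eqP; rewrite subr_eq0 => /eqP.
have lE w : l w = \sum_j hom w 0 j * rV_cons (- b, a) 0 j.
  rewrite big_ord_recl hom0 mul1r mxE unlift_none addrC; congr (_ + _).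
  by apply: eq_bigr => j _; rewrite homS mxE liftK mulrC.
have combE : \sum_(i < d.+1) v 0 i * l (with_last u z i) = 0.
  transitivity (\sum_j (v *m minor_mx d.+1 (with_last u z)) 0 j * rV_cons (- b, a) 0 j).
    under [RHS]eq_bigr do rewrite mxE mulr_suml.
    rewrite exchange_big/=; apply: eq_bigr => i _; rewrite lE mulr_sumr.
    by apply: eq_bigr => j _; rewrite -[RHS]mulrA [minor_mx _ _ _ _]mxE ltn_ord.
  by rewrite vM big1// => j _; rewrite mxE mul0r.
rewrite -l0; move: combE; rewrite big_ord_recr/= big1 ?add0r; last first.
  move=> i _; rewrite /with_last/= ltn_ord; apply/eqP; rewrite mulf_eq0.
  by apply/orP; right; apply/eqP; rewrite l0; apply: uH; exists i => /=.
rewrite /with_last ltnn => /eqP; rewrite mulf_eq0 => /orP[/eqP vmax|/eqP//].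
(* A dependency among the first d rows alone makes the side of every point zero. *)
have sall w : side u w = 0.
  apply/eqP/det0P; exists v => //; apply/rowP => j.
  have /rowP/(_ j) := vM; rewrite !mxE !big_ord_recr/= vmax !mul0r !addr0 => vj; rewrite -[RHS]vj.
  by apply: eq_bigr => i _; rewrite !mxE /with_last/= ltn_ord.
have := sall (delta_mx 0 i0); rewrite side_affine.
have := sall 0; rewrite side_affine big1 => [|i _]; last by rewrite mxE mulr0.
rewrite addr0 => ->; rewrite add0r (bigD1 i0)//= big1 => [|i ii0].
  by rewrite mxE !eqxx mulr1 addr0 => n0; move: ni0; rewrite n0 eqxx.
by rewrite mxE (negbTE ii0) andbF mulr0.
Qed.

Lemma vertices_side u : vertices u `<=` [set z | side u z = 0].
Proof. by move=> _ [i /= id <-]; exact: (side_vertex u (Ordinal id)). Qed.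

Lemma hyperplane_through_side u : general_position u ->
  hyperplane_through (vertices u) = [set z | side u z = 0].
Proof.
move=> gp; apply/seteqP; split=> z /=.
  move/(_ [set z | side u z = 0]); apply.
  by split; [exact: is_hyperplane_side|exact: vertices_side].
by move=> sz H [hH uH]; exact: (side0_hyperplane gp sz).
Qed.

Lemma hyperplane_through_sub_side u : (0 < d)%N ->
  hyperplane_through (vertices u) `<=` [set z | side u z = 0].
Proof.
move=> d0; have [gp|ngp] := pselect (general_position u).
  by rewrite hyperplane_through_side.
by move=> z _ /=; exact: side_degenerate.
Qed.

(** An affine function vanishes on a segment exactly when its values at the ends
    do not have the same strict sign.  Separation thus becomes a polynomial
    condition on the points, hence a measurable one. *)
Lemma segment_meets_side u x y : general_position u ->
  (line_segment x y `&` hyperplane_through (vertices u) !=set0) <->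
  side u x * side u y <= 0.
Proof.
move=> gp; rewrite hyperplane_through_side//; split.
  move=> [_ [[t /andP[t0 t1] ->]]] /=; rewrite side_conv.
  set p := side u x; set q := side u y => pq0.
  have [p0|p0] := eqVneq p 0; first by rewrite p0 mul0r.
  have t_neq0 : t != 0.
    by apply: contra_eq_neq pq0 => ->; rewrite subr0 mul1r mul0r addr0.
  have t_gt0 : 0 < t by rewrite lt_neqAle eq_sym t_neq0.
  rewrite -(pmulr_rle0 _ t_gt0).
  have -> : t * (p * q) = - (1 - t) * p ^+ 2.
    have : t * q = - (1 - t) * p by apply/eqP; rewrite -subr_eq0 mulNr opprK addrC pq0.
    by move=> tq; rewrite mulrCA tq; ring.
  by rewrite mulNr oppr_le0 mulr_ge0 ?sqr_ge0// subr_ge0.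
set p := side u x; set q := side u y => pq.
have [pq0|pq0] := eqVneq p q.
  have p0 : p = 0.
    by apply/eqP; rewrite -sqrf_eq0 eq_le sqr_ge0 andbT expr2 {2}pq0.
  exists x; split=> //; exists 0; first by rewrite lexx ler01.
  by rewrite subr0 scale1r scale0r addr0.
have pq_neq0 : p - q != 0 by rewrite subr_eq0.
exists ((1 - p / (p - q)) *: x + (p / (p - q)) *: y); split; last first.
  by rewrite /= side_conv -/p -/q; field.
exists (p / (p - q)) => //.
have [pq_gt0|pq_le0] := ltP 0 (p - q).
  rewrite ler_pdivlMr// ler_pdivrMr// mul0r mul1r.
  by apply/andP; split; nra.
have pq_lt0 : p - q < 0 by rewrite lt_neqAle pq_neq0.
rewrite ler_ndivlMr// ler_ndivrMr// mul0r mul1r.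
by apply/andP; split; nra.
Qed.

(** [side u] vanishes somewhere on the segment and, for the sup norm, is
    Lipschitz with constant the l1 norm of its linear part. *)
Lemma segment_near_side u x y (delta : R) : (0 < d)%N ->
  (forall i, `|y 0 i - x 0 i| <= delta) ->
  line_segment x y `&` hyperplane_through (vertices u) !=set0 ->
  `|side u x| <= delta * \sum_i `|normal u i|.
Proof.
move=> d0 xy [z [[t /andP[t0 t1] zE]]] /(hyperplane_through_sub_side d0)/= sz.
have -> : side u x = - \sum_i normal u i * (z 0 i - x 0 i).
  rewrite -sumrN -[LHS]subr0 -[X in _ - X]sz !side_affine opprD addrACA subrr.
  by rewrite add0r -sumrB; apply: eq_bigr => i _; ring.
rewrite normrN (le_trans (ler_norm_sum _ _ _))// mulr_sumr ler_sum// => i _.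
rewrite normrM mulrC ler_wpM2r//.
have -> : z 0 i - x 0 i = t * (y 0 i - x 0 i) by rewrite zE !mxE; ring.
by rewrite normrM ger0_norm// (le_trans _ (xy i))// ler_piMl.
Qed.

End hyperplanes.

(** * Convex position *)

Lemma subset_of_card (S : finType) (T : {set S}) n : (#|T| <= n)%N -> (n <= #|S|)%N ->
  exists2 T' : {set S}, T \subset T' & #|T'| = n.
Proof.
elim: n => [|n IH].
  by rewrite leqn0 => /eqP T0 _; exists T.
rewrite leq_eqVlt => /predU1P[Tn _|Tn nS]; first by exists T.
have [T' TT' T'n] := IH Tn (ltnW nS).
have /existsP[s sT'] : [exists s, s \notin T'].
  rewrite -negb_forall; apply/negP => /forallP T'S; move: nS.
  by rewrite -T'n ltnNge subset_leq_card//; apply/fintype.subsetP.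
exists (s |: T'); last by rewrite cardsU1 sT' T'n.
by rewrite (fintype.subset_trans TT')// finset.subsetUr.
Qed.

Section convex_position.
Context {R : realType} {d : nat} {S : finType}.
Implicit Types (z : S -> 'rV[R]_d) (w x y : 'rV[R]_d).

Definition hull z w := exists l : S -> R,
  [/\ forall s, 0 <= l s, \sum_s l s = 1 & w = \sum_s l s *: z s].

Lemma hull_point z s : hull z (z s).
Proof.
exists (fun i => (i == s)%:R); split.
- by move=> i; rewrite ler0n.
- by rewrite (bigD1 s)//= eqxx big1 ?addr0// => i /negbTE ->.
- rewrite (bigD1 s)//= eqxx scale1r big1 ?addr0// => i /negbTE ->.
  by rewrite scale0r.
Qed.

Lemma hull_conv z w1 w2 t : 0 <= t <= 1 -> hull z w1 -> hull z w2 ->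
  hull z ((1 - t) *: w1 + t *: w2).
Proof.
move=> /andP[t0 t1] [l1 [l10 l11 ->]] [l2 [l20 l21 ->]].
exists (fun s => (1 - t) * l1 s + t * l2 s); split.
- by move=> s; rewrite addr_ge0// mulr_ge0// subr_ge0.
- by rewrite big_split/= -!mulr_sumr l11 l21 !mulr1 subrK.
- rewrite !scaler_sumr -big_split/=; apply: eq_bigr => s _.
  by rewrite !scalerA scalerDl.
Qed.

Lemma hull_box z w (a b : 'rV[R]_d) :
  (forall s i, a 0 i < z s 0 i < b 0 i) -> hull z w -> forall i, a 0 i < w 0 i < b 0 i.
Proof.
move=> zab [l [l0 l1 ->]] i.
have [s ls] : exists s, 0 < l s.
  apply: contrapT => /forallNP nl; have : \sum_s l s = 0.
    apply: big1 => s _; apply/eqP; rewrite eq_le l0 andbT leNgt.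
    exact/negP.
  by rewrite l1 => /eqP; rewrite oner_eq0.
have lt_comb (u v : S -> R) : (forall s, u s < v s) ->
    \sum_s l s * u s < \sum_s l s * v s.
  move=> uv; rewrite [ltLHS](bigD1 s)//= [ltRHS](bigD1 s)//= ltr_leD//.
    by rewrite ltr_pM2l.
  by apply: ler_sum => j _; rewrite ler_wpM2l// ltW.
have cst c : c = \sum_s l s * c by rewrite -mulr_suml l1 mul1r.
rewrite summxE; under eq_bigr do rewrite mxE.
rewrite [a 0 i]cst [b 0 i]cst.
by apply/andP; split; apply: lt_comb => j; have /andP[] := zab j i.
Qed.

Definition supported z x (T : {set S}) := exists l : S -> R,
  [/\ forall s, 0 <= l s, \sum_(s in T) l s = 1 & x = \sum_(s in T) l s *: z s].

(** Caratheodory's reduction: moving the weights along an affine dependency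
    until the first of them vanishes removes a point from the support. *)
Lemma supported_reduce z x (T : {set S}) (g : S -> R) :
  supported z x T -> \sum_(s in T) g s = 0 -> \sum_(s in T) g s *: z s = 0 ->
  (exists2 s, s \in T & g s != 0) ->
  exists2 s, s \in T & supported z x (T :\ s).
Proof.
move=> [l [l0 l1 xE]] g1 gz [s1 s1T gs1].
have [s2 /andP[s2T gs2]] : exists s, (s \in T) && (0 < g s).
  apply: contrapT => /forallNP ng.
  have gle s : s \in T -> 0 <= - g s.
    by move=> sT; rewrite oppr_ge0 leNgt; apply/negP => gs; apply: (ng s); rewrite sT.
  have /eqP : \sum_(s in T) - g s = 0 by rewrite sumrN g1 oppr0.
  rewrite psumr_eq0// => /allP/(_ s1); rewrite mem_index_enum => /(_ isT).
  by rewrite s1T/= oppr_eq0 (negbTE gs1).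
pose Q s := (s \in T) && (0 < g s).
have [s0 /andP[s0T gs0] s0min] :
    exists2 s, Q s & forall s', Q s' -> l s / g s <= l s' / g s'.
  case: (@arg_minP _ _ _ s2 Q (fun s => l s / g s)) => [|s Qs smin].
    by rewrite /Q s2T.
  by exists s.
(* The largest step that keeps all weights nonnegative. *)
exists s0 => //; pose c := l s0 / g s0.
have c0 : 0 <= c by rewrite divr_ge0// ltW.
have s0c : l s0 - c * g s0 = 0 by rewrite /c divfK ?subrr// gt_eqF.
exists (fun s => if s \in T then l s - c * g s else 0); split.
- move=> s; case: ifPn => // sT; rewrite subr_ge0.
  have [gs|gs] := ltP 0 (g s).
    by rewrite -ler_pdivlMr// s0min// /Q sT.
  by rewrite (le_trans _ (l0 s))// mulr_ge0_le0.
- transitivity (\sum_(s in T) (l s - c * g s)).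
    rewrite [RHS](big_setD1 s0)//= s0c add0r; apply: eq_bigr => s.
    by rewrite !inE => /andP[_ ->].
  by rewrite sumrB -mulr_sumr g1 mulr0 subr0.
- transitivity (\sum_(s in T) (l s - c * g s) *: z s); last first.
    rewrite (big_setD1 s0)//= s0c scale0r add0r; apply: eq_bigr => s.
    by rewrite !inE => /andP[_ ->].
  under eq_bigr do rewrite scalerBl -scalerA.
  by rewrite sumrB -scaler_sumr gz scaler0 subr0.
Qed.

(** A support of x of minimal size is affinely independent.  If it has at most d
    points, their affine hull contains x.  Otherwise it is an affine basis; y,
    lying outside the hull, has a negative barycentric coordinate, whereas that
    of x is nonnegative, so it vanishes at some point of the segment. *)
Lemma caratheodory_exit z x y : (d <= #|S|)%N -> hull z x -> ~ hull z y ->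
  exists (T : {set S}) (c : S -> R) (t : R),
    [/\ #|T| = d, 0 <= t <= 1, \sum_(s in T) c s = 1 &
        (1 - t) *: x + t *: y = \sum_(s in T) c s *: z s].
Proof.
move=> dS [l0 [l00 l01 l0x]] ny.
have suppT : supported z x [set: S].
  by exists l0; split => //; [rewrite -l01|rewrite l0x]; apply: eq_bigl => s; rewrite inE.
have [T /asboolP[l [lge0 l1 xE]] Tmin] : exists2 T : {set S}, `[< supported z x T >] &
    forall T' : {set S}, `[< supported z x T' >] -> (#|T| <= #|T'|)%N.
  case: (@arg_minnP _ [set: S]%SET (fun T : {set S} => `[< supported z x T >])
     (fun T : {set S} => #|T|)).
    exact/asboolP.
  by move=> T sT Tmin; exists T.
have [Td|dT] := leqP #|T| d.
  have [T' TT' T'd] : exists2 T' : {set S}, T \subset T' & #|T'| = d.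
    exact: subset_of_card.
  exists T', (fun s => if s \in T then l s else 0), 0; split => //.
  - by rewrite lexx ler01.
  - rewrite -big_mkcondr/= -[RHS]l1; apply: eq_bigl => s.
    by apply/andP/idP => [[]//|sT]; rewrite (fintype.subsetP TT').
  - rewrite subr0 scale1r scale0r addr0 [LHS]xE [RHS](big_setID T)/=.
    rewrite [X in _ + X]big1 ?addr0; last first.
      by move=> s; rewrite inE => /andP[/negbTE ->]; rewrite scale0r.
    by rewrite (finset.setIidPr TT'); apply: eq_bigr => s ->.
pose M : 'M[R]_(#|T|, d.+1) := \matrix_(i, j) hom (z (enum_val i)) 0 j.
have combE (g : S -> R) j : ((\row_i g (enum_val i)) *m M) 0 j =
    \sum_(s in T) g s * hom (z s) 0 j.
  rewrite mxE [RHS]big_enum_val/=; apply: eq_bigr => i _; by rewrite !mxE.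
have comb_sum (g : S -> R) v : (\row_i g (enum_val i)) *m M = hom v ->
    \sum_(s in T) g s = 1 /\ \sum_(s in T) g s *: z s = v.
  move=> gv; split.
    have := combE g ord0; rewrite gv hom0 => ->.
    by apply: eq_bigr => s _; rewrite hom0 mulr1.
  apply/rowP => i; have := combE g (lift ord0 i); rewrite gv homS => ->.
  by rewrite summxE; apply: eq_bigr => s _; rewrite homS mxE.
have rfree : row_free M.
  rewrite -kermx_eq0; apply/negPn/negP => /rowV0Pn[v /sub_kermxP vM v0].
  have /existsP[i vi] : [exists i, v 0 i != 0].
    rewrite -negb_forall; apply: contra v0 => /forallP v0.
    by apply/eqP/rowP => i; rewrite mxE; exact/eqP.
  pose g s := if [pick i | enum_val i == s] is Some i then v 0 i else 0.
  have gE i' : g (enum_val i') = v 0 i'.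
    rewrite /g; case: pickP => [i1 /eqP/enum_val_inj -> //|/(_ i')].
    by rewrite eqxx.
  have vE : v = \row_i g (enum_val i) by apply/rowP => i'; rewrite mxE gE.
  have [s sT sred] : exists2 s, s \in T & supported z x (T :\ s).
    apply: (@supported_reduce z x T g).
    - by exists l.
    - have := combE g ord0; rewrite -vE vM mxE => e; rewrite [RHS]e.
      by apply: eq_bigr => s _; rewrite hom0 mulr1.
    - apply/rowP => i'; have := combE g (lift ord0 i'); rewrite -vE vM !mxE => e.
      rewrite [RHS]e.
      by rewrite summxE; apply: eq_bigr => s _; rewrite homS mxE.
    - by exists (enum_val i); [exact: enum_valP|rewrite gE].
  by have := Tmin _ (asboolT sred); rewrite (cardsD1 s T) sT ltnn.
have Td : #|T| = d.+1.
  by apply/eqP; rewrite eqn_leq dT andbT -(eqP rfree) rank_leq_col.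
have rfull : row_full M by rewrite /row_full (eqP rfree) Td.
have /submxP[v vM] : (hom y <= M)%MS by rewrite submx_full.
pose g s := if [pick i | enum_val i == s] is Some i then v 0 i else 0.
have gE i' : g (enum_val i') = v 0 i'.
  rewrite /g; case: pickP => [i1 /eqP/enum_val_inj -> //|/(_ i')].
  by rewrite eqxx.
have vE : v = \row_i g (enum_val i) by apply/rowP => i'; rewrite mxE gE.
have [g1 gy] : \sum_(s in T) g s = 1 /\ \sum_(s in T) g s *: z s = y.
  by apply: comb_sum; rewrite -vE.
have [s0 s0T gs0] : exists2 s, s \in T & g s < 0.
  apply: contrapT => ng; apply: ny.
  exists (fun s => if s \in T then g s else 0); split.
  - move=> s; case: ifPn => // sT; rewrite leNgt; apply/negP => gs.
    by apply: ng; exists s.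
  - by rewrite -big_mkcond.
  - by rewrite -gy [LHS]big_mkcond/=; apply: eq_bigr => s _; case: ifP => // _; rewrite scale0r.
have lg : 0 < l s0 - g s0 by rewrite subr_gt0 (lt_le_trans gs0).
(* The barycentric coordinate of index s0 vanishes at this parameter. *)
pose t := l s0 / (l s0 - g s0).
have ts0 : (1 - t) * l s0 + t * g s0 = 0.
  by rewrite /t; field; rewrite gt_eqF.
have t01 : 0 <= t <= 1.
  apply/andP; split; first by rewrite divr_ge0// ltW.
  by rewrite ler_pdivrMr// mul1r lerDl oppr_ge0 ltW.
clearbody t.
exists (T :\ s0), (fun s => (1 - t) * l s + t * g s), t; split.
- by have := cardsD1 s0 T; rewrite s0T Td => -[].
- by [].
- transitivity (\sum_(s in T) ((1 - t) * l s + t * g s)).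
    by rewrite [RHS](big_setD1 s0)//= ts0 add0r.
  by rewrite big_split/= -!mulr_sumr l1 g1 !mulr1 subrK.
- transitivity (\sum_(s in T) ((1 - t) * l s + t * g s) *: z s).
    under [RHS]eq_bigr do rewrite scalerDl -!scalerA.
    by rewrite big_split/= -!scaler_sumr -xE gy.
  by rewrite (big_setD1 s0)//= ts0 scale0r add0r.
Qed.

Lemma hyperplane_through_affine z (T : {set S}) (c : S -> R) (A : set 'rV[R]_d) :
  \sum_(s in T) c s = 1 -> (forall s, s \in T -> A (z s)) ->
  hyperplane_through A (\sum_(s in T) c s *: z s).
Proof.
move=> c1 TA H [[a [b [_ HE]]] AH]; rewrite HE/=.
transitivity (\sum_(s in T) c s * \sum_i a 0 i * z s 0 i).
  under [RHS]eq_bigr do rewrite mulr_sumr.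
  rewrite [RHS]exchange_big/=; apply: eq_bigr => i _.
  by rewrite summxE mulr_sumr; apply: eq_bigr => s _; rewrite mxE mulrCA.
rewrite -[RHS]mul1r -c1 mulr_suml; apply: eq_bigr => s sT; congr (_ * _).
by have := AH _ (TA _ sT); rewrite HE.
Qed.

End convex_position.

Section orthants.
Context {R : realType} {d : nat}.
Implicit Types (x z : 'rV[R]_d) (sg : {ffun 'I_d -> bool}).

(** A single relation for both orders, so that an orthant is one conjunction
    and proofs about one sign serve for the other. *)
Definition slt (b : bool) (s t : R) : bool := if b then s < t else t < s.

Definition orthant sg x : set 'rV[R]_d :=
  [set z | forall i, slt (sg i) (x 0 i) (z 0 i)].

(** The coordinates are matched with those of x one after the other, by mixing
    two combinations that lie on either side of x in the current coordinate and
    on the same side in the remaining ones. *)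
Lemma hull_orthants x (z : {ffun 'I_d -> bool} -> 'rV[R]_d) :
  (forall sg, orthant sg x (z sg)) -> hull z x.
Proof.
move=> zo.
have step j : (j <= d)%N -> forall sg, exists2 w, hull z w & forall i : 'I_d,
    if (i < j)%N then w 0 i = x 0 i else
    if sg i then x 0 i < w 0 i else w 0 i < x 0 i.
  elim: j => [_|j IH jd] sg.
    by exists (z sg); [exact: hull_point|move=> i; exact: zo].
  pose jj := Ordinal jd.
  pose sgb b : {ffun 'I_d -> bool} := [ffun i => if i == jj then b else sg i].
  have [wp hwp wpE] := IH (ltnW jd) (sgb true).
  have [wm hwm wmE] := IH (ltnW jd) (sgb false).
  have := wpE jj; have := wmE jj; rewrite ltnn !ffunE eqxx => wmj wpj.
  have pm : 0 < wp 0 jj - wm 0 jj by rewrite subr_gt0 (lt_trans wmj).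
  pose t := (wp 0 jj - x 0 jj) / (wp 0 jj - wm 0 jj).
  have t0 : 0 <= t by rewrite divr_ge0// subr_ge0 ltW// -subr_gt0.
  have t1 : t <= 1.
    by rewrite ler_pdivrMr// mul1r lerB// ltW.
  exists ((1 - t) *: wp + t *: wm).
    by apply: hull_conv => //; rewrite t0.
  move=> i; rewrite ltnS leq_eqVlt -[(i : nat) == j]/(i == jj) !mxE.
  have [->|ij] /= := eqVneq i jj.
    by rewrite /t; field; rewrite gt_eqF.
  have := wpE i; have := wmE i; rewrite !ffunE (negbTE ij).
  case: ltnP => _; first by move=> -> ->; rewrite -mulrDl subrK mul1r.
  have s0 : 0 <= 1 - t by rewrite subr_ge0.
  have [t_eq0|t_neq0] := eqVneq t 0; first by rewrite t_eq0 subr0 mul1r mul0r addr0.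
  have t_gt0 : 0 < t by rewrite lt_neqAle eq_sym t_neq0.
  case: (sg i) => h1 h2.
    have : 0 < t * (wm 0 i - x 0 i) by rewrite mulr_gt0// subr_gt0.
    have : 0 <= (1 - t) * (wp 0 i - x 0 i) by rewrite mulr_ge0// subr_ge0 ltW.
    by move=> *; lra.
  have : 0 < t * (x 0 i - wm 0 i) by rewrite mulr_gt0// subr_gt0.
  have : 0 <= (1 - t) * (x 0 i - wp 0 i) by rewrite mulr_ge0// subr_ge0 ltW.
  by move=> *; lra.
have [w hw wE] := step d (leqnn d) [ffun=> true].
suff -> : x = w by [].
by apply/rowP => i; have := wE i; rewrite ltn_ord.
Qed.

Lemma orthant_disjoint x z sg sg' : orthant sg x z -> orthant sg' x z -> sg = sg'.
Proof.
move=> h h'; apply/ffunP => i; have := h i; have := h' i; rewrite /slt.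
by case: (sg i); case: (sg' i) => // a /(lt_trans a); rewrite ltxx.
Qed.

End orthants.

(** * Counting separating hyperplanes and selecting nearest indices *)

Lemma leq_card_bigcup (I T : finType) (P : pred I) (F : I -> {set T}) :
  (#|(\bigcup_(i | P i) F i)%SET| <= \sum_(i | P i) #|F i|)%N.
Proof.
elim/big_rec2: _ => [|i m A _ Am]; first by rewrite cards0.
by rewrite (leq_trans (leq_card_setU _ _).1)// leq_add2l.
Qed.

Section separation_count.
Context {R : realType} {d : nat}.
Implicit Types (x y : 'rV[R]_d) (xs : nat -> 'rV[R]_d) (n : nat).

Definition separates xs n (I : {set 'I_n}) x y : bool :=
  `[< line_segment x y `&`
      hyperplane_through [set xs i | i in [set` I]] !=set0 >].

Lemma empirical_distanceE xs n x y :
  empirical_distance xs n x y =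
    #|[set I : {set 'I_n} | (#|I| == d) && separates xs I x y]%SET|.
Proof.
rewrite /empirical_distance -sum1_card [RHS](eq_bigl
  (fun I : {set 'I_n} => (#|I| == d) && separates xs I x y)); last first.
  by move=> I; rewrite inE.
rewrite big_mkcondr/=; apply: eq_bigr => I _.
by rewrite /separates; case: asboolP.
Qed.

Let S := {ffun 'I_d -> bool}.

Lemma leq_card_orthants : (d <= #|{: S}|)%N.
Proof. by rewrite card_ffun card_bool card_ord ltnW// ltn_expl. Qed.

Lemma selection_separates xs n x y (a b : 'rV[R]_d) (s : S -> 'I_n) :
  (forall sg, orthant sg x (xs (s sg))) ->
  (forall sg i, a 0 i < xs (s sg) 0 i < b 0 i) ->
  ~ (forall i, a 0 i < y 0 i < b 0 i) ->
  exists T : {set S}, [/\ #|T| = d, #|s @: T| = d & separates xs (s @: T) x y].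
Proof.
move=> so sab yab; pose z sg := xs (s sg).
have xz : hull z x by exact: hull_orthants.
have yz : ~ hull z y by move=> hy; apply: yab; exact: (hull_box sab).
have [T [c [t [Td t01 c1 cE]]]] := caratheodory_exit leq_card_orthants xz yz.
have s_inj : injective s.
  move=> g g' gg'; apply: (@orthant_disjoint _ _ x (xs (s g))); first exact: so.
  by rewrite gg'; exact: so.
exists T; split; rewrite ?card_imset//; apply/asboolP.
exists ((1 - t) *: x + t *: y); split; first by exists t.
rewrite cE; apply: hyperplane_through_affine => // g gT.
by exists (s g) => //=; exact: imset_f.
Qed.

Lemma card_selections_through (n : nat) (T : {set S}) (I : {set 'I_n}) :
  #|[set s : {ffun S -> 'I_n} | [forall g in T, s g \in I]]%SET| =
  (#|I| ^ #|T| * n ^ (#|{: S}| - #|T|))%N.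
Proof.
pose F g : pred 'I_n := fun i => (g \in T) ==> (i \in I).
transitivity #|(family F : simpl_pred {ffun S -> 'I_n})|.
  by apply: eq_card => s; rewrite inE; apply/forallP/familyP => h g; exact: h.
rewrite card_family foldrE big_map big_enum/=.
rewrite (bigID (mem T))/= (eq_bigr (fun=> #|I|)); last first.
  by move=> g gT; apply: eq_card => i; rewrite [LHS]/(F g i) /F gT.
rewrite prod_nat_const; congr (_ * _)%N.
rewrite (eq_bigr (fun=> n)) => [|g /negbTE gT]; last first.
  by rewrite -[RHS]card_ord; apply: eq_card => i; rewrite [LHS]/(F g i) /F gT.
rewrite prod_nat_const; congr (_ ^ _)%N.
by rewrite -(cardsC T) addKn; apply: eq_card => g; rewrite !inE.
Qed.

(** Every choice of one index per orthant yields d of the chosen points whose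
    hyperplane separates x from y.  Conversely, for a fixed set of d orthants, a
    given set of d indices arises from at most d^d n^(2^d - d) choices, and there
    are at most 2^(2^d) sets of orthants. *)
Lemma far_separated xs n x y (a b : 'rV[R]_d) (N : S -> {set 'I_n}) :
  (forall sg i, i \in N sg -> orthant sg x (xs i)) ->
  (forall sg i, i \in N sg -> forall j, a 0 j < xs i 0 j < b 0 j) ->
  ~ (forall j, a 0 j < y 0 j < b 0 j) ->
  (\prod_sg #|N sg| <= 2 ^ #|{: S}| * (empirical_distance xs n x y *
     (d ^ d * n ^ (#|{: S}| - d))))%N.
Proof.
move=> No Nab yab; rewrite empirical_distanceE; set sep := [set I | _]%SET.
have -> : (\prod_sg #|N sg| = #|(family (fun g => mem (N g)) : simpl_pred {ffun S -> 'I_n})|)%N.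
  by rewrite card_family foldrE big_map -big_enum/=; apply: eq_bigr.
pose Sel (T : {set S}) (I : {set 'I_n}) :=
  [set s : {ffun S -> 'I_n} | [forall g in T, s g \in I]]%SET.
apply: (@leq_trans #|(\bigcup_(T : {set S} | #|T| == d) \bigcup_(I in sep) Sel T I)%SET|).
  apply/subset_leq_card/fintype.subsetP => s /familyP sN.
  have [||T [Td sTd sT]] := @selection_separates xs n x y a b s _ _ yab.
  - by move=> g; apply: No; exact: sN.
  - by move=> g; apply: Nab; exact: sN.
  apply/finset.bigcupP; exists T; first exact/eqP.
  apply/finset.bigcupP; exists (s @: T); first by rewrite inE sTd eqxx.
  by rewrite inE; apply/forallP => g; apply/implyP => gT; exact: imset_f.
apply: (leq_trans (leq_card_bigcup _ _)).
have -> : (2 ^ #|{: S}| = #|{: {set S}}|)%N.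
  by rewrite -cardsT -card_powerset; apply: eq_card => T; rewrite !inE finset.subsetT.
apply: (@leq_trans (\sum_(T : {set S}) (#|sep| * (d ^ d * n ^ (#|{: S}| - d))))%N); last first.
  by rewrite sum_nat_const.
rewrite [leqRHS](bigID (fun T : {set S} => #|T| == d))/=.
rewrite -[leqLHS]addn0 leq_add//; apply: leq_sum => T /eqP Td.
apply: (leq_trans (leq_card_bigcup _ _)); rewrite -sum_nat_const.
apply: leq_sum => I; rewrite inE => /andP[/eqP Id _].
by rewrite card_selections_through Td Id.
Qed.

End separation_count.

Section nearest_indices.
Implicit Types (rho : nat -> nat) (n k : nat).

Definition rank_le rho : rel nat := fun i j =>
  (rho i < rho j)%N || (rho i == rho j) && (i <= j)%N.

Definition nearest rho n k : seq nat := take k (sort (rank_le rho) (iota 0 n)).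

Lemma rank_le_total rho : total (rank_le rho).
Proof. by move=> i j; rewrite /rank_le; case: ltngtP => //= _; exact: leq_total. Qed.

Lemma rank_le_trans rho : transitive (rank_le rho).
Proof.
move=> j i l; rewrite /rank_le => /orP[ij|/andP[/eqP -> ij]] /orP[jl|/andP[/eqP jl1 jl]].
- by rewrite (ltn_trans ij jl).
- by rewrite -jl1 ij.
- by rewrite jl.
- by rewrite jl1 eqxx (leq_trans ij jl) orbT.
Qed.

Lemma rank_le_anti rho : antisymmetric (rank_le rho).
Proof.
by move=> i j; rewrite /rank_le; case: ltngtP => //= _ ij; apply/eqP; rewrite eqn_leq.
Qed.

Lemma eq_nearest rho rho' n k : (forall i, (i < n)%N -> rho i = rho' i) ->
  nearest rho n k = nearest rho' n k.
Proof.
move=> rr; congr (take k _).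
apply: (sorted_eq (@rank_le_trans rho) (@rank_le_anti rho)).
- exact/sort_sorted/rank_le_total.
- rewrite (@eq_in_sorted _ (fun i => i < n)%N _ (rank_le rho')).
  + exact/sort_sorted/rank_le_total.
  + by move=> i j ni nj; rewrite /rank_le !rr.
  + by apply/allP => i; rewrite mem_sort mem_iota.
- by rewrite perm_sort perm_sym perm_sort.
Qed.

Lemma nearest_uniq rho n k : uniq (nearest rho n k).
Proof. by rewrite take_uniq// sort_uniq iota_uniq. Qed.

Lemma mem_nearest rho n k i : i \in nearest rho n k -> (i < n)%N.
Proof. by move=> /mem_take; rewrite mem_sort mem_iota. Qed.

Lemma size_nearest rho n k : (k <= n)%N -> size (nearest rho n k) = k.
Proof. by move=> kn; rewrite size_takel// size_sort size_iota. Qed.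

Lemma big_nearest (V : nmodType) (F : nat -> V) rho n k :
  \sum_(i <- nearest rho n k) F i = \sum_(i < n | (i : nat) \in nearest rho n k) F i.
Proof.
rewrite -(big_mkord (fun i => i \in nearest rho n k)) -big_filter.
apply/perm_big/uniq_perm; rewrite ?nearest_uniq ?filter_uniq ?iota_uniq//.
move=> i; rewrite mem_filter mem_index_iota/=; case: (boolP (i \in _)) => //=.
by move/mem_nearest ->.
Qed.

Lemma take_sorted_all (T : Type) (leT : rel T) (P : pred T) s k :
  transitive leT -> (forall i j, leT i j -> P j -> P i) ->
  sorted leT s -> (k <= count P s)%N -> all P (take k s).
Proof.
move=> leT_tr Pdown; elim: s k => [|i s IH] [|k]//= ps.
case: (boolP (P i)) => [Pi|nPi].
  by rewrite add1n ltnS => kc; rewrite IH// (path_sorted ps).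
rewrite add0n; suff -> : count P s = 0%N by [].
have := order_path_min leT_tr ps; elim: s {IH ps} => //= j s IH /andP[ij js].
by rewrite IH// addn0; case: (boolP (P j)) => // /(Pdown _ _ ij); rewrite (negbTE nPi).
Qed.

Lemma nearest_small rho n k L : (k <= \sum_(i < n) (rho i < L))%N ->
  forall i, i \in nearest rho n k -> (rho i < L)%N.
Proof.
rewrite -(big_mkord predT (fun i => (rho i < L) : nat)) /index_iota subn0.
rewrite (eq_bigr (fun i => if (rho i < L)%N then 1%N else 0%N)) => [|i _]; last by case: ifP.
rewrite -big_mkcond/= sum1_count => kc; apply/allP.
apply: (take_sorted_all (@rank_le_trans rho)).
- by move=> i j /orP[ij|/andP[/eqP -> _]]//; exact: ltn_trans.
- exact/sort_sorted/rank_le_total.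
- by rewrite count_sort.
Qed.

Lemma knn_estimateE (R : realType) (d : nat) (xs : nat -> 'rV[R]_d) ys n k x :
  (k <= n)%N -> knn_estimate xs ys n k x = k%:R^-1 *
   \sum_(i <- nearest (fun i => empirical_distance xs n x (xs i)) n k) ys i.
Proof.
move=> kn; rewrite /knn_estimate; congr (_ * _).
rewrite (big_nth 0%N) size_nearest// big_mkord; apply: eq_bigr => i _.
by rewrite nth_take.
Qed.

End nearest_indices.

(** * Lebesgue-null sets *)

Section null_sections.
Context {d1 d2 : measure_display} {T1 : measurableType d1} {T2 : measurableType d2}
  {R : realType}.
Variables (m1 : {sigma_finite_measure set T1 -> \bar R})
          (m2 : {sigma_finite_measure set T2 -> \bar R}).
Implicit Types A : set (T1 * T2).
Local Open Scope ereal_scope.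

Lemma integral_eq0_ae d (T : measurableType d) (m : {measure set T -> \bar R})
    (D : set T) (f : T -> \bar R) :
  measurable D -> measurable_fun D f -> (forall x, D x -> 0 <= f x) ->
  (\int[m]_(x in D) f x = 0) <-> {ae m, forall x, D x -> f x = 0}.
Proof.
move=> mD mf f0; have := ae_eq_integral_abs m mD mf.
rewrite (eq_integral f)//; move=> x; rewrite inE => Dx.
by rewrite gee0_abs// f0.
Qed.

Lemma measurable_xslice A x : measurable A -> measurable [set y | A (x, y)].
Proof. by move=> /(measurable_xsection x); rewrite xsectionE. Qed.

Lemma measurable_yslice A y : measurable A -> measurable [set x | A (x, y)].
Proof. by move=> /(measurable_ysection y); rewrite ysectionE. Qed.

Lemma measurable_fun_measure_xsection A : measurable A ->
  measurable_fun setT (fun x => m2 [set y | A (x, y)]).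
Proof.
move=> mA; apply: (eq_measurable_fun (m2 \o xsection A)).
  by move=> x _ /=; rewrite xsectionE.
exact: measurable_fun_xsection.
Qed.

Lemma measurable_fun_measure_ysection A : measurable A ->
  measurable_fun setT (fun y => m1 [set x | A (x, y)]).
Proof.
move=> mA; apply: (eq_measurable_fun (m1 \o ysection A)).
  by move=> x _ /=; rewrite ysectionE.
exact: measurable_fun_ysection.
Qed.

Lemma product_null_xsection A : measurable A ->
  (m1 \x m2) A = 0 <-> {ae m1, forall x, m2 [set y | A (x, y)] = 0}.
Proof.
move=> mA; rewrite /product_measure1/=.
under eq_integral do rewrite xsectionE.
rewrite integral_eq0_ae//; last exact: measurable_fun_measure_xsection.
by split; apply: filterS => x /=; [apply|move=> + _].
Qed.

Lemma product_null_ysection A : measurable A ->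
  (m1 \x m2) A = 0 <-> {ae m2, forall y, m1 [set x | A (x, y)] = 0}.
Proof.
move=> mA.
have -> : (m1 \x m2) A = \int[m2]_y m1 [set x | A (x, y)].
  rewrite (@product_measure_unique _ _ _ _ _ m1 m2 (m1 \x^ m2))//.
    by apply: eq_integral => y _ /=; rewrite ysectionE.
  by move=> B C mB mC; exact: product_measure2E.
rewrite integral_eq0_ae//; last exact: measurable_fun_measure_ysection.
by split; apply: filterS => x /=; [apply|move=> + _].
Qed.

End null_sections.

Lemma measurable_preimageT d d' (T : measurableType d) (T' : measurableType d')
    (f : T -> T') (A : set T') :
  measurable_fun setT f -> measurable A -> measurable (f @^-1` A).
Proof. by move=> mf mA; rewrite -[X in measurable X]setTI; exact: mf. Qed.

Lemma measurable_forall (n : nat) d (T : measurableType d) (A : 'I_n -> set T) :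
  (forall i, measurable (A i)) -> measurable [set x | forall i, A i x].
Proof.
move=> mA; rewrite (_ : [set x | _] = \bigcap_(i in [set: 'I_n]) A i).
  by apply: fin_bigcap_measurable.
by apply/seteqP; split=> x /= h i => [_|]; exact: h.
Qed.

Section order_by_sign.
Context {R : realType}.

Lemma slt_dense b (s t : R) : slt b s t -> exists q : rat, slt b s (ratr q) && slt b (ratr q) t.
Proof.
case: b => /= /rat_in_itvoo[q]; rewrite in_itv/= => h; exists q => //.
by rewrite andbC.
Qed.

Lemma slt_trans b : transitive (@slt R b).
Proof. by case: b => t s u /= h1 h2; [exact: lt_trans h2|exact: lt_trans h1]. Qed.

Lemma slt_total b (s t : R) : ~~ slt b t s -> ~~ slt b s t -> s = t.
Proof.
by case: b => /=; rewrite -!leNgt => h1 h2; apply/eqP; rewrite eq_le h1 h2.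
Qed.

Lemma measurable_slt d (T : measurableType d) b (f g : T -> R) :
  measurable_fun setT f -> measurable_fun setT g ->
  measurable [set w | slt b (f w) (g w)].
Proof.
move=> mf mg; case: b => /=.
- by apply: (measurable_preimageT (A := [set true]) (measurable_fun_ltr mf mg)).
- by apply: (measurable_preimageT (A := [set true]) (measurable_fun_ltr mg mf)).
Qed.

(** Apart from its extremal point, if any, each point t of the set lies beyond a
    rational q which itself lies beyond another point of the set; the part of A
    beyond q is then null, and there are countably many q. *)
Lemma half_line_null (A : set R) b : measurable A ->
  lebesgue_measure.-negligible
    [set t | A t /\ lebesgue_measure (A `&` [set s | slt b t s]) = 0%E].
Proof.
move=> mA; set D := [set t | _].
pose E (q : rat) := if `[< exists2 t, D t & slt b t (ratr q) >] then
  A `&` [set s | slt b (ratr q) s] else set0.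
have E0 q : lebesgue_measure.-negligible (E q).
  rewrite /E; case: asboolP => [[t [At tA] tq]|_]; last exact: negligible_set0.
  exists (A `&` [set s | slt b t s]); split => //.
    apply: measurableI => //.
    by apply: (measurable_slt b (f := cst t) (g := id)).
  by move=> s [As qs]; split=> //; exact: slt_trans qs.
pose M := [set t | D t /\ forall s, D s -> ~~ slt b s t].
have M0 : lebesgue_measure.-negligible M.
  have [[t Mt]|nM] := pselect (M !=set0); last first.
    rewrite (_ : M = set0); first exact: negligible_set0.
    by apply/seteqP; split=> // t Mt; apply: nM; exists t.
  exists [set t]; split => //; first exact: lebesgue_measure_set1.
  move=> s Ms /=; have [Dt tm] := Mt; have [Ds sm] := Ms.
  exact: slt_total (sm _ Dt) (tm _ Ds) .
have DE : D `<=` M `|` \bigcup_n (if unpickle n is Some q then E q else set0).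
  move=> t Dt; have [Mt|nMt] := pselect (M t); [by left|right].
  have [s Ds st] : exists2 s, D s & slt b s t.
    by apply: contrapT => ns; apply: nMt; split=> // s Ds; apply/negP => st; apply: ns; exists s.
  have [q /andP[sq qt]] := slt_dense st.
  exists (pickle q); first by [].
  rewrite pickleK /E; case: asboolP => [_|[]]; last by exists s.
  by split=> //; case: Dt.
have [N [mN N0 MN]] : lebesgue_measure.-negligible
    (M `|` \bigcup_n (if unpickle n is Some q then E q else set0)).
  apply: negligibleU => //; apply: negligible_bigcup => n.
  by case: (unpickle n) => [q|]; [exact: E0|exact: negligible_set0].
by exists N; split=> // t Dt; exact: MN (DE _ Dt).
Qed.

End order_by_sign.

Section lebesgue_rV_null.
Context {R : realType}.
Local Notation leb := (@lebesgue_measure R).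

Lemma measurable_rV_consA n (A : set 'rV[R]_n.+1) : measurable A ->
  measurable (@rV_cons R n @^-1` A).
Proof. by move=> mA; apply: measurable_preimageT mA; exact: measurable_rV_cons. Qed.

Lemma lebesgue_rVS n (A : set 'rV[R]_n.+1) :
  lebesgue_rV R n.+1 A = (leb \x lebesgue_rV R n)%E (@rV_cons R n @^-1` A).
Proof. by []. Qed.

Lemma rV_cons0 n (x : R * 'rV[R]_n) : rV_cons x 0 ord0 = x.1.
Proof. by rewrite mxE unlift_none. Qed.

Lemma rV_consS n (x : R * 'rV[R]_n) i : rV_cons x 0 (lift ord0 i) = x.2 0 i.
Proof. by rewrite mxE liftK. Qed.

Lemma measurable_affine n (c0 : R) (c : 'rV[R]_n) :
  measurable_fun setT (fun z : 'rV[R]_n => c0 + \sum_i c 0 i * z 0 i).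
Proof.
apply: measurable_funD => //; apply: measurable_sum => i.
by apply: measurable_funM => //; exact: (measurable_rV_coord (T := R)).
Qed.

(** By Tonelli's theorem: along the first coordinate the sections are single
    points if its coefficient is nonzero; otherwise the sections at a fixed first
    coordinate are hyperplanes, or empty sets, in one dimension less. *)
Lemma lebesgue_rV_hyperplane n (c0 : R) (c : 'rV[R]_n) : (c0 != 0) || (c != 0) ->
  lebesgue_rV R n [set z | c0 + \sum_i c 0 i * z 0 i = 0] = 0%E.
Proof.
have mH m (a0 : R) (a : 'rV[R]_m) : measurable [set z : 'rV[R]_m | a0 + \sum_i a 0 i * z 0 i = 0].
  exact: (measurable_preimageT (measurable_affine a0 a) (measurable_set1 0)).
elim: n => [|n IH] in c0 c *.
  rewrite (_ : c = 0) ?eqxx ?orbF => [c00|]; last by apply/rowP => -[].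
  rewrite (_ : [set z | _] = set0) ?measure0//; apply/seteqP; split=> // z /=.
  by rewrite big_ord0 addr0 => c0E; rewrite c0E eqxx in c00.
move=> c0c; rewrite lebesgue_rVS.
have mA := measurable_rV_consA (mH _ c0 c).
pose c' : 'rV[R]_n := \row_j c 0 (lift ord0 j).
have sumE t v : c0 + \sum_i c 0 i * rV_cons (t, v) 0 i =
    (c0 + c 0 ord0 * t) + \sum_i c' 0 i * v 0 i.
  rewrite big_ord_recl rV_cons0 addrA; congr (_ + _).
  by apply: eq_bigr => i _; rewrite rV_consS mxE.
have [ch|ch] := eqVneq (c 0 ord0) 0.
  apply/product_null_xsection => //; apply: aeW => t /=.
  transitivity (lebesgue_rV R n [set v | c0 + \sum_i c' 0 i * v 0 i = 0]).
    by congr (lebesgue_rV R n _); apply/seteqP; split=> v /=; rewrite sumE ch mul0r addr0.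
  apply: IH; case/orP: c0c => [->//|cn0]; apply/orP; right.
  apply: contraNneq cn0 => /rowP c'0; apply/eqP/rowP => i; rewrite [RHS]mxE.
  by case: (unliftP ord0 i) => [j|] -> //; have := c'0 j; rewrite !mxE.
apply/product_null_ysection => //; apply: aeW => v.
apply: (subset_measure0 (measurable_yslice v mA)
  (measurable_set1 (- (c0 + \sum_i c' 0 i * v 0 i) / c 0 ord0))).
  move=> t; rewrite /= sumE => /eqP e.
  have {}e : c 0 ord0 * t = - (c0 + \sum_i c' 0 i * v 0 i).
    by apply/eqP; rewrite -addr_eq0 addrA (addrC _ c0).
  by rewrite -e mulrAC mulfV// mul1r.
exact: lebesgue_measure_set1.
Qed.

Lemma measurable_orthant_rel n (sg : {ffun 'I_n -> bool}) d (T : measurableType d)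
    (f g : T -> 'rV[R]_n) : measurable_fun setT f -> measurable_fun setT g ->
  measurable [set w | orthant sg (f w) (g w)].
Proof.
move=> mf mg; apply: measurable_forall => i.
have mc h : measurable_fun setT h -> measurable_fun setT (fun w : T => (h w : 'rV[R]_n) 0 i).
  move=> mh; exact: (measurableT_comp (measurable_rV_coord (T := R) i) mh).
exact: (measurable_slt (sg i) (mc _ mf) (mc _ mg)).
Qed.

Lemma measurable_nonzero d (T : measurableType d) (f : T -> \bar R) :
  measurable_fun setT f -> measurable [set x | f x <> 0%E].
Proof.
move=> mf; rewrite (_ : [set x | _] = f @^-1` (~` [set 0%E])); last by [].
by apply: measurable_preimageT => //; apply: measurableC.
Qed.

Lemma measurable_zero d (T : measurableType d) (f : T -> \bar R) :
  measurable_fun setT f -> measurable [set x | f x = 0%E].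
Proof. by move=> mf; exact: (measurable_preimageT mf (emeasurable_set1 0%E)). Qed.

Lemma measurable_orthant_measure n (sg : {ffun 'I_n -> bool}) (A : set 'rV[R]_n) :
  measurable A ->
  measurable_fun setT (fun x => lebesgue_rV R n (A `&` orthant sg x)).
Proof.
move=> mA; apply: (measurable_fun_measure_xsection (lebesgue_rV R n)
   (A := [set xz : 'rV[R]_n * 'rV[R]_n | A xz.2 /\ orthant sg xz.1 xz.2])).
apply: measurableI; first exact: measurable_preimageT measurable_snd mA.
by apply: measurable_orthant_rel; [exact: measurable_fst|exact: measurable_snd].
Qed.

(** Almost every point of A sees mass of A in each open orthant; this takes the
    place of Lebesgue's density theorem.  Write a point as (t, z) and let h(t, z)
    be the length of the part of the fibre of A over z that lies beyond t.  By
    [half_line_null], h is positive at almost every point of A.  For fixed t,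
    induction applies to the set of z with h(t, z) > 0: almost all of its points
    see mass of it in the orthant, and integrating h over that part shows that A
    has mass in the orthant at (t, z). *)
Lemma lebesgue_rV_orthant n (sg : {ffun 'I_n -> bool}) (A : set 'rV[R]_n) :
  measurable A ->
  lebesgue_rV R n [set x | A x /\ lebesgue_rV R n (A `&` orthant sg x) = 0%E] = 0%E.
Proof.
elim: n => [|n IH] in sg A *.
  move=> mA; have [[x Ax]|nA] := pselect (A !=set0); last first.
    rewrite (_ : [set x | _] = set0) ?measure0//.
    by apply/seteqP; split=> // x [Ax _]; apply: nA; exists x.
  have oT y : orthant sg y = setT by apply/seteqP; split=> // z _ [].
  have [A0|A0] := pselect (lebesgue_rV R 0 A = 0%E).
    rewrite (_ : [set x | _] = A)//.
    by apply/seteqP; split=> z => [[]//|Az]; split=> //; rewrite oT setIT.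
  rewrite (_ : [set x | _] = set0) ?measure0//.
  by apply/seteqP; split=> // z [_]; rewrite oT setIT.
move=> mA; rewrite lebesgue_rVS.
set B := [set x | _].
have mB : measurable B.
  by apply: measurableI => //; apply: measurable_zero; exact: measurable_orthant_measure.
have mA' := measurable_rV_consA mA; have mB' := measurable_rV_consA mB.
set A' := _ @^-1` A in mA'; set B' := _ @^-1` B in mB' *.
pose sg' : {ffun 'I_n -> bool} := [ffun j => sg (lift ord0 j)].
pose b := sg ord0.
have orthE (q p : R * 'rV[R]_n) : orthant sg (rV_cons q) (rV_cons p) <->
    (slt b q.1 p.1 /\ orthant sg' q.2 p.2).
  split=> [ho|[ho0 ho1] i].
    split; first by have := ho ord0; rewrite !rV_cons0.
    by move=> i; have := ho (lift ord0 i); rewrite !rV_consS ffunE.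
  case: (unliftP ord0 i) => [j|] ->; last by rewrite !rV_cons0.
  by have := ho1 j; rewrite !rV_consS ffunE.
pose h (q : measurableTypeR R * 'rV[R]_n) := leb [set s | A' (s, q.2) /\ slt b q.1 s].
have mh : measurable_fun setT h.
  apply: (measurable_fun_measure_xsection leb
    (A := [set w : (measurableTypeR R * 'rV[R]_n) * measurableTypeR R |
             A' (w.2, w.1.2) /\ slt b w.1.1 w.2])).
  apply: measurableI; last first.
    apply: measurable_slt; last exact: measurable_snd.
    by apply: measurableT_comp; exact: measurable_fst.
  apply: (measurable_preimageT _ mA'); apply: measurable_fun_pair; first exact: measurable_snd.
  by apply: (measurableT_comp measurable_snd); exact: measurable_fst.
pose N1 := [set q | A' q /\ h q = 0%E].
have mN1 : measurable N1 by apply: measurableI => //; exact: measurable_zero.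
pose g q := lebesgue_rV R n [set z | h (q.1, z) <> 0%E /\ orthant sg' q.2 z].
have mgS : measurable [set w : (measurableTypeR R * 'rV[R]_n) * 'rV[R]_n |
             h (w.1.1, w.2) <> 0%E /\ orthant sg' w.1.2 w.2].
  apply: measurableI.
    apply: measurable_nonzero; apply: (measurableT_comp mh).
    apply: measurable_fun_pair; last exact: measurable_snd.
    by apply: (measurableT_comp measurable_fst); exact: measurable_fst.
  apply: measurable_orthant_rel; last exact: measurable_snd.
  by apply: (measurableT_comp measurable_snd); exact: measurable_fst.
have mg : measurable_fun setT g.
  exact: (measurable_fun_measure_xsection (lebesgue_rV R n) mgS).
pose N2 := [set q | h q <> 0%E /\ g q = 0%E].
have mN2 : measurable N2.
  by apply: measurableI; [exact: measurable_nonzero|exact: measurable_zero].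
apply: (@subset_measure0 _ _ _ _ _ (N1 `|` N2)) => //.
- exact: measurableU.
- move=> q [Aq oq]; have [hq|hq] := pselect (h q = 0%E); first by left.
  right; split=> //; move: oq; rewrite lebesgue_rVS => /product_null_ysection oq.
  have mAo : measurable (A `&` orthant sg (rV_cons q)).
    apply: measurableI => //.
    exact: (measurable_orthant_rel sg (f := cst (rV_cons q)) (g := id)).
  have [N [mN N0 Nsub]] := oq (measurable_rV_consA mAo).
  apply: (subset_measure0 _ mN _ N0).
    exact: (measurable_xslice q mgS).
  move=> z [hz oz]; apply: Nsub => /=; rewrite -[leb _]/(leb _) => h0; apply: hz.
  rewrite -h0; congr (leb _); apply/seteqP; split => s /=.
    by move=> [As qs]; split=> //; apply/orthE.
  by move=> [As /orthE[qs _]].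
- apply: null_set_setU => //.
    apply/product_null_ysection => //; apply: aeW => v /=.
    apply: measure_negligible.
      exact: (measurable_yslice v mN1).
    apply: (half_line_null (A := [set s | A' (s, v)]) b).
    exact: (measurable_yslice v mA').
  apply/product_null_xsection => //; apply: aeW => t /=.
  apply: (IH sg' [set z | h (t, z) <> 0%E]).
  by apply: measurable_nonzero; apply: (measurableT_comp mh); exact: measurable_pair1.
Qed.

End lebesgue_rV_null.

(** * Independent families and resampling of one coordinate *)

Lemma probability_setT_lty d (T : measurableType d) (R : realType)
  (P : probability T R) : (P setT < +oo)%E.
Proof. by rewrite probability_setT ltry. Qed.

Section image_measure.
Context {d1 d2 : measure_display} {T1 : measurableType d1} {T2 : measurableType d2}
  {R : realType}.

Definition image_measure (m : {measure set T1 -> \bar R}) (f : T1 -> T2)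
    (mf : measurable_fun setT f) : {measure set T2 -> \bar R} :=
  measure_function_pushforward__canonical__measure_function_Measure m mf.

Lemma image_measureE m f (mf : measurable_fun setT f) A :
  image_measure m mf A = m (f @^-1` A).
Proof. by []. Qed.

End image_measure.

Section rectangles.
Context {disp : measure_display} {T : measurableType disp} {R : realType} {m : nat}.

Definition rectangle (A : 'I_m -> set T) : set 'rV[T]_m := [set v | forall i, A i (v 0 i)].

Lemma measurable_rectangle (A : 'I_m -> set T) :
  (forall i, measurable (A i)) -> measurable (rectangle A).
Proof.
move=> mA; apply: (measurable_forall (A := fun i => [set v : 'rV[T]_m | A i (v 0 i)])) => i.
exact: measurable_preimageT (measurable_rV_coord i) (mA i).
Qed.

(** Rectangles are stable under intersection and generate the sigma-algebra. *)
Lemma eq_measure_rectangle (m1 m2 : {measure set 'rV[T]_m -> \bar R}) :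
  (m1 setT < +oo)%E ->
  (forall A, (forall i, measurable (A i)) -> m1 (rectangle A) = m2 (rectangle A)) ->
  forall S, measurable S -> m1 S = m2 S.
Proof.
move=> m1oo m12 S mS.
pose C := [set B | exists2 A : 'I_m -> set T, forall i, measurable (A i) & B = rectangle A].
have CT : C setT.
  by exists (fun=> setT) => //; apply/seteqP; split.
apply: (measure_unique C (fun=> setT)) => //.
- rewrite eqEsubset; split.
    apply: smallest_sub; first exact: smallest_sigma_algebra.
    move=> B; rewrite -bigcup_seq => -[i _ [A mA <-]]; apply: sub_sigma_algebra.
    exists (fun j => if j == i then A else setT).
      by move=> j; case: ifP.
    apply/seteqP; split=> v /=.
      by move=> [_ Av] j; case: eqP => [->|].
    by move=> /(_ i); rewrite eqxx.
  apply: smallest_sub; first exact: sigma_algebra_measurable.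
  by move=> _ [A mA ->]; exact: measurable_rectangle.
- move=> _ _ [A mA ->] [B mB ->]; exists (fun i => A i `&` B i).
    by move=> i; exact: measurableI.
  by apply/seteqP; split=> v /= => [[Av Bv] i|ABv]; [split|split=> i; have [] := ABv i].
- by apply/seteqP; split=> // v _; exists 0%N.
- by move=> _ [A mA ->]; exact: m12.
Qed.

Definition update (j : 'I_m) (v : 'rV[T]_m) (z : T) : 'rV[T]_m :=
  \row_i if i == j then z else v 0 i.

Lemma updateE j v z : update j v z 0 j = z.
Proof. by rewrite mxE eqxx. Qed.

Lemma update_neq j v z i : i != j -> update j v z 0 i = v 0 i.
Proof. by rewrite mxE => /negbTE ->. Qed.

End rectangles.

Section iid.
Context {R : realType} {disp disp' : measure_display} {Omega : measurableType disp}
  {T : measurableType disp'} (P : probability Omega R) {I : eqType}.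
Variable Z : I -> Omega -> T.
Hypotheses (mZ : forall o, measurable_fun setT (Z o))
  (indZ : mutually_independent P Z)
  (idZ : forall o o' (A : set T), measurable A -> P (Z o @^-1` A) = P (Z o' @^-1` A)).

Definition block m (e : 'I_m -> I) (w : Omega) : 'rV[T]_m := \row_i Z (e i) w.

Lemma measurable_block m (e : 'I_m -> I) : measurable_fun setT (block e).
Proof.
apply: measurable_fun_rVP => i; apply: (eq_measurable_fun (Z (e i))) => //.
by move=> w _; rewrite mxE.
Qed.

Lemma block_rectangle m (e : 'I_m -> I) (A : 'I_m -> set T) : injective e ->
  (forall i, measurable (A i)) ->
  P (block e @^-1` rectangle A) = (\prod_i P (Z (e i) @^-1` A i))%E.
Proof.
move=> e_inj mA.
pose A' o := if [pick i | e i == o] is Some i then A i else setT.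
have A'E i : A' (e i) = A i.
  rewrite /A'; case: pickP => [j /eqP/e_inj -> //|/(_ i)]; by rewrite eqxx.
have := indZ (s := [seq e i | i <- enum 'I_m]) (A := A').
rewrite map_inj_uniq// enum_uniq => /(_ isT).
rewrite big_map big_enum/= (eq_bigr (fun i => P (Z (e i) @^-1` A i))); last first.
  by move=> i _; rewrite A'E.
move=> <-; last by move=> o; rewrite /A'; case: pickP.
congr (P _); apply/seteqP; split=> w /=.
  by move=> Aw _ /mapP[i _ ->] /=; have := Aw i; rewrite mxE A'E.
move=> Aw i; rewrite mxE -A'E; apply: (Aw (e i)).
by apply/mapP; exists i; rewrite ?mem_enum.
Qed.

Lemma eq_block_law m (e e' : 'I_m -> I) (S : set 'rV[T]_m) :
  injective e -> injective e' -> measurable S ->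
  P (block e @^-1` S) = P (block e' @^-1` S).
Proof.
move=> ei ei' mS.
apply: (eq_measure_rectangle (m1 := image_measure P (measurable_block e))
  (m2 := image_measure P (measurable_block e'))) => //.
  by rewrite image_measureE preimage_setT; exact: probability_setT_lty.
move=> A mA; apply: (etrans (block_rectangle ei mA)).
apply: (etrans _ (esym (block_rectangle ei' mA))).
by apply: eq_bigr => i _; exact: idZ.
Qed.

Definition resampled m (e : 'I_m -> I) (j : 'I_m) (q : Omega * Omega) : 'rV[T]_m :=
  update j (block e q.1) (Z (e j) q.2).

Lemma measurable_resampled m (e : 'I_m -> I) j : measurable_fun setT (resampled e j).
Proof.
apply: measurable_fun_rVP => i.
have [->|ij] := eqVneq i j.
  apply: (eq_measurable_fun (Z (e j) \o snd)); first by move=> q _; rewrite updateE.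
  by apply: measurableT_comp => //; exact: measurable_snd.
apply: (eq_measurable_fun (Z (e i) \o fst)).
  by move=> q _; rewrite update_neq// mxE.
by apply: measurableT_comp => //; exact: measurable_fst.
Qed.

(** Both sides are laws under which the coordinates are independent with the
    same marginals, so they agree on rectangles.  Events and integrals can
    thereby be computed with all coordinates but one frozen. *)
Lemma resampling m (e : 'I_m -> I) (j : 'I_m) (S : set 'rV[T]_m) :
  injective e -> measurable S ->
  P (block e @^-1` S) = (P \x P)%E (resampled e j @^-1` S).
Proof.
move=> e_inj mS.
apply: (eq_measure_rectangle (m1 := image_measure P (measurable_block e))
  (m2 := image_measure (P \x P)%E (measurable_resampled e j))) => //.
  by rewrite image_measureE preimage_setT; exact: probability_setT_lty.
move=> A mA; apply: (etrans (block_rectangle e_inj mA)); rewrite image_measureE.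
pose A' i := if i == j then setT else A i.
have -> : resampled e j @^-1` rectangle A =
    (block e @^-1` rectangle A') `*` (Z (e j) @^-1` A j).
  apply/seteqP; split=> -[w w'] /=.
    move=> Aw; split; last by have := Aw j; rewrite updateE.
    by move=> i; rewrite /A'; case: eqVneq => // ij; have := Aw i; rewrite update_neq.
  move=> [Aw Aw'] i; have [->|ij] := eqVneq i j; first by rewrite updateE.
  by rewrite update_neq//; have := Aw i; rewrite /A' (negbTE ij).
have mA' i : measurable (A' i) by rewrite /A'; case: ifP.
have mB : measurable (block e @^-1` rectangle A').
  exact: measurable_preimageT (measurable_block e) (measurable_rectangle mA').
have mBj : measurable (Z (e j) @^-1` A j) by exact: measurable_preimageT (mZ (e j)) (mA j).
apply: (etrans _ (esym (product_measure1E P P mB mBj))).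
transitivity (P (block e @^-1` rectangle A') * P (Z (e j) @^-1` A j))%E; last by [].
rewrite block_rectangle// (bigD1 j)//= [in RHS](bigD1 j)//=.
have -> : P (Z (e j) @^-1` A' j) = 1%E.
  by rewrite /A' eqxx preimage_setT probability_setT.
rewrite mul1e muleC; congr (_ * _)%E.
by apply: eq_bigr => i ij; rewrite /A' (negbTE ij).
Qed.

Lemma integral_resampling m (e : 'I_m -> I) (j : 'I_m) (F : 'rV[T]_m -> R) (C : R) :
  injective e -> measurable_fun setT F -> (forall v, `|F v| <= C) ->
  (forall w, \int[P]_w' (F (resampled e j (w, w')))%:E = 0)%E ->
  (\int[P]_w (F (block e w))%:E = 0)%E.
Proof.
move=> e_inj mF FC F0.
have bF d (U : measurableType d) (Q : {measure set U -> \bar R}) (g : U -> 'rV[T]_m) :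
    (Q setT < +oo)%E -> measurable_fun setT g -> Q.-integrable setT (EFin \o (F \o g)).
  move=> Qfin mg; apply: measurable_bounded_integrable => //.
    exact: measurableT_comp.
  by exists C; split; [exact: num_real|move=> x Cx w _; exact/ltW/(le_lt_trans _ Cx)/FC].
have mEF : measurable_fun setT (EFin \o F) by exact/measurable_EFinP.
have PP1 : ((P \x P)%E setT < +oo)%E.
  exact: (@probability_setT_lty _ _ _ (P \x P)%E).
transitivity (\int[image_measure P (measurable_block e)]_v (EFin \o F) v)%E.
  rewrite integral_pushforward//; first exact: measurable_block.
  by apply: bF => //; [exact: probability_setT_lty|exact: measurable_block].
transitivity (\int[image_measure (P \x P)%E (measurable_resampled e j)]_v (EFin \o F) v)%E.
  by apply: eq_measure_integral => A mA _; exact: resampling.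
have bR := bF _ _ (P \x P)%E _ PP1 (measurable_resampled e j).
rewrite integral_pushforward//; last exact: measurable_resampled.
rewrite preimage_setT -(integral12_prod_meas1 bR).
by apply: integral0_eq => w _; exact: F0.
Qed.

End iid.

(** * Second-moment bounds *)

Lemma measurable_le_set d (T : measurableType d) (R : realType) (f g : T -> R) :
  measurable_fun setT f -> measurable_fun setT g -> measurable [set w | f w <= g w].
Proof.
by move=> mf mg; apply: (measurable_preimageT (A := [set true]) (measurable_fun_ler mf mg)).
Qed.

Section moment_bounds.
Context {R : realType} {disp : measure_display} {Omega : measurableType disp}
  (P : probability Omega R).

Lemma bounded_integrable (f : Omega -> R) (C : R) :
  measurable_fun setT f -> (forall w, `|f w| <= C) -> P.-integrable setT (EFin \o f).
Proof.
move=> mf fC; apply: measurable_bounded_integrable => //; first exact: probability_setT_lty.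
by exists C; split; [exact: num_real|move=> x Cx w _; exact/ltW/(le_lt_trans _ Cx)/fC].
Qed.

Lemma integral_le_cst (f : Omega -> R) (C : R) : measurable_fun setT f ->
  (forall w, 0 <= f w <= C) -> (\int[P]_w (f w)%:E <= C%:E)%E.
Proof.
move=> mf fC; apply: (@le_trans _ _ (\int[P]_w (cst C%:E w))%E).
  apply: ge0_le_integral => //.
  - by move=> w _; rewrite lee_fin; have /andP[] := fC w.
  - exact/measurable_EFinP.
  - by move=> w _; rewrite lee_fin; have /andP[] := fC w.
by rewrite integral_cst// -[X in (_ * X)%E]/(P setT) probability_setT mule1.
Qed.

Lemma markov_event (f : Omega -> R) (a : R) : measurable_fun setT f ->
  (forall w, 0 <= f w) -> 0 < a ->
  (a%:E * P [set w | (a <= f w)%R] <= \int[P]_w (f w)%:E)%E.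
Proof.
move=> mf f0 a0.
have mE : measurable [set w | a <= f w].
  exact: measurable_le_set.
rewrite -[X in P X]setIT -integral_indic// -ge0_integralZl//; last 2 first.
- by apply/measurable_EFinP.
- by rewrite lee_fin ltW.
apply: ge0_le_integral => //.
- by move=> w _; rewrite -EFinM lee_fin mulr_ge0// ltW.
- by apply/measurable_EFinP; apply: measurable_funM.
- exact/measurable_EFinP.
- move=> w _; rewrite -EFinM lee_fin indicE.
  have [|] := boolP (w \in _); last by rewrite mulr0.
  by rewrite inE /= mulr1.
Qed.

(** The hypothesis bounds the sum of the squares instead of each term, so that a
    sum with few nonzero terms gets a bound of the right order. *)
Lemma chebyshev_orthogonal n (f : 'I_n -> Omega -> R) (C V a : R) :
  (forall i, measurable_fun setT (f i)) ->
  (forall i w, `|f i w| <= C) ->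
  (forall i j, i != j -> (\int[P]_w (f i w * f j w)%:E = 0)%E) ->
  (forall w, \sum_i f i w ^+ 2 <= V) -> 0 < a ->
  (P [set w | (a <= `|\sum_i f i w|)%R ] <= (V / a ^+ 2)%:E)%E.
Proof.
move=> mf fC f_orth fV a0.
have C0 (i : 'I_n) (w : Omega) : 0 <= C by rewrite (le_trans _ (fC i w)).
have mff i j : measurable_fun setT (fun w => f i w * f j w) by exact: measurable_funM.
have iff i j : P.-integrable setT (EFin \o (fun w => f i w * f j w)).
  apply: (bounded_integrable (C := C * C)) => // w.
  by rewrite normrM ler_pM.
have sqE w : (\sum_i f i w) ^+ 2 = \sum_i \sum_j f i w * f j w.
  by rewrite expr2 mulr_suml; apply: eq_bigr => i _; rewrite mulr_sumr.
have m2 : measurable_fun setT (fun w => (\sum_i f i w) ^+ 2).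
  by apply: measurable_funX; exact: measurable_sum.
have int2 : (\int[P]_w ((\sum_i f i w) ^+ 2)%:E = \int[P]_w (\sum_i f i w ^+ 2)%:E)%E.
  under eq_integral do rewrite sqE -sumEFin.
  rewrite integral_sum//=; last first.
    move=> i; under eq_fun do rewrite -sumEFin.
    by apply: (integrable_sum measurableT) => j _; exact: (iff i j).
  under [RHS]eq_integral do rewrite -sumEFin.
  rewrite [RHS]integral_sum//=; last by move=> i; exact: (iff i i).
  apply: eq_bigr => i _; under eq_integral do rewrite -sumEFin.
  rewrite integral_sum//=; last by move=> j; exact: (iff i j).
  rewrite (bigD1 i)//= [X in (_ + X)%E]big1 ?adde0//.
  by move=> j ji; rewrite f_orth// eq_sym.
rewrite (_ : [set w | _] = [set w | a ^+ 2 <= (\sum_i f i w) ^+ 2]); last first.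
  by apply/eq_set => w; rewrite -ler_sqr ?nnegrE ?(ltW a0)// real_normK ?num_real.
rewrite mulrC EFinM lee_pdivlMl ?exprn_gt0//.
apply: (le_trans (markov_event m2 (fun w => sqr_ge0 _) (exprn_gt0 2 a0))).
rewrite int2; apply: integral_le_cst.
  by apply: measurable_sum => i; exact: measurable_funX.
by move=> w; rewrite fV andbT sumr_ge0// => i _; exact: sqr_ge0.
Qed.

Lemma markov_count (K : finType) (D : pred K) (E : K -> set Omega) (q a : R) :
  (forall k, D k -> measurable (E k)) -> (forall k, D k -> (P (E k) <= q%:E)%E) -> 0 < a ->
  (P [set w | (a <= \sum_(k | D k) \1_(E k) w)%R] <= (#|D|%:R * q / a)%:E)%E.
Proof.
move=> mE Eq a0; rewrite mulrC EFinM lee_pdivlMl//.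
have m1 k : D k -> measurable_fun setT (\1_(E k) : Omega -> R).
  by move=> /mE mEk; exact: measurable_indic.
have mS : measurable_fun setT (fun w => \sum_(k | D k) \1_(E k) w : R).
  rewrite (_ : (fun w => _) = (fun w => \sum_k if D k then \1_(E k) w else 0)); last first.
    by apply/funext => w; rewrite big_mkcond.
  apply: measurable_sum => k.
  by case: (boolP (D k)) => [Dk|//]; exact: m1.
have S0 w : 0 <= \sum_(k | D k) \1_(E k) w :> R.
  by apply: sumr_ge0 => k _; rewrite indicE ler0n.
apply: (le_trans (markov_event mS S0 a0)).
pose g k w : R := if D k then \1_(E k) w else 0.
have mg k : measurable_fun setT (g k).
  by rewrite /g; case: (boolP (D k)) => [Dk|//]; exact: m1.
have -> : (\int[P]_w (\sum_(k | D k) \1_(E k) w)%R%:E = \sum_k \int[P]_w (g k w)%:E)%E.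
  rewrite -ge0_integral_sum//.
  - by apply: eq_integral => w _; rewrite sumEFin big_mkcond.
  - by move=> k; exact/measurable_EFinP.
  - by move=> k w _; rewrite lee_fin /g; case: ifP; rewrite // indicE ler0n.
apply: (@le_trans _ _ (\sum_(k | D k) q%:E)%E).
  rewrite [leRHS]big_mkcond/=; apply: lee_sum => k _; rewrite /g.
  case: (boolP (D k)) => Dk; last by rewrite integral0.
  by rewrite integral_indic ?setIT ?Eq//; exact: mE.
rewrite sumEFin (eq_bigl (fun k => k \in D))//. by rewrite sumr_const mulr_natl.
Qed.

End moment_bounds.

Section law_of_large_numbers.
Context {R : realType} {disp disp' : measure_display} {Omega : measurableType disp}
  {T : measurableType disp'} (P : probability Omega R) {I : eqType}.
Variable Z : I -> Omega -> T.
Hypotheses (mZ : forall o, measurable_fun setT (Z o))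
  (indZ : mutually_independent P Z)
  (idZ : forall o o' (A : set T), measurable A -> P (Z o @^-1` A) = P (Z o' @^-1` A)).

Lemma indic_comp (o : I) (B : set T) w : \1_B (Z o w) = \1_(Z o @^-1` B) w :> R.
Proof. by rewrite !indicE; congr (_%:R); apply/idP/idP; rewrite !inE. Qed.

Lemma frequency_bound (e : nat -> I) (B : set T) (p : R) n :
  injective e -> measurable B -> (forall o, P (Z o @^-1` B) = p%:E) -> 0 < p -> (0 < n)%N ->
  (P [set w | (\sum_(i < n) \1_B (Z (e i) w) <= p / 2 * n%:R)%R] <= (4 / (p ^+ 2 * n%:R))%:E)%E.
Proof.
move=> e_inj mB pE p0 n0.
have p1 : p <= 1.
  by rewrite -lee_fin -(pE (e 0%N)) probability_le1//; exact: measurable_preimageT (mZ _) mB.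
pose f (i : 'I_n) w : R := \1_B (Z (e i) w) - p.
have mf i : measurable_fun setT (f i).
  apply: measurable_funB => //; apply: measurableT_comp => //.
have b01 z : 0 <= (\1_B z : R) <= 1 by rewrite indicE; case: (_ \in _); rewrite ?lexx ?ler01.
have fB z : `|(\1_B z : R) - p| <= 1.
  by have /andP[z0 z1] := b01 z; rewrite ler_norml; apply/andP; split; lra.
have f_orth i j : i != j -> (\int[P]_w (f i w * f j w)%:E = 0)%E.
  move=> ij; pose e2 (k : 'I_2) := if k == ord0 then e i else e j.
  have e2_inj : injective e2.
    move=> k l; rewrite /e2; have := ltn_ord k; have := ltn_ord l.
    case: eqVneq => [->|k0]; case: eqVneq => [->|l0]//.
    - by move=> _ _ /e_inj/val_inj ji; rewrite ji eqxx in ij.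
    - by move=> _ _ /e_inj/val_inj ji; rewrite ji eqxx in ij.
    - by move=> kl ll _; apply/val_inj; move: k0 l0; rewrite -!val_eqE/=; lia.
  pose F (v : 'rV[T]_2) : R := (\1_B (v 0 ord0) - p) * (\1_B (v 0 ord_max) - p).
  have mF : measurable_fun setT F.
    have m1 k : measurable_fun setT (fun v : 'rV[T]_2 => \1_B (v 0 k) - p : R).
      apply: measurable_funB => //.
      exact: (measurableT_comp (measurable_indic mB) (measurable_rV_coord k)).
    by apply: measurable_funM; exact: m1.
  have := @integral_resampling _ _ _ _ _ P _ Z mZ indZ 2 e2 ord_max F 1 e2_inj mF.
  under [in X in _ -> _ -> X]eq_integral do rewrite /F !mxE /e2 eqxx/=.
  apply.
    by move=> v; rewrite normrM mulr_ile1.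
  move=> w; rewrite /F.
  under eq_integral do rewrite updateE update_neq//= EFinM.
  rewrite integralZl//; last first.
    apply: (@bounded_integrable _ _ _ P _ 1) => //.
    by apply: measurable_funB => //; apply: measurableT_comp.
  rewrite -/(f j) (_ : (\int[P]_x _ = 0)%E) ?mule0//.
  under eq_integral do rewrite EFinB indic_comp.
  rewrite integralB//=.
  - rewrite integral_indic// ?setIT; last exact: measurable_preimageT (mZ _) mB.
    rewrite integral_cst// -[X in (_ - _ * X)%E]/(P setT) probability_setT mule1.
    by rewrite -[X in (X - _)%E]/(P (Z (e j) @^-1` B)) pE subee.
  - apply: (@bounded_integrable _ _ _ P _ 1) => //.
      by apply: measurable_indic; exact: measurable_preimageT (mZ _) mB.
    by move=> w'; rewrite indicE; case: (_ \in _); rewrite ?normr1 ?normr0.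
  - by apply: (@bounded_integrable _ _ _ P _ `|p|).
have pn0 : 0 < p / 2 * n%:R by rewrite mulr_gt0 ?ltr0n// divr_gt0.
have fC i w : `|f i w| <= 1 by exact: fB.
have fV w : \sum_(i < n) f i w ^+ 2 <= n%:R.
  rewrite -[leRHS]mulr1 -[X in X%:R * _]card_ord mulr_natl -sumr_const ler_sum// => i _.
  by rewrite -real_normK ?num_real// expr_le1.
have -> : 4 / (p ^+ 2 * n%:R) = n%:R / (p / 2 * n%:R) ^+ 2.
  by field; rewrite pnatr_eq0 -lt0n n0 gt_eqF.
apply: (le_trans _ (chebyshev_orthogonal mf fC f_orth fV pn0)).
have mf1 : measurable_fun setT (fun w => \sum_(i < n) \1_B (Z (e i) w) : R).
  by apply: measurable_sum => i; apply: measurableT_comp.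
apply: le_measure; rewrite ?inE.
- exact: measurable_le_set.
- by apply: measurable_le_set => //; apply: measurableT_comp => //; exact: measurable_sum.
- move=> w /= hw; rewrite sumrB sumr_const card_ord -[p *+ n]mulr_natr.
  by rewrite -normrN opprB (le_trans _ (ler_norm _))//; lra.
Qed.

Lemma frequency_lln (e : nat -> I) (B : set T) (p : R) : injective e -> measurable B ->
  (forall o, P (Z o @^-1` B) = p%:E) -> 0 < p -> forall eta : R, 0 < eta ->
  exists n0, forall n, (n0 <= n)%N ->
  (P [set w | (\sum_(i < n) \1_B (Z (e i) w) <= p / 2 * n%:R)%R] <= eta%:E)%E.
Proof.
move=> e_inj mB pE p0 eta eta0.
pose c := 4 / (p ^+ 2 * eta).
have c0 : 0 < c by rewrite divr_gt0// mulr_gt0// exprn_gt0.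
exists (Num.truncn c).+1 => n n0n.
have cn : c < n%:R by rewrite (lt_le_trans (truncnS_gt c))// ler_nat.
have n0 : (0 < n)%N by rewrite -(ltr_nat R) (lt_trans c0).
apply: (le_trans (frequency_bound e_inj mB pE p0 n0)); rewrite lee_fin.
rewrite ler_pdivrMr ?mulr_gt0 ?exprn_gt0 ?ltr0n//.
move: cn; rewrite /c ltr_pdivrMr ?mulr_gt0 ?exprn_gt0// => /ltW.
by rewrite [n%:R * _]mulrC mulrAC mulrC.
Qed.

End law_of_large_numbers.

(** * General position of the sample *)

Section measurable_sides.
Context {R : realType} {disp : measure_display} {U : measurableType disp} {d : nat}.
Implicit Types (u : U -> nat -> 'rV[R]_d) (z : U -> 'rV[R]_d).

Lemma measurable_det n (M : U -> 'M[R]_n) :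
  (forall i j, measurable_fun setT (fun w => M w i j)) ->
  measurable_fun setT (fun w => \det (M w)).
Proof.
move=> mM; apply: measurable_sum => s; apply: measurable_funM => //.
by apply: measurable_prod => i _; exact: mM.
Qed.

Lemma measurable_hom z j : measurable_fun setT z ->
  measurable_fun setT (fun w => hom (z w) 0 j).
Proof.
move=> mz; case: (unliftP ord0 j) => [i|] ->.
  apply: (eq_measurable_fun (fun w => z w 0 i)); first by move=> w _; rewrite homS.
  exact: (measurableT_comp (measurable_rV_coord (T := R) i) mz).
rewrite (_ : (fun w => _) = cst 1); first exact: measurable_cst.
by apply/funext => w; rewrite hom0.
Qed.

Lemma measurable_minor_mx m u i j : (forall k, measurable_fun setT (u ^~ k)) ->
  measurable_fun setT (fun w => minor_mx m (u w) i j).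
Proof.
move=> mu; case: (ltnP i m) => im.
  apply: (eq_measurable_fun (fun w => hom (u w i) 0 j)).
    by move=> w _; rewrite [RHS]mxE im.
  exact: measurable_hom.
rewrite (_ : (fun w => _) = cst (i == j)%:R); first exact: measurable_cst.
by apply/funext => w; rewrite mxE ltnNge im.
Qed.

Lemma measurable_det_minor m u : (forall k, measurable_fun setT (u ^~ k)) ->
  measurable_fun setT (fun w => \det (minor_mx m (u w))).
Proof. by move=> mu; apply: measurable_det => i j; exact: measurable_minor_mx. Qed.

Lemma measurable_minor_cof m u j : (forall k, measurable_fun setT (u ^~ k)) ->
  measurable_fun setT (fun w => minor_cof m (u w) j).
Proof.
move=> mu; apply: measurable_funM => //; apply: measurable_det => i k.
pose i' := lift (inord m) i; pose k' := lift j k.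
apply: (eq_measurable_fun (fun w => minor_mx m (u w) i' k')).
  by move=> w _; rewrite [RHS]mxE [RHS]mxE.
exact: measurable_minor_mx.
Qed.

Lemma measurable_side u z : (forall k, measurable_fun setT (u ^~ k)) ->
  measurable_fun setT z -> measurable_fun setT (fun w => side (u w) (z w)).
Proof.
move=> mu mz; apply: (measurable_det_minor d.+1 (u := fun w => with_last (u w) (z w))) => k.
rewrite /with_last; case: (ltnP k d) => _; [exact: mu|exact: mz].
Qed.

End measurable_sides.

Section general_position.
Context {R : realType} {disp : measure_display} {Omega : measurableType disp}
  {d : nat} (P : probability Omega R) {I : eqType}.
Local Notation T := ('rV[R]_d * R)%type.
Variable Z : I -> Omega -> T.
Hypotheses (d0 : (0 < d)%N) (mZ : forall o, measurable_fun setT (Z o))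
  (indZ : mutually_independent P Z)
  (idZ : forall o o' (A : set T), measurable A -> P (Z o @^-1` A) = P (Z o' @^-1` A))
  (acZ : forall o (A : set 'rV[R]_d), measurable A -> lebesgue_rV R d A = 0%E ->
     P [set w | A (Z o w).1] = 0%E).

Definition points m (v : 'rV[T]_m) (i : nat) : 'rV[R]_d :=
  if insub i is Some j then (v 0 j).1 else 0.

Lemma pointsE m (v : 'rV[T]_m) (i : 'I_m) : points v i = (v 0 i).1.
Proof. by rewrite /points valK. Qed.

Lemma measurable_points m k : measurable_fun setT (fun v : 'rV[T]_m => points v k).
Proof.
rewrite /points; case: insubP => [j _ _|_]; last exact: measurable_cst.
apply: measurableT_comp; first exact: measurable_fst.
exact: measurable_rV_coord.
Qed.

Lemma hom_null o (c : 'I_d.+1 -> R) : (exists j, c j != 0) ->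
  P [set w | \sum_j hom (Z o w).1 0 j * c j = 0] = 0%E.
Proof.
move=> [j cj]; pose c' : 'rV[R]_d := \row_i c (lift ord0 i).
have := @lebesgue_rV_hyperplane R d (c ord0) c'.
have -> : (c ord0 != 0) || (c' != 0).
  move: cj; case: (unliftP ord0 j) => [i|] -> cj; last by rewrite cj.
  by apply/orP; right; apply: contraNneq cj => /rowP/(_ i); rewrite !mxE => ->.
move=> /(_ isT) l0.
rewrite -(acZ o (measurable_preimageT (measurable_affine (c ord0) c') (measurable_set1 0)) l0).
congr (P _); apply/eq_set => w; congr (_ = _).
rewrite big_ord_recl hom0 mul1r; congr (_ + _); apply: eq_bigr => i _.
by rewrite homS !mxE mulrC.
Qed.

(** Freezing all points but the last, the minor is an affine function of the last
    point which is nonzero as soon as the previous minor is nonzero; its zero set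
    is a hyperplane, hence null. *)
Lemma det_minor_null m (e : 'I_m -> I) : (m <= d.+1)%N -> injective e ->
  P [set w | \det (minor_mx m (points (block Z e w))) = 0] = 0%E.
Proof.
elim: m => [|m IH] in e *.
  move=> _ _; rewrite (_ : [set w | _] = set0) ?measure0//.
  by apply/seteqP; split=> // w /=; rewrite minor_mx0 => /eqP; rewrite oner_eq0.
rewrite ltnS => md e_inj.
pose S := [set v : 'rV[T]_m.+1 | \det (minor_mx m.+1 (points v)) = 0].
have mS : measurable S.
  apply: (measurable_preimageT _ (measurable_set1 0)).
  by apply: measurable_det_minor => k; exact: measurable_points.
rewrite -[[set w | _]]/(block Z e @^-1` S) (resampling mZ indZ ord_max e_inj mS).
apply/product_null_xsection.
  exact: measurable_preimageT (measurable_resampled mZ _ _) mS.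
pose e' (i : 'I_m) := e (widen_ord (leqnSn m) i).
have e'_inj : injective e' by move=> i j /e_inj /(congr1 val)/= ij; exact: val_inj.
have mN : measurable [set w | \det (minor_mx m (points (block Z e' w))) = 0].
  apply: (measurable_preimageT _ (measurable_set1 0)).
  apply: measurable_det_minor => k; apply: (measurableT_comp (measurable_points _)).
  exact: measurable_block.
exists [set w | \det (minor_mx m (points (block Z e' w))) = 0]; split => //.
  exact: (IH e' (leqW md) e'_inj).
move=> w /= nw; apply: contrapT => D0; apply: nw.
rewrite -[RHS](@hom_null (e ord_max) (minor_cof m (points (block Z e' w)))); last first.
  by exists (inord m); rewrite minor_cof_diag//; exact/eqP.
congr (P _); apply/eq_set => w'; congr (_ = _).
rewrite det_minor_mxS//; apply: eq_bigr => j _; congr (_ * _).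
  by rewrite -[m]/(val (@ord_max m)) pointsE updateE.
apply: minor_cof_ext => i im.
have -> : i = widen_ord (leqnSn m) (Ordinal im) by [].
rewrite pointsE update_neq//; last by rewrite -val_eqE/= neq_ltn im.
by rewrite -[val _]/(val (Ordinal im)) pointsE !mxE.
Qed.

Lemma general_position_ae (e : 'I_d -> I) : injective e ->
  {ae P, forall w, general_position (points (block Z e w))}.
Proof.
move=> e_inj; exists [set w | \det (minor_mx d (points (block Z e w))) = 0]; split.
- apply: (measurable_preimageT _ (measurable_set1 0)).
  apply: measurable_det_minor => k; apply: (measurableT_comp (measurable_points _)).
  exact: measurable_block.
- exact: det_minor_null.
- move=> w /= ngp; apply: contrapT => /eqP D0; apply: ngp; exact: det_minor_mx_gp.
Qed.

Lemma side_null (e : 'I_d.+1 -> I) : injective e ->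
  P [set w | side (points (block Z e w)) (Z (e ord_max) w).1 = 0] = 0%E.
Proof.
move=> e_inj; rewrite -[RHS](det_minor_null (leqnn _) e_inj).
congr (P _); apply/eq_set => w; rewrite /side; congr (\det _ = _).
apply: minor_mx_ext => i; rewrite ltnS leq_eqVlt /with_last => /predU1P[->|->//].
by rewrite ltnn -[d in RHS]/(val (@ord_max d)) pointsE mxE.
Qed.

(** No division by the norm of the normal vector, so that degenerate families, for
    which the side function is zero, are included. *)
Definition near_hyperplane (delta : R) (v : 'rV[T]_d.+1) : Prop :=
  `|side (points v) (v 0 ord_max).1| <= delta * \sum_i `|normal (points v) i|.

Lemma measurable_near_hyperplane delta : measurable [set v | near_hyperplane delta v].
Proof.
have mp k := @measurable_points d.+1 k.
apply: measurable_le_set.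
  apply: measurableT_comp => //; apply: measurable_side => //.
  by apply: measurableT_comp; [exact: measurable_fst|exact: measurable_rV_coord].
apply: measurable_funM => //; apply: measurable_sum => i.
by apply: measurableT_comp => //; exact: measurable_minor_cof.
Qed.

(** As delta decreases to zero these events decrease to the null event that the
    last point is on the hyperplane.  The same delta serves for all index maps
    because the law of the block does not depend on them. *)
Lemma near_hyperplane_small (e0 : 'I_d.+1 -> I) (eta : R) : injective e0 -> 0 < eta ->
  exists2 delta : R, 0 < delta & forall e : 'I_d.+1 -> I, injective e ->
    (P [set w | near_hyperplane delta (block Z e w)] <= eta%:E)%E.
Proof.
move=> e0_inj eta0.
pose F (q : nat) := [set w | near_hyperplane (q.+1%:R^-1) (block Z e0 w)].
have mF q : measurable (F q).
  exact: measurable_preimageT (measurable_block mZ e0) (measurable_near_hyperplane _).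
have capF : \bigcap_q F q = [set w | side (points (block Z e0 w)) (Z (e0 ord_max) w).1 = 0].
  apply/seteqP; split=> w /=; last first.
    move=> s0 q _; rewrite /F /= /near_hyperplane mxE s0 normr0 mulr_ge0// sumr_ge0//.
  move=> Fw; apply/eqP; rewrite -normr_le0; apply/ler_addgt0Pr => eps eps0.
  rewrite add0r; set s := \sum_i `|normal (points (block Z e0 w)) i|.
  have s0 : 0 <= s by apply: sumr_ge0.
  have := Fw (Num.truncn (s / eps)) Logic.I; rewrite /F /= /near_hyperplane mxE -/s => h.
  rewrite (le_trans h)// mulrC ler_pdivrMr ?ltr0n// mulrC -ler_pdivrMr//.
  exact/ltW/truncnS_gt.
have cap0 : P (\bigcap_q F q) = 0%E by rewrite capF; exact: side_null.
have F0 : (P (F 0%N) < +oo)%E.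
  by rewrite (le_lt_trans (probability_le1 P (mF 0%N)))// ltry.
have Fdec : {homo F : n m / (n <= m)%N >-> (m <= n)%O}.
  move=> n m nm; apply/subsetPset => w; rewrite /F /= /near_hyperplane => /le_trans; apply.
  rewrite ler_wpM2r ?sumr_ge0// lef_pV2 ?posrE ?ltr0n// ler_nat ltnS//.
have mcap : measurable (\bigcap_q F q) by exact: bigcapT_measurable.
have : (P \o F) n @[n --> \oo] --> 0%E.
  by rewrite -cap0; exact: nonincreasing_cvg_mu.
move=> /fine_cvgP[[N1 _ FN1]] /cvgrPdist_le/(_ _ eta0)[N2 _ FN2].
pose N := maxn N1 N2.
exists (N.+1%:R^-1); first by rewrite invr_gt0 ltr0n.
move=> e e_inj.
have -> : P [set w | near_hyperplane (N.+1%:R^-1) (block Z e w)] = P (F N).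
  exact: (eq_block_law mZ indZ idZ e_inj e0_inj (measurable_near_hyperplane _)).
have := FN2 N (leq_maxr _ _); rewrite /= sub0r normrN => h.
have PN : P (F N) \is a fin_num by exact: FN1 N (leq_maxl _ _).
rewrite -(fineK PN) lee_fin.
by rewrite (le_trans (ler_norm _)).
Qed.

End general_position.

(** * Nearest neighbours as a function of finitely many signs *)

Section nearest_measurable.
Context {R : realType} {d : nat}.
Local Notation T := ('rV[R]_d * R)%type.
Variables (n k : nat).
Implicit Types (v : 'rV[T]_n.+1) (J : {set 'I_n}).

Definition member J (j : nat) : nat := nth 0%N [seq val i | i <- enum J] j.

Lemma member_lt J (j : 'I_d) : #|J| = d -> (member J j < n)%N.
Proof.
move=> Jd; have sz : size [seq val i | i <- enum J] = d by rewrite size_map -cardE.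
have : member J j \in [seq val i | i <- enum J] by rewrite mem_nth// sz.
by move=> /mapP[i _ ->]; exact: ltn_ord.
Qed.

Lemma vertices_member (xs : nat -> 'rV[R]_d) J : #|J| = d ->
  vertices (fun j => xs (member J j)) = [set xs i | i in [set` J]].
Proof.
move=> Jd; have sz : size [seq val i | i <- enum J] = d by rewrite size_map -cardE.
apply/seteqP; split=> x /=.
  move=> [j /= jd <-].
  have : member J j \in [seq val i | i <- enum J] by rewrite mem_nth// sz.
  by move=> /mapP[i iJ ->]; exists i => //=; rewrite mem_enum in iJ.
move=> [i /= iJ <-].
have iJ' : val i \in [seq val i | i <- enum J] by rewrite mem_map ?mem_enum//; exact: val_inj.
exists (index (val i) [seq val i | i <- enum J]); first by rewrite /= -sz index_mem.
by rewrite /= /member nth_index.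
Qed.

Definition cuts J (i : nat) v : bool :=
  side (fun j => points v (member J j)) (points v n) *
  side (fun j => points v (member J j)) (points v i) <= 0.

(** The list of nearest indices depends on the data through this finite-valued
    map only, which makes every event about it measurable. *)
Definition cut_pattern v : {ffun {set 'I_n} * 'I_n -> bool} :=
  [ffun p : {set 'I_n} * 'I_n => cuts p.1 p.2 v].

Definition pattern_rank (b : {ffun {set 'I_n} * 'I_n -> bool}) (i : nat) : nat :=
  if insub i is Some j then #|[set J : {set 'I_n} | (#|J| == d) && b (J, j)]%SET| else 0%N.

Definition nearest_by_sides v : seq nat := nearest (pattern_rank (cut_pattern v)) n k.

Lemma nearest_by_sidesE (xs : nat -> 'rV[R]_d) x v :
  (forall i : 'I_n, points v i = xs i) -> points v n = x ->
  (forall J, #|J| = d -> general_position (fun j => points v (member J j))) ->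
  nearest (fun i => empirical_distance xs n x (xs i)) n k = nearest_by_sides v.
Proof.
move=> vxs vx gp; apply: eq_nearest => i im.
rewrite /pattern_rank (insubT (fun i => i < n)%N im) empirical_distanceE.
apply: eq_card => J; rewrite !inE; case: eqVneq => //= Jd; rewrite ffunE/=.
rewrite /separates -(vertices_member _ Jd).
have -> : vertices (fun j => xs (member J j)) = vertices (fun j => points v (member J j)).
  apply/seteqP; split=> y [j /= jd <-]; exists j => //=;
  by rewrite -(vxs (Ordinal (@member_lt J (Ordinal jd) Jd))).
rewrite -vx -(vxs (Ordinal im)).
apply/asboolP/idP => [/(segment_meets_side _ _ (gp _ Jd))//|].
by move=> h; apply/(segment_meets_side _ _ (gp _ Jd)).
Qed.

Lemma measurable_cut_pattern (Q : {ffun {set 'I_n} * 'I_n -> bool} -> Prop) :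
  measurable [set v | Q (cut_pattern v)].
Proof.
have mcut b : measurable [set v | cut_pattern v = b].
  pose A (p : 'I_#|{: {set 'I_n} * 'I_n}|) : set 'rV[T]_n.+1 :=
    [set v | cuts (enum_val p).1 (enum_val p).2 v = b (enum_val p)].
  have -> : [set v | cut_pattern v = b] = [set v | forall p, A p v].
    apply/seteqP; split=> v /=.
      by move=> vb p; rewrite /A /= -vb ffunE.
    move=> h; apply/ffunP => p; rewrite ffunE -(enum_rankK p).
    exact: h.
  apply: measurable_forall => p; rewrite /A /cuts.
  set J := (enum_val p).1; set i := (enum_val p).2.
  have ms z : measurable_fun setT z ->
      measurable_fun setT (fun v => side (fun j => points v (member J j)) (z v)).
    by move=> mz; apply: measurable_side => // j; exact: measurable_points.
  have mle : measurable_fun setT (fun v => side (fun j => points v (member J j)) (points v n) *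
     side (fun j => points v (member J j)) (points v i) <= 0).
    by apply: measurable_fun_ler => //; apply: measurable_funM; apply: ms; exact: measurable_points.
  exact: (measurable_preimageT (A := [set b (enum_val p)]) mle).
have -> : [set v | Q (cut_pattern v)] =
    \bigcup_(b in [set b | Q b]) [set v | cut_pattern v = b].
  apply/seteqP; split=> v /=; first by move=> Qv; exists (cut_pattern v).
  by move=> [b Qb /= ->].
by apply: fin_bigcup_measurable => //; exact: finite_finset.
Qed.

Lemma measurable_mem_nearest (i : nat) : measurable [set v | i \in nearest_by_sides v].
Proof. exact: (measurable_cut_pattern (fun b => i \in nearest (pattern_rank b) n k)). Qed.

Lemma nearest_by_sides_points v v' : (forall i, points v i = points v' i) ->
  nearest_by_sides v = nearest_by_sides v'.
Proof.
move=> vv'; congr (nearest (pattern_rank _) n k); apply/ffunP => p; rewrite !ffunE /cuts.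
have -> : (fun j => points v (member p.1 j)) = (fun j => points v' (member p.1 j)).
  by apply/funext => j.
by rewrite !vv'.
Qed.

End nearest_measurable.

Section nearest_variance.
Context {R : realType} {disp : measure_display} {Omega : measurableType disp}
  {d : nat} (P : probability Omega R) {I : eqType}.
Local Notation T := ('rV[R]_d * R)%type.
Variable Z : I -> Omega -> T.
Hypotheses (mZ : forall o, measurable_fun setT (Z o))
  (indZ : mutually_independent P Z).
Variables (h : T -> R) (C : R).
Hypotheses (mh : measurable_fun setT h) (hC : forall z, `|h z| <= C)
  (h0 : forall o (S : set 'rV[R]_d), measurable S ->
    (\int[P]_w (\1_S (Z o w).1 * h (Z o w))%:E = 0)%E).

Lemma measurable_nearest_term n k (i : 'I_n) : measurable_fun setT (fun v : 'rV[T]_n.+1 =>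
  (val i \in nearest_by_sides k v)%:R * h (v 0 (widen_ord (leqnSn n) i))).
Proof.
have -> : (fun v : 'rV[T]_n.+1 =>
    (val i \in nearest_by_sides k v)%:R * h (v 0 (widen_ord (leqnSn n) i))) =
  (fun v => \1_[set v | val i \in nearest_by_sides k v] v * h (v 0 (widen_ord (leqnSn n) i))).
  apply/funext => v; rewrite indicE.
  have -> : (v \in [set v : 'rV[T]_n.+1 | val i \in nearest_by_sides k v]) =
    (val i \in nearest_by_sides k v) by apply/idP/idP; rewrite inE.
  by [].
apply: measurable_funM; first by apply: measurable_indic; exact: measurable_mem_nearest.
exact: (measurableT_comp mh (measurable_rV_coord _)).
Qed.

(** For two selected indices, resample the data of one of them: the selection and
    the other residual depend on it through its position only, and [h] integrates
    to zero over every set of positions.  Hence distinct terms are orthogonal. *)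
Lemma nearest_average_deviation n k (e : 'I_n.+1 -> I) (t : R) : injective e ->
  (0 < k <= n)%N -> 0 < t ->
  (P [set w | (k%:R * t <= `|\sum_(i < n) (val i \in nearest_by_sides k (block Z e w))%:R *
       h (Z (e (widen_ord (leqnSn n) i)) w)|)%R] <= (C ^+ 2 / (k%:R * t ^+ 2))%:E)%E.
Proof.
move=> e_inj /andP[k0 kn] t0.
pose wd (i : 'I_n) := widen_ord (leqnSn n) i.
pose g (i : 'I_n) (v : 'rV[T]_n.+1) : R := (val i \in nearest_by_sides k v)%:R * h (v 0 (wd i)).
have mg i : measurable_fun setT (g i) by exact: measurable_nearest_term.
have gC i v : `|g i v| <= C.
  rewrite /g; case: (_ \in _); rewrite ?mul1r ?mul0r ?normr0//.
  exact: le_trans (normr_ge0 _) (hC (0, 0)).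
pose f i w := g i (block Z e w).
have f_orth (i l : 'I_n) : i != l -> (\int[P]_w (f i w * f l w)%:E = 0)%E.
  move=> il; pose F v := g i v * g l v.
  apply: (@integral_resampling _ _ _ _ _ P _ Z mZ indZ n.+1 e (wd i) F (C * C) e_inj).
  - by apply: measurable_funM; exact: mg.
  - by move=> v; rewrite normrM ler_pM.
  move=> w; set v := block Z e w.
  pose up (x : 'rV[R]_d) := update (wd i) v (x, 0 : R).
  have mup : measurable_fun setT up.
    apply: measurable_fun_rVP => j.
    have [->|ij] := eqVneq j (wd i).
      apply: (eq_measurable_fun (fun x => (x, 0 : R))); first by move=> x _; rewrite updateE.
      by apply: measurable_fun_pair.
    rewrite (_ : (fun x => _) = cst (v 0 j)); first exact: measurable_cst.
    by apply/funext => x; rewrite update_neq.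
  pose S := [set x | (val i \in nearest_by_sides k (up x)) &&
    (val l \in nearest_by_sides k (up x))].
  have mS : measurable S.
    have mi j := measurable_preimageT mup (@measurable_mem_nearest R d n k j).
    have := measurableI _ _ (mi (val i)) (mi (val l)).
    rewrite (_ : _ `&` _ = S)//; apply/seteqP; split=> x; rewrite /S /=.
      by move=> [-> ->].
    by move=> /andP[].
  have FE w' : F (resampled Z e (wd i) (w, w')) =
      h (v 0 (wd l)) * (\1_S (Z (e (wd i)) w').1 * h (Z (e (wd i)) w')).
    rewrite /F /g /resampled /= -/v updateE update_neq; last first.
      by apply: contraNneq il => /(congr1 val)/= li; apply/eqP/val_inj.
    set z := Z (e (wd i)) w'.
    have -> : nearest_by_sides k (update (wd i) v z) = nearest_by_sides k (up z.1).
      apply: nearest_by_sides_points => j; rewrite /points; case: insubP => // j' _ _.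
      have [->|ij] := eqVneq j' (wd i); first by rewrite !updateE.
      by rewrite !update_neq.
    have -> : \1_S z.1 = ((val i \in nearest_by_sides k (up z.1)) &&
        (val l \in nearest_by_sides k (up z.1)))%:R :> R.
      by rewrite indicE (_ : (z.1 \in S) = (val i \in nearest_by_sides k (up z.1)) &&
        (val l \in nearest_by_sides k (up z.1)))//; apply/idP/idP; rewrite inE.
    by case: (_ \in _); case: (_ \in _) => /=; ring.
  under eq_integral do rewrite FE EFinM.
  rewrite integralZl//; first by rewrite h0// mule0.
  apply: (@bounded_integrable _ _ _ P _ C).
    apply: measurable_funM; last exact: measurableT_comp.
    apply: (measurableT_comp (measurable_indic mS)).
    by apply: (measurableT_comp measurable_fst).
  move=> w'; rewrite normrM indicE; case: (_ \in _); rewrite ?normr1 ?mul1r//.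
  rewrite normr0 mul0r; exact: le_trans (normr_ge0 _) (hC (0, 0)).
have mf i : measurable_fun setT (f i) by apply: measurableT_comp => //; exact: measurable_block.
have fV w : \sum_i f i w ^+ 2 <= k%:R * C ^+ 2.
  set N := nearest_by_sides k (block Z e w).
  apply: (@le_trans _ _ (\sum_(i < n | val i \in N) C ^+ 2)).
    rewrite [leRHS]big_mkcond/=; apply: ler_sum => i _; rewrite /f /g -/N.
    case: (_ \in _); last by rewrite mul0r expr0n.
    rewrite mul1r -real_normK ?num_real// ler_sqr ?nnegrE//.
    exact: le_trans (normr_ge0 _) (hC (0, 0)).
  rewrite -(big_nearest (fun=> C ^+ 2)) big_const_seq count_predT size_nearest//.
  by rewrite iter_addr_0 mulr_natl.
have kt0 : 0 < k%:R * t by rewrite mulr_gt0// ltr0n.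
have -> : C ^+ 2 / (k%:R * t ^+ 2) = k%:R * C ^+ 2 / (k%:R * t) ^+ 2.
  by field; rewrite pnatr_eq0 -lt0n k0 gt_eqF.
have := chebyshev_orthogonal mf (fun i w => gC i (block Z e w)) f_orth fV kt0.
rewrite (_ : [set w | _] = [set w | (k%:R * t <=
  `|\sum_(i < n) (val i \in nearest_by_sides k (block Z e w))%:R *
       h (Z (e (widen_ord (leqnSn n) i)) w)|)%R])//.
apply/eq_set => w; congr (is_true (_ <= `| _ |)); apply: eq_bigr => i _.
by rewrite /f /g mxE.
Qed.

End nearest_variance.

(** * Locality of the empirical distance *)

Section locality.
Context {R : realType} {d : nat}.
Implicit Types (x y : 'rV[R]_d) (xs : nat -> 'rV[R]_d) (n : nat).
Let S := {ffun 'I_d -> bool}.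

(** The proportion of hyperplanes provided by [far_separated]. *)
Definition separation_rate (c : R) : R := c ^+ #|{: S}| / (2 ^ #|{: S}| * d ^ d)%:R.

Lemma separation_rate_gt0 c : (0 < d)%N -> 0 < c -> 0 < separation_rate c.
Proof.
move=> d0 c0; rewrite divr_gt0 ?exprn_gt0// ltr0n muln_gt0 expn_gt0/=.
by rewrite expn_gt0 d0.
Qed.

Lemma far_distance xs n x y (a b : 'rV[R]_d) (N : S -> {set 'I_n}) (c : R) :
  (0 < d)%N -> (0 < n)%N -> 0 <= c ->
  (forall sg, c * n%:R <= #|N sg|%:R) ->
  (forall sg i, i \in N sg -> orthant sg x (xs i)) ->
  (forall sg i, i \in N sg -> forall j, a 0 j < xs i 0 j < b 0 j) ->
  ~ (forall j, a 0 j < y 0 j < b 0 j) ->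
  separation_rate c * n%:R ^+ d <= (empirical_distance xs n x y)%:R.
Proof.
move=> d0 n0 c0 cN No Nab yab.
have := far_separated No Nab yab; rewrite -(ler_nat R) natr_prod => h.
have K0 : 0 < (2 ^ #|{: S}| * d ^ d)%:R :> R.
  by rewrite ltr0n muln_gt0 expn_gt0/= expn_gt0 d0.
have nm0 : 0 < n%:R ^+ (#|{: S}| - d) :> R by rewrite exprn_gt0// ltr0n.
rewrite /separation_rate mulrAC ler_pdivrMr// -(ler_pM2r nm0).
apply: (@le_trans _ _ (\prod_sg (c * n%:R))).
  rewrite prodr_const exprMn -mulrA -exprD subnKC//; last exact: leq_card_orthants.
  by rewrite (eq_card (B := {: S})).
apply: (@le_trans _ _ (\prod_sg #|N sg|%:R)).
  by apply: ler_prod => sg _; rewrite cN mulr_ge0.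
apply: (le_trans h); rewrite !natrM !natrX.
by rewrite mulrCA -!mulrA.
Qed.

Definition near_count xs n x (delta : R) : nat :=
  \sum_(J : {set 'I_n} | #|J| == d)
    (`|side (fun j => xs (member J j)) x| <=
       delta * \sum_i `|normal (fun j => xs (member J j)) i|)%R.

Lemma distance_le_near_count xs n x y (delta : R) : (0 < d)%N ->
  (forall i, `|y 0 i - x 0 i| <= delta) ->
  (empirical_distance xs n x y <= near_count xs n x delta)%N.
Proof.
move=> d0 xy; apply: leq_sum => J /eqP Jd.
case: asboolP => //; rewrite -(vertices_member _ Jd) => h.
by rewrite (segment_near_side d0 xy h).
Qed.

(** If at least k points are so close to x that few hyperplanes separate them from
    x, then the k nearest ones are separated from x by few hyperplanes too, which
    excludes the points outside the box. *)
Lemma nearest_in_box xs n k x (a b : 'rV[R]_d) (N : S -> {set 'I_n}) (c delta : R) :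
  (0 < d)%N -> (0 < n)%N -> 0 <= c ->
  (forall sg, c * n%:R <= #|N sg|%:R) ->
  (forall sg i, i \in N sg -> orthant sg x (xs i)) ->
  (forall sg i, i \in N sg -> forall j, a 0 j < xs i 0 j < b 0 j) ->
  (near_count xs n x delta)%:R < separation_rate c * n%:R ^+ d ->
  (k <= \sum_(i < n) `[< forall l, `|xs i 0 l - x 0 l| <= delta >]%R)%N ->
  forall i, i \in nearest (fun i => empirical_distance xs n x (xs i)) n k ->
    forall j, a 0 j < xs i 0 j < b 0 j.
Proof.
move=> d0 n0 c0 cN No Nab cnt kn i iN; apply: contrapT => iab.
have := far_distance d0 n0 c0 cN No Nab iab; rewrite leNgt => /negP; apply.
apply: le_lt_trans cnt; rewrite ler_nat -ltnS.
apply: (nearest_small _ iN); apply: (leq_trans kn); apply: leq_sum => l _.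
by case: asboolP => // lx; rewrite ltnS distance_le_near_count.
Qed.

End locality.

Section rational_boxes.
Context {R : realType} {d : nat}.
Implicit Types (x z : 'rV[R]_d) (a b q : 'rV[rat]_d).

Definition real_point q : 'rV[R]_d := \row_i ratr (q 0 i).

Definition rat_box (ab : 'rV[rat]_d * 'rV[rat]_d) : set 'rV[R]_d :=
  [set z | forall i, real_point ab.1 0 i < z 0 i < real_point ab.2 0 i].

Lemma measurable_rat_box ab : measurable (rat_box ab).
Proof.
apply: measurable_forall => i.
have mi : measurable_fun setT (fun z : 'rV[R]_d => z 0 i) := measurable_rV_coord (T := R) i.
rewrite (_ : (fun z => _) = [set z | slt true (real_point ab.1 0 i) (z 0 i)] `&`
   [set z | slt true (z 0 i) (real_point ab.2 0 i)]).
  by apply: measurableI; apply: measurable_slt.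
by apply/seteqP; split=> z /= => [/andP[]|[-> ->]].
Qed.

Lemma measurable_orthant_at sg q : measurable (orthant sg (real_point q)).
Proof. exact: (measurable_orthant_rel sg (f := cst (real_point q)) (g := id)). Qed.

Lemma rat_box_nbhs x (eps : R) : 0 < eps -> exists2 ab, rat_box ab x &
  forall z, rat_box ab z -> forall i, `|x 0 i - z 0 i| < eps.
Proof.
move=> eps0.
have rl i : exists q : rat, x 0 i - eps / 2 < ratr q < x 0 i.
  have [|q] := @rat_in_itvoo R (x 0 i - eps / 2) (x 0 i).
    by rewrite ltrBlDr ltrDl divr_gt0.
  by rewrite in_itv/=; exists q.
have ru i : exists q : rat, x 0 i < ratr q < x 0 i + eps / 2.
  have [|q] := @rat_in_itvoo R (x 0 i) (x 0 i + eps / 2).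
    by rewrite ltrDl divr_gt0.
  by rewrite in_itv/=; exists q.
pose a := \row_i projT1 (cid (rl i)); pose b := \row_i projT1 (cid (ru i)).
have aE i : x 0 i - eps / 2 < real_point a 0 i < x 0 i.
  by rewrite !mxE; exact: (projT2 (cid (rl i))).
have bE i : x 0 i < real_point b 0 i < x 0 i + eps / 2.
  by rewrite !mxE; exact: (projT2 (cid (ru i))).
exists (a, b).
  by move=> i /=; have /andP[_ ->] := aE i; have /andP[-> _] := bE i.
move=> z zab i; have /andP[h1 h2] := zab i; have /andP[h3 h4] := aE i.
have /andP[h5 h6] := bE i; rewrite ltr_norml; apply/andP; split; rewrite /= in h1 h2 *; lra.
Qed.

Lemma orthant_rat_point sg x z : orthant sg x z ->
  exists2 q, orthant sg x (real_point q) & orthant sg (real_point q) z.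
Proof.
move=> xz.
have r i : exists q : rat, slt (sg i) (x 0 i) (ratr q) && slt (sg i) (ratr q) (z 0 i).
  exact/slt_dense/xz.
exists (\row_i projT1 (cid (r i))) => i.
  by rewrite !mxE; have /andP[] := projT2 (cid (r i)).
by rewrite !mxE; have /andP[] := projT2 (cid (r i)).
Qed.

Lemma orthant_trans sg x y z : orthant sg x y -> orthant sg y z -> orthant sg x z.
Proof.
move=> xy yz i; exact: (slt_trans (b := sg i) (xy i) (yz i)).
Qed.

(** Boxes and orthant corners are rational so that the family is countable. *)
Definition config : countType :=
  ((('rV[rat]_d * 'rV[rat]_d) * {ffun {ffun 'I_d -> bool} -> 'rV[rat]_d})%type : countType).

Definition piece (j : config) sg : set 'rV[R]_d :=
  rat_box j.1 `&` orthant sg (real_point (j.2 sg)).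

(** For x in the core, the piece of sign sg lies in the orthant of sign sg at x, so
    that pieces can be fixed before x is known. *)
Definition core (j : config) : set 'rV[R]_d :=
  [set x | rat_box j.1 x /\ forall sg, orthant sg x (real_point (j.2 sg))].

Lemma measurable_piece j sg : measurable (piece j sg).
Proof.
by apply: measurableI; [exact: measurable_rat_box|exact: measurable_orthant_at].
Qed.

Lemma measurable_core j : measurable (core j).
Proof.
apply: measurableI; first exact: measurable_rat_box.
rewrite (_ : (fun x => _) = \bigcap_(sg in [set: {ffun 'I_d -> bool}])
    [set x | orthant sg x (real_point (j.2 sg))]).
  apply: fin_bigcap_measurable => [|sg _]; first exact: finite_finset.
  exact: (measurable_orthant_rel sg (f := id) (g := cst (real_point (j.2 sg)))).
by apply/seteqP; split=> x /= h sg => [_|]; exact: h.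
Qed.

End rational_boxes.

(** * Countably many configurations around almost every point *)

Lemma ae_forall_countable d (T : measurableType d) (R : realType)
    (m : {measure set T -> \bar R}) (K : countType) (Q : K -> T -> Prop) :
  (forall j, {ae m, forall w, Q j w}) -> {ae m, forall w, forall j, Q j w}.
Proof.
move=> mQ.
have : {ae m, forall w, forall n, if unpickle n is Some j then Q j w else True}.
  apply/ae_foralln => n; case: (unpickle n) => [j|]; [exact: mQ|exact: aeW].
by apply: filterS => w h j; have := h (pickle j); rewrite pickleK.
Qed.

Lemma ae_eq0 d (T : measurableType d) (R : realType) (m : {measure set T -> \bar R})
    (A : set T) : measurable A -> m A = 0%E -> {ae m, forall w, ~ A w}.
Proof. by move=> mA A0; exists A; split=> // w /= /contrapT. Qed.

Lemma countable_union_nonnull d (T : measurableType d) (R : realType)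
    (m : {measure set T -> \bar R}) (K : countType) (A : K -> set T) (B : set T) :
  (forall j, measurable (A j)) -> measurable B -> m B <> 0%E ->
  B `<=` [set w | exists j, A j w] -> exists j, m (A j) <> 0%E.
Proof.
move=> mA mB B0 BA; apply: contrapT => /forallNP nA; apply: B0.
apply: measure_negligible => //.
pose F n := if unpickle n is Some j then A j else set0.
have [N [mN N0 FN]] : m.-negligible (\bigcup_n F n).
  apply: negligible_bigcup => n; rewrite /F.
  case: (unpickle n) => [j|]; last exact: negligible_set0.
  by apply/negligibleP => //; apply: contrapT; exact: nA.
exists N; split=> // w /BA[j Aj]; apply: FN; exists (pickle j) => //.
by rewrite /F pickleK.
Qed.

Section local_configurations.
Context {R : realType} {disp : measure_display} {Omega : measurableType disp}
  {d : nat} (P : probability Omega R) (X : Omega -> 'rV[R]_d).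
Hypotheses (mX : measurable_fun setT X) (dX : has_density P X).
Local Notation leb := (lebesgue_rV R d).

Lemma density_null (A : set 'rV[R]_d) : measurable A -> leb A = 0%E -> P (X @^-1` A) = 0%E.
Proof.
move=> mA A0; have [f [mf f0 fE]] := dX; rewrite fE//; apply: null_set_integral => //.
by apply/measurable_EFinP; exact: measurable_funTS.
Qed.

(** A null integral of f over A forces f to vanish almost everywhere on A. *)
Lemma density_nonnull (f : 'rV[R]_d -> R) (A : set 'rV[R]_d) :
  measurable_fun setT f -> (forall x, 0 <= f x) ->
  (forall A : set 'rV[R]_d, measurable A ->
     P (X @^-1` A) = (\int[leb]_(x in A) (f x)%:E)%E) ->
  measurable A -> leb (A `&` [set x | f x != 0]) <> 0%E -> P (X @^-1` A) <> 0%E.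
Proof.
move=> mf f0 fE mA A0; rewrite fE// => /integral_eq0_ae.
have mEf : measurable_fun A (fun x => (f x)%:E) by apply/measurable_EFinP; exact: measurable_funTS.
have ge0 x : A x -> (0 <= (f x)%:E)%E by rewrite lee_fin.
move=> /(_ mA mEf ge0)[N [mN N0 AN]]; apply: A0.
have mA0 : measurable (A `&` [set x | f x != 0]).
  apply: measurableI => //.
  have -> : [set x | f x != 0] = f @^-1` (~` [set 0]).
    by apply/seteqP; split=> x /= /eqP.
  by apply: measurable_preimageT => //; apply: measurableC; exact: measurable_set1.
apply: (subset_measure0 mA0 mN _ N0) => x [Ax fx]; apply: AN => /= h.
by move: fx; have [f0x] := h Ax; rewrite /= f0x eqxx.
Qed.

Lemma continuous_rat_box (r : 'rV[R]_d -> R) x (tol : R) : {for x, continuous r} -> 0 < tol ->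
  exists2 ab, rat_box ab x &
    forall z z', rat_box ab z -> rat_box ab z' -> `|r z - r z'| <= tol.
Proof.
move=> rx tol0; have tol2 : 0 < tol / 2 by rewrite divr_gt0.
have /cvgrPdist_lt/(_ _ tol2) : r @ x --> r x by exact: rx.
move=> /nbhs_ballP[eps /= eps0 xeps].
have [ab abx abP] := rat_box_nbhs x eps0; exists ab => // z z' abz abz'.
have near y : rat_box ab y -> `|r x - r y| < tol / 2.
  by move=> aby; apply: xeps; split=> // i j; rewrite ord1; exact: (abP _ aby j).
have := near _ abz; have := near _ abz'; rewrite !ltr_norml => /andP[? ?] /andP[? ?].
by rewrite ler_norml; apply/andP; split; lra.
Qed.

(** At a continuity point x choose a rational box of small oscillation.  Where the
    density is positive, [lebesgue_rV_orthant] gives mass in each orthant at x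
    inside the box; that orthant is the countable union of its shifts to rational
    corners in it, one of which therefore has mass. *)
Lemma config_ae (r : 'rV[R]_d -> R) (tol : R) :
  {ae P, forall w, {for X w, continuous r}} -> 0 < tol ->
  {ae P, forall w, exists j : @config d,
    [/\ forall z z' : 'rV[R]_d, rat_box j.1 z -> rat_box j.1 z' -> `|r z - r z'| <= tol,
        forall sg, P (X @^-1` piece j sg) <> 0%E & core j (X w)]}.
Proof.
move=> cr tol0; have [f [mf f0 fE]] := dX.
pose A := [set x | f x != 0].
have mA : measurable A.
  have -> : A = f @^-1` (~` [set 0]) by apply/seteqP; split=> x /= /eqP.
  by apply: measurable_preimageT => //; apply: measurableC; exact: measurable_set1.
have XA : {ae P, forall w, A (X w)}.
  have : P (X @^-1` (~` A)) = 0%E.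
    rewrite fE; last exact: measurableC.
    by apply: integral0_eq => x /= /negP; rewrite negbK => /eqP ->.
  move=> /ae_eq0; have mC : measurable (X @^-1` (~` A)).
    by apply: measurable_preimageT => //; exact: measurableC.
  by move=> /(_ mC); apply: filterS => w /= /contrapT.
have mbo (ab : 'rV[rat]_d * 'rV[rat]_d) : measurable (A `&` rat_box ab).
  by apply: measurableI => //; exact: measurable_rat_box.
have Xorth (p : ('rV[rat]_d * 'rV[rat]_d) * {ffun 'I_d -> bool}) : {ae P, forall w,
    ~ ((A `&` rat_box p.1) (X w) /\ leb (A `&` rat_box p.1 `&` orthant p.2 (X w)) = 0%E)}.
  pose B := [set x | (A `&` rat_box p.1) x /\ leb (A `&` rat_box p.1 `&` orthant p.2 x) = 0%E].
  have mB : measurable B.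
    apply: measurableI => //; apply: measurable_zero.
    exact: measurable_orthant_measure.
  apply: (ae_eq0 (A := X @^-1` B)); first exact: measurable_preimageT mX mB.
  by apply: density_null => //; exact: lebesgue_rV_orthant.
move: (ae_forall_countable Xorth); move: XA; move: cr; apply: filterS3 => w cw Aw ow.
have [ab abw abr] := continuous_rat_box cw tol0.
have qP sg : exists q : 'rV[rat]_d, orthant sg (X w) (real_point q) /\
    P (X @^-1` (rat_box ab `&` orthant sg (real_point q))) <> 0%E.
  have O0 : leb (A `&` rat_box ab `&` orthant sg (X w)) <> 0%E.
    by move=> h; apply: (ow (ab, sg)).
  have mO : measurable (A `&` rat_box ab `&` orthant sg (X w)).
    by apply: measurableI => //; exact: (measurable_orthant_rel sg (f := cst (X w)) (g := id)).
  pose O (q : 'rV[rat]_d) := if `[< orthant sg (X w) (real_point q) >] then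
    A `&` rat_box ab `&` orthant sg (real_point q) else set0.
  have mOq q : measurable (O q).
    rewrite /O; case: asboolP => // _; apply: measurableI => //.
    exact: measurable_orthant_at.
  have [|q] := countable_union_nonnull mOq mO O0.
    move=> z [Abz oz]; have [q wq qz] := orthant_rat_point oz.
    by exists q; rewrite /O; case: asboolP.
  rewrite /O; case: asboolP => [wq Oq|]; last by rewrite measure0.
  exists q; split => //; apply: (density_nonnull mf f0 fE).
    by apply: measurableI; [exact: measurable_rat_box|exact: measurable_orthant_at].
  by rewrite setIC setIA.
exists (ab, [ffun sg => projT1 (cid (qP sg))]); split => //.
- by move=> sg; rewrite /piece /= ffunE; case: (cid (qP sg)) => q [].
- by split=> // sg /=; rewrite ffunE; case: (cid (qP sg)) => q [].
Qed.

Lemma small_box_ae (delta : R) : 0 < delta -> {ae P, forall w,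
  exists ab : 'rV[rat]_d * 'rV[rat]_d,
    [/\ forall z z' : 'rV[R]_d, rat_box ab z -> rat_box ab z' ->
          forall i, `|z' 0 i - z 0 i| <= delta,
        P (X @^-1` rat_box ab) <> 0%E & rat_box ab (X w)]}.
Proof.
move=> delta0.
have : {ae P, forall w, forall ab, P (X @^-1` rat_box ab) = 0%E -> ~ rat_box ab (X w)}.
  apply: ae_forall_countable => ab.
  have [ab0|abn0] := pselect (P (X @^-1` rat_box ab) = 0%E); last exact: aeW.
  have := ae_eq0 _ ab0; have mab : measurable (X @^-1` rat_box ab).
    by apply: measurable_preimageT => //; exact: measurable_rat_box.
  by move=> /(_ mab); apply: filterS => w nw _.
apply: filterS => w hw; have d2 : 0 < delta / 2 by rewrite divr_gt0.
have [ab abw abP] := rat_box_nbhs (X w) d2; exists ab; split => //; last first.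
  by move=> ab0; exact: hw ab0 abw.
move=> z z' abz abz' i; have := abP _ abz i; have := abP _ abz' i.
rewrite !ltr_norml ler_norml => /andP[? ?] /andP[? ?]; apply/andP; split; lra.
Qed.

End local_configurations.

(** * Events of vanishing probability *)

Section vanishing_events.
Context {R : realType} {disp : measure_display} {Omega : measurableType disp}
  (P : probability Omega R).

(** The probability tends to zero.  The measurable cover M is there because events
    about oscillations of r or about the k nearest points need not be measurable. *)
Definition vanishes (B : nat -> set Omega) := forall eta : R, 0 < eta ->
  exists n0, forall n, (n0 <= n)%N ->
    exists M, [/\ measurable M, B n `<=` M & (P M <= eta%:E)%E].

Lemma vanishes_sub (B B' : nat -> set Omega) n0 :
  (forall n, (n0 <= n)%N -> B n `<=` B' n) -> vanishes B' -> vanishes B.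
Proof.
move=> BB' vB' eta /vB'[n1 h]; exists (maxn n0 n1) => n; rewrite geq_max => /andP[n0n n1n].
have [M [mM B'M PM]] := h _ n1n; exists M; split=> //.
exact: subset_trans (BB' _ n0n) B'M.
Qed.

Lemma vanishes_U (B B' : nat -> set Omega) : vanishes B -> vanishes B' ->
  vanishes (fun n => B n `|` B' n).
Proof.
move=> vB vB' eta eta0; have e2 : 0 < eta / 2 by rewrite divr_gt0.
have [n1 h1] := vB _ e2; have [n2 h2] := vB' _ e2.
exists (maxn n1 n2) => n; rewrite geq_max => /andP[n1n n2n].
have [M1 [mM1 BM1 PM1]] := h1 _ n1n; have [M2 [mM2 BM2 PM2]] := h2 _ n2n.
exists (M1 `|` M2); split; [exact: measurableU|exact: setUSS|].
apply: (le_trans (measureU2 _ mM1 mM2)).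
by rewrite [eta]splitr EFinD leeD.
Qed.

Lemma vanishes_seq (K : eqType) (s : seq K) (B : K -> nat -> set Omega) :
  (forall j, j \in s -> vanishes (B j)) ->
  vanishes (fun n => [set w | exists2 j, j \in s & B j n w]).
Proof.
elim: s => [|j s IH] vB.
  by move=> eta eta0; exists 0%N => n _; exists set0; split=> //;
    [move=> w [] | rewrite measure0 lee_fin ltW].
apply: (@vanishes_sub _ (fun n => B j n `|` [set w | exists2 j, j \in s & B j n w]) 0%N).
  move=> n _ w [i]; rewrite inE => /predU1P[->|si] Bw; first by left.
  by right; exists i.
apply: vanishes_U; first by apply: vB; rewrite mem_head.
by apply: IH => i si; apply: vB; rewrite inE si orbT.
Qed.

(** Up to an event of small probability a sequence may be replaced by a simpler
    one; typically only finitely many members of a countable family remain. *)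
Lemma vanishes_approx (B : nat -> set Omega) :
  (forall eta : R, 0 < eta -> exists E B' : nat -> set Omega, vanishes B' /\
    exists n0, forall n, (n0 <= n)%N ->
      [/\ measurable (E n), (P (E n) <= eta%:E)%E & B n `<=` E n `|` B' n]) ->
  vanishes B.
Proof.
move=> h eta eta0; have e2 : 0 < eta / 2 by rewrite divr_gt0.
have [E [B' [vB' [n1 h1]]]] := h _ e2; have [n2 h2] := vB' _ e2.
exists (maxn n1 n2) => n; rewrite geq_max => /andP[n1n n2n].
have [mE PE BE] := h1 _ n1n; have [M [mM BM PM]] := h2 _ n2n.
exists (E n `|` M); split; [exact: measurableU| |].
  by move=> w /BE[Ew|/BM]; [left|right].
apply: (le_trans (measureU2 _ mE mM)).
by rewrite [eta]splitr EFinD leeD.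
Qed.

Lemma vanishes_null (Q : Omega -> Prop) : {ae P, forall w, Q w} ->
  vanishes (fun=> [set w | ~ Q w]).
Proof.
move=> [N [mN N0 QN]] eta eta0; exists 0%N => n _; exists N; split=> //.
by rewrite N0 lee_fin ltW.
Qed.

Lemma countable_cover (K : countType) (Good : K -> Prop) (E : K -> set Omega) (eta : R) :
  (forall j, measurable (E j)) -> {ae P, forall w, exists2 j, Good j & E j w} ->
  0 < eta -> exists (s : seq K) (D : set Omega),
    [/\ forall j, j \in s -> Good j, measurable D, (P D <= eta%:E)%E &
        forall w, ~ D w -> exists2 j, j \in s & E j w].
Proof.
move=> mE aeE eta0.
pose s N := [seq j <- pmap unpickle (iota 0 N) | `[< Good j >] ] : seq K.
pose D N := [set w | ~ exists2 j, j \in s N & E j w].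
have mD N : measurable (D N).
  have -> : D N = ~` \bigcup_(j in [set` s N]) E j.
    by apply/seteqP; split=> w /= h [j]; move=> sj Ej; apply: h; exists j.
  by apply: measurableC; apply: fin_bigcup_measurable => //; exact: finite_seq.
have Ddec : {homo D : n m / (n <= m)%N >-> (m <= n)%O}.
  move=> n m nm; apply/subsetPset => w; apply: contra_not => -[j sj Ej]; exists j => //.
  move: sj; rewrite !mem_filter => /andP[-> /=]; rewrite !mem_pmap => /mapP[i].
  rewrite mem_iota add0n => im jE; apply/mapP; exists i => //.
  by rewrite mem_iota add0n (leq_trans im).
have cap0 : P (\bigcap_N D N) = 0%E.
  have mcap : measurable (\bigcap_N D N) by exact: bigcapT_measurable.
  apply: measure_negligible => //; have [N [mN N0 hN]] := aeE; exists N; split=> // w Dw.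
  apply: hN => -[j gj Ej]; apply: (Dw (pickle j).+1 Logic.I); exists j => //.
  rewrite mem_filter; apply/andP; split; first exact/asboolP.
  by rewrite mem_pmap; apply/mapP; exists (pickle j); rewrite ?pickleK// mem_iota add0n ltnSn.
have : (P \o D) n @[n --> \oo] --> 0%E.
  rewrite -cap0; apply: nonincreasing_cvg_mu => //; last exact: bigcapT_measurable.
  by rewrite (le_lt_trans (probability_le1 P (mD 0%N)))// ltry.
move=> /fine_cvgP[[N1 _ DN1]] /cvgrPdist_le/(_ _ eta0)[N2 _ DN2].
pose N := maxn N1 N2; exists (s N), (D N); split => //.
- by move=> j; rewrite mem_filter => /andP[/asboolP].
- have PN : P (D N) \is a fin_num by exact: DN1 N (leq_maxl _ _).
  have := DN2 N (leq_maxr _ _); rewrite /= sub0r normrN => h.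
  by rewrite -(fineK PN) lee_fin (le_trans (ler_norm _)).
- by move=> w /contrapT.
Qed.

End vanishing_events.

Lemma positive_lower_bound (R : realType) (K : finType) (g : K -> R) :
  (forall j, 0 < g j) -> exists2 c, 0 < c & forall j, c <= g j.
Proof.
move=> g0; have : forall s : seq K, exists2 c, 0 < c & forall j, j \in s -> c <= g j.
  elim=> [|j s [c c0 cs]]; first by exists 1.
  exists (Num.min c (g j)); first by rewrite lt_min c0 g0.
  move=> i; rewrite inE => /predU1P[->|/cs ci]; first by rewrite ge_min lexx orbT.
  by rewrite ge_min ci.
by move=> /(_ (enum K))[c c0 h]; exists c => // j; apply: h; rewrite mem_enum.
Qed.

Section near_points.
Context {R : realType} {disp : measure_display} {Omega : measurableType disp}
  {d : nat} (P : probability Omega R).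
Local Notation T := ('rV[R]_d * R)%type.
Variable Z : option nat -> Omega -> T.
Hypotheses (d0 : (0 < d)%N) (mZ : forall o, measurable_fun setT (Z o))
  (indZ : mutually_independent P Z)
  (idZ : forall o o' (A : set T), measurable A -> P (Z o @^-1` A) = P (Z o' @^-1` A))
  (acZ : forall o (A : set 'rV[R]_d), measurable A -> lebesgue_rV R d A = 0%E ->
     P [set w | A (Z o w).1] = 0%E).

Definition sample w (i : nat) : 'rV[R]_d := (Z (Some i) w).1.
Definition query w : 'rV[R]_d := (Z None w).1.

Definition tuple_index n (J : {set 'I_n}) (j : 'I_d.+1) : option nat :=
  if (j < d)%N then Some (member J j) else None.

Lemma tuple_index_inj n (J : {set 'I_n}) : #|J| = d -> injective (tuple_index J).
Proof.
move=> Jd i j; rewrite /tuple_index.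
have sz : size [seq val i | i <- enum J] = d by rewrite size_map -cardE.
case: ltnP => id; case: ltnP => jd //.
  move=> [] /eqP; rewrite /member nth_uniq ?sz// => [/eqP/val_inj//|].
  by rewrite map_inj_uniq ?enum_uniq//; exact: val_inj.
move=> _; apply: val_inj; apply/eqP; rewrite eqn_leq.
by rewrite (leq_trans (ltn_ord i : (i <= d)%N) jd) (leq_trans (ltn_ord j : (j <= d)%N) id).
Qed.

Lemma near_hyperplane_tuple n (J : {set 'I_n}) delta w :
  near_hyperplane delta (block Z (tuple_index J) w) <->
  `|side (fun j => sample w (member J j)) (query w)| <=
    delta * \sum_i `|normal (fun j => sample w (member J j)) i|.
Proof.
have pE i : (i < d)%N ->
    points (block Z (tuple_index J) w) i = sample w (member J i).
  move=> id; have iS : (i < d.+1)%N by rewrite ltnS ltnW.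
  rewrite -[i in LHS]/(val (Ordinal iS)) pointsE mxE /tuple_index/= id//.
rewrite /near_hyperplane mxE /tuple_index/= ltnn -/(query w).
have -> : side (points (block Z (tuple_index J) w)) (query w) =
    side (fun j => sample w (member J j)) (query w).
  by rewrite !sideE; apply: eq_bigr => j _; congr (_ * _); apply: minor_cof_ext.
rewrite (eq_bigr (fun i => `|normal (fun j => sample w (member J j)) i|))//.
by move=> i _; congr (`| _ |); apply: minor_cof_ext.
Qed.

Lemma card_tuples_le n : (#|[pred J : {set 'I_n} | #|J| == d]| <= n ^ d)%N.
Proof.
have -> : #|[pred J : {set 'I_n} | #|J| == d]| = 'C(n, d).
  by have := card_draws 'I_n d; rewrite card_ord => <-; apply: eq_card => J; rewrite !inE.
rewrite (@leq_trans (n ^_ d))//; first by rewrite -bin_ffact leq_pmulr// fact_gt0.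
rewrite ffact_prod -[X in (n ^ X)%N]card_ord -prod_nat_const.
by apply: leq_prod => i _; exact: leq_subr.
Qed.

(** Markov's inequality; the bound is uniform in n since there are at most n^d
    sets of d indices. *)
Lemma near_count_small (theta eta : R) : 0 < theta -> 0 < eta ->
  exists2 delta : R, 0 < delta & forall n, (0 < n)%N ->
    let E := [set w | theta * n%:R ^+ d <= (near_count (sample w) n (query w) delta)%:R] in
    measurable E /\ (P E <= eta%:E)%E.
Proof.
move=> theta0 eta0.
pose e0 (j : 'I_d.+1) : option nat := Some (val j).
have e0_inj : injective e0 by move=> i j [] /val_inj.
have [|delta delta0 hd] := near_hyperplane_small mZ indZ idZ acZ e0_inj (eta := theta * eta).
  by rewrite mulr_gt0.
exists delta => // n n0 E.
pose F (J : {set 'I_n}) := [set w | near_hyperplane delta (block Z (tuple_index J) w)].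
have mF J : measurable (F J).
  exact: measurable_preimageT (measurable_block mZ _) (measurable_near_hyperplane _).
have cE w : (near_count (sample w) n (query w) delta)%:R =
    \sum_(J : {set 'I_n} | #|J| == d) \1_(F J) w :> R.
  rewrite /near_count natr_sum; apply: eq_bigr => J _; rewrite indicE.
  congr (nat_of_bool _)%:R.
  by apply/idP/idP => [/near_hyperplane_tuple h|]; rewrite inE// => /near_hyperplane_tuple.
have nd0 : 0 < theta * n%:R ^+ d by rewrite mulr_gt0// exprn_gt0// ltr0n.
have EE : E = [set w | theta * n%:R ^+ d <= \sum_(J : {set 'I_n} | #|J| == d) \1_(F J) w].
  by apply/eq_set => w; rewrite cE.
split.
  rewrite EE; apply: measurable_le_set => //.
  rewrite (_ : (fun w => _) =
    (fun w => \sum_(J : {set 'I_n}) if #|J| == d then \1_(F J) w else 0)); last first.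
    by apply/funext => w; rewrite big_mkcond.
  apply: measurable_sum => J; case: (boolP (#|J| == d)) => // _.
  exact: measurable_indic.
rewrite EE; apply: (le_trans (@markov_count _ _ _ P _ [pred J : {set 'I_n} | #|J| == d] F
   (theta * eta) _ _ _ nd0)) => //.
  by move=> J /eqP Jd; apply: hd; exact: tuple_index_inj.
rewrite lee_fin ler_pdivrMr//.
have -> : eta * (theta * n%:R ^+ d) = n%:R ^+ d * (theta * eta) by ring.
apply: ler_wpM2r; first by apply/ltW/mulr_gt0.
by rewrite -natrX ler_nat card_tuples_le.
Qed.

End near_points.

(** * Convergence of the bias *)

Section bias.
Context {R : realType} {disp : measure_display} {Omega : measurableType disp}
  {d : nat} (P : probability Omega R).
Local Notation T := ('rV[R]_d * R)%type.
Variable Z : option nat -> Omega -> T.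
Hypotheses (d0 : (0 < d)%N) (mZ : forall o, measurable_fun setT (Z o))
  (indZ : mutually_independent P Z)
  (idZ : forall o o' (A : set T), measurable A -> P (Z o @^-1` A) = P (Z o' @^-1` A))
  (dZ : has_density P (query Z)).
Variables (r : 'rV[R]_d -> R) (k : nat -> nat).
Hypotheses (cr : {ae P, forall w, {for query Z w, continuous r}})
  (k_small : ((k n)%:R / n%:R : R) @[n --> \oo] --> (0 : R)).

Lemma measurable_query : measurable_fun setT (query Z).
Proof. exact: (measurableT_comp measurable_fst (mZ None)). Qed.

Lemma point_law o (A : set 'rV[R]_d) : measurable A ->
  P [set w | A (Z o w).1] = P (query Z @^-1` A).
Proof.
by move=> mA; apply: (idZ o None (A := fst @^-1` A)); exact: measurable_preimageT measurable_fst mA.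
Qed.

Lemma point_ac o (A : set 'rV[R]_d) : measurable A -> lebesgue_rV R d A = 0%E ->
  P [set w | A (Z o w).1] = 0%E.
Proof.
by move=> mA A0; rewrite point_law//; exact: (density_null dZ).
Qed.

Definition hits n (A : set 'rV[R]_d) w : R := \sum_(i < n) \1_A (sample Z w i).

Lemma hits_vanishes (A : set 'rV[R]_d) : measurable A -> P (query Z @^-1` A) <> 0%E ->
  exists2 p : R, 0 < p & vanishes P (fun n => [set w | hits n A w <= p * n%:R]).
Proof.
move=> mA A0; set B : set T := fst @^-1` A.
have mB : measurable B := measurable_preimageT measurable_fst mA.
have mXA : measurable (query Z @^-1` A) := measurable_preimageT measurable_query mA.
have pfin : P (query Z @^-1` A) \is a fin_num by exact: fin_num_measure.
pose p := fine (P (query Z @^-1` A)).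
have pE o : P (Z o @^-1` B) = p%:E by rewrite /p fineK//; exact: point_law.
have p0 : 0 < p.
  by rewrite -lte_fin /p fineK// lt_neqAle eq_sym measure_ge0 andbT; exact/eqP.
exists (p / 2); first by rewrite divr_gt0.
move=> eta eta0.
have e_inj : injective (@Some nat) by move=> i j [].
have [n0 h] := frequency_lln mZ indZ e_inj mB pE p0 eta0.
exists n0 => n n0n; have := h _ n0n; set M := [set w | _] => PM.
exists M; split=> //.
  apply: measurable_le_set => //; apply: measurable_sum => i.
  exact: (measurableT_comp (measurable_indic mB)).
Qed.

Lemma k_lt_fraction (p : R) : 0 < p -> exists n0, forall n, (n0 <= n)%N ->
  (k n)%:R <= p * n%:R.
Proof.
move=> p0; have /cvgrPdist_le/(_ _ p0)[n0 _ h] := k_small.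
exists (maxn n0 1) => n; rewrite geq_max => /andP[n0n n1].
have := h n n0n; rewrite /= sub0r normrN ger0_norm ?divr_ge0//.
by rewrite ler_pdivrMr ?ltr0n.
Qed.

Lemma hits_card n (A : set 'rV[R]_d) w :
  hits n A w = (\sum_(i < n) `[< A (sample Z w i) >])%N%:R.
Proof.
by rewrite natr_sum; apply: eq_bigr => i _; rewrite indicE; congr (nat_of_bool _)%:R.
Qed.

Definition nearest_sample n w : seq nat :=
  nearest (fun i => empirical_distance (sample Z w) n (query Z w) (sample Z w i)) n (k n).

(** The configuration around the query point comes first: its masses fix the
    proportion theta of separating hyperplanes.  Then delta is chosen so that
    fewer than theta n^d hyperplanes pass within delta of the query point.  Last
    comes a cell of diameter at most delta around the query point, whose mass
    provides k_n close sample points.  What remains is the failure of finitely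
    many laws of large numbers. *)
Lemma bias_vanishes (tol : R) : 0 < tol ->
  vanishes P (fun n => [set w | exists2 i, i \in nearest_sample n w &
    ~ (`|r (sample Z w i) - r (query Z w)| <= tol)]).
Proof.
move=> tol0; set B := fun n => [set w | _].
apply: vanishes_approx => eta eta0.
pose Good (j : @config d) :=
  (forall z z' : 'rV[R]_d, rat_box j.1 z -> rat_box j.1 z' -> `|r z - r z'| <= tol) /\
  forall sg, P (query Z @^-1` piece j sg) <> 0%E.
have [s [D [sG mD PD Dcov]]] : exists (s : seq (@config d)) (D : set Omega),
    [/\ forall j, j \in s -> Good j, measurable D, (P D <= eta%:E)%E &
        forall w, ~ D w -> exists2 j, j \in s & (query Z @^-1` core j) w].
  apply: countable_cover => //.
    by move=> j; apply: (measurable_preimageT measurable_query); exact: measurable_core.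
  have := config_ae measurable_query dZ cr tol0; apply: filterS => w [j [j1 j2 j3]].
  by exists j.
exists (fun=> D), (fun n => [set w | exists2 j, j \in s & (B n `&` (query Z @^-1` core j)) w]).
split; last first.
  exists 0%N => n _; split=> // w Bw.
  have [Dw|/Dcov[j sj cj]] := pselect (D w); first by left.
  by right; exists j.
(* From here on the configuration j is fixed. *)
apply: (vanishes_seq (B := fun j n => B n `&` (query Z @^-1` core j))) => j /sG[jr jp].
clear eta eta0 s D sG mD PD Dcov.
have /(_ _)/cid2-/all_sig2[p p0 vp] sg := hits_vanishes (measurable_piece j sg) (jp sg).
have [c c0 cp] := positive_lower_bound p0.
have th0 := separation_rate_gt0 d0 c0 : 0 < @separation_rate R d c.
apply: vanishes_approx => eta eta0.
have [delta delta0 hdelta] := near_count_small mZ indZ idZ point_ac th0 eta0.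
pose E := fun n : nat => [set w : Omega | @separation_rate R d c * n%:R ^+ d <=
   (near_count (sample Z w) n (query Z w) delta)%:R].
exists E, (fun n => (B n `&` (query Z @^-1` core j)) `\` E n); split; last first.
  exists 1%N => n n1; have [mE PE] := hdelta n n1; split=> // w Bw.
  by have [Ew|nEw] := pselect (E n w); [left|right].
apply: vanishes_approx => eta' eta'0.
pose Good' (ab : 'rV[rat]_d * 'rV[rat]_d) :=
  (forall z z' : 'rV[R]_d, rat_box ab z -> rat_box ab z' -> forall i, `|z' 0 i - z 0 i| <= delta) /\
  P (query Z @^-1` rat_box ab) <> 0%E.
have [s [D [sG mD PD Dcov]]] : exists (s : seq ('rV[rat]_d * 'rV[rat]_d)) (D : set Omega),
    [/\ forall j, j \in s -> Good' j, measurable D, (P D <= eta'%:E)%E &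
        forall w, ~ D w -> exists2 j, j \in s & (query Z @^-1` rat_box j) w].
  apply: countable_cover => //.
    by move=> ab; apply: (measurable_preimageT measurable_query); exact: measurable_rat_box.
  have := small_box_ae P measurable_query delta0; apply: filterS => w [ab [ab1 ab2 ab3]].
  by exists ab.
pose B1 n := (B n `&` (query Z @^-1` core j)) `\` E n.
exists (fun=> D), (fun n =>
  [set w | exists2 ab, ab \in s & (B1 n `&` (query Z @^-1` rat_box ab)) w]).
split; last first.
  exists 0%N => n _; split=> // w Bw.
  have [Dw|/Dcov[ab sab abw]] := pselect (D w); first by left.
  by right; exists ab.
apply: (vanishes_seq (B := fun ab n => B1 n `&` (query Z @^-1` rat_box ab))) => ab /sG[abd abp].
have [p' p'0 vp'] := hits_vanishes (measurable_rat_box ab) abp.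
have [n0 kn0] := k_lt_fraction p'0.
have vps := @vanishes_seq _ _ _ P _ (enum {: {ffun 'I_d -> bool}}) _ (fun sg _ => vp sg).
apply: (vanishes_sub (n0 := maxn n0 1) _ (vanishes_U vps vp')).
move=> n; rewrite geq_max => /andP[n0n n1] w [[[[i iN ri] [wbox wq]] nE] wab].
apply: contrapT => /not_orP[npiece ncell]; apply: ri.
pose N sg : {set 'I_n} := [set i : 'I_n | `[< piece j sg (sample Z w i) >] ]%SET.
apply: (jr _ _ _ wbox).
have := @nearest_in_box R d (sample Z w) n (k n) (query Z w) (real_point j.1.1) (real_point j.1.2)
  N c delta d0 n1 (ltW c0).
apply => //.
- move=> sg; have : ~ (hits n (piece j sg) w <= p sg * n%:R).
    by move=> hsg; apply: npiece; exists sg; rewrite ?mem_enum.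
  move/negP; rewrite -ltNge => /ltW; rewrite hits_card => h.
  rewrite (le_trans _ (le_trans h _))//.
    by rewrite ler_wpM2r.
  rewrite ler_nat -sum1_card [leqRHS]big_mkcond/=; apply: leq_sum => l _.
  by rewrite inE; case: asboolP.
- move=> sg l; rewrite inE => /asboolP[_ ol].
  exact: orthant_trans (wq sg) ol.
- by move=> sg l; rewrite inE => /asboolP[+ _].
- by move/negP : nE; rewrite -ltNge.
- have : ~ (hits n (rat_box ab) w <= p' * n%:R) by [].
  move/negP; rewrite -ltNge => /ltW /(le_trans (kn0 _ n0n)).
  rewrite hits_card ler_nat => /leq_trans; apply; apply: leq_sum => l _.
  by case: asboolP => // abl; case: asboolP => // nd; exfalso; apply: nd; exact: abd.
Qed.

End bias.

(** * Integrals of dominated functions and truncation *)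

Section integral_tools.
Context {R : realType} {disp : measure_display} {Omega : measurableType disp}
  (P : probability Omega R).

(** The integral of a nonnegative function is a supremum over the simple functions
    below it, so it is monotone for nonmeasurable functions as well. *)
Lemma le_integral_dominated (f g : Omega -> \bar R) :
  (forall w, 0 <= f w)%E -> (forall w, f w <= g w)%E ->
  (\int[P]_w f w <= \int[P]_w g w)%E.
Proof.
move=> f0 fg; have g0 w : (0 <= g w)%E := le_trans (f0 w) (fg w).
rewrite !ge0_integralTE//; apply: le_ereal_sup => _ [h hf <-]; exists h => // w.
exact: le_trans (hf w) (fg w).
Qed.

(** The function f may fail to be measurable; it is compared with a measurable
    function that is infinite on the null set N. *)
Lemma integral_le_off_event (f : Omega -> R) (M N : set Omega) (a b eta : R) :
  measurable M -> (P M <= eta%:E)%E -> measurable N -> P N = 0%E ->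
  0 <= a -> 0 <= b -> (forall w, 0 <= f w) -> (forall w, ~ N w -> f w <= b) ->
  (forall w, ~ N w -> ~ M w -> f w <= a) ->
  (\int[P]_w (f w)%:E <= (a + b * eta)%:E)%E.
Proof.
move=> mM PM mN N0 a0 b0 f0 fb fa.
pose u w := (a + b * \1_M w)%:E.
have mu : measurable_fun setT u.
  apply/measurable_EFinP; apply: measurable_funD => //.
  by apply: measurable_funM => //; exact: measurable_indic.
have u0 w : (0 <= u w)%E by rewrite lee_fin addr_ge0// mulr_ge0// indicE.
pose v := (cst +oo \_ N : Omega -> \bar R)%E.
have mv : measurable_fun setT v by apply/(measurable_restrictT _ mN); exact: measurable_cst.
have vN w : N w -> (v w = +oo)%E by move=> Nw; rewrite /v patchT ?mem_set.
have vC w : ~ N w -> (v w = 0)%E by move=> nN; rewrite /v patchC// inE.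
have v0 w : (0 <= v w)%E.
  by have [/vN->//|/vC->] := pselect (N w).
apply: (@le_trans _ _ (\int[P]_w (u w + v w))%E).
  apply: le_integral_dominated => w; first by rewrite lee_fin.
  have [wN|wN] := pselect (N w); first by rewrite vN// addey ?leey// /u.
  rewrite vC//.
  rewrite adde0 lee_fin indicE; have [Mw|nMw] := pselect (M w).
    by rewrite mem_set// mulr1 (le_trans (fb _ wN))// lerDr.
  by rewrite memNset// mulr0 addr0 fa.
have iv : (\int[P]_w v w = 0)%E.
  by rewrite /v -integral_mkcond null_set_integral//; exact: measurable_cst.
rewrite ge0_integralD// iv adde0.
rewrite /u; under eq_integral do rewrite EFinD.
rewrite ge0_integralD//; last 2 first.
- by move=> w _; rewrite lee_fin mulr_ge0// indicE.
- by apply/measurable_EFinP; apply: measurable_funM => //; exact: measurable_indic.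
rewrite integral_cst// -[X in (_ * X + _)%E]/(P setT) probability_setT mule1 EFinD leeD2l//.
under eq_integral do rewrite EFinM.
have m1 : measurable_fun setT (EFin \o (\1_M : Omega -> R)).
  by apply/measurable_EFinP; exact: measurable_indic.
have b0' : (0 <= b%:E)%E by rewrite lee_fin.
have i0 w : (0 <= (\1_M w : R)%:E)%E by rewrite lee_fin indicE.
rewrite (ge0_integralZl P measurableT m1 (fun w _ => i0 w) b0').
rewrite integral_indic// setIT EFinM; apply: lee_wpmul2l; rewrite ?lee_fin//; exact: PM.
Qed.

Lemma null_of_eq_integral (B : set Omega) (f g : Omega -> R) :
  measurable B -> P.-integrable B (EFin \o f) -> P.-integrable B (EFin \o g) ->
  (forall w, B w -> f w < g w) ->
  (\int[P]_(w in B) (f w)%:E = \int[P]_(w in B) (g w)%:E)%E -> P B = 0%E.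
Proof.
move=> mB intf intg fg fgE.
have [mf _] := integrableP _ _ _ intf; have [mg _] := integrableP _ _ _ intg.
have : (\int[P]_(w in B) ((g w)%:E - (f w)%:E) = 0)%E.
  rewrite integralB// -fgE subee//; exact: integrable_fin_num.
have mgf : measurable_fun B (fun w => (g w)%:E - (f w)%:E)%E by exact: emeasurable_funB.
move=> /(integral_eq0_ae P mB mgf)[|N [mN N0 hN]].
  by move=> w Bw; rewrite -EFinB lee_fin subr_ge0 ltW// fg.
apply: (subset_measure0 mB mN _ N0) => w Bw; apply: hN => /= h.
by have := h Bw; rewrite -EFinB => -[] /eqP; rewrite subr_eq0 gt_eqF// fg.
Qed.

End integral_tools.

Section clip.
Context {R : realType}.

Definition clip (M y : R) : R := Num.max (- M) (Num.min y M).

Lemma clip_norm M y : 0 <= M -> `|clip M y| <= M.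
Proof.
move=> M0; rewrite ler_norml /clip le_max lexx/= ge_max ge_min lexx orbT andbT.
by rewrite lerNl (le_trans _ M0)// oppr_le0.
Qed.

Lemma clip_id M y : `|y| <= M -> clip M y = y.
Proof.
by rewrite ler_norml => /andP[h1 h2]; rewrite /clip min_l// max_r.
Qed.

Lemma measurable_clip M : measurable_fun setT (clip M).
Proof.
by apply: measurable_maxr => //; apply: measurable_minr.
Qed.

End clip.

(** * Residuals of the regression function *)

Section regression.
Context {R : realType} {disp : measure_display} {Omega : measurableType disp}
  {d : nat} (P : probability Omega R).
Local Notation T := ('rV[R]_d * R)%type.
Variable Z : option nat -> Omega -> T.
Hypotheses (d0 : (0 < d)%N) (mZ : forall o, measurable_fun setT (Z o))
  (indZ : mutually_independent P Z)
  (idZ : forall o o' (A : set T), measurable A -> P (Z o @^-1` A) = P (Z o' @^-1` A)).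

Lemma integral_same_law (F : T -> R) (C : R) o o' :
  measurable_fun setT F -> (forall z, `|F z| <= C) ->
  (\int[P]_w (F (Z o w))%:E = \int[P]_w (F (Z o' w))%:E)%E.
Proof.
move=> mF FC.
have mEF : measurable_fun setT (EFin \o F) by exact/measurable_EFinP.
have tr o1 : (\int[P]_w (F (Z o1 w))%:E =
    \int[image_measure P (mZ o1)]_z (EFin \o F) z)%E.
  rewrite integral_pushforward//.
  apply: (@bounded_integrable _ _ _ P (F \o Z o1) C); last by move=> w; exact: FC.
  exact: measurableT_comp.
rewrite !tr; apply: eq_measure_integral => A mA _; exact: idZ.
Qed.

Lemma ae_same_law (A : set T) : measurable A -> {ae P, forall w, A (Z None w)} ->
  {ae P, forall w, forall o, A (Z o w)}.
Proof.
move=> mA [N [mN N0 AN]]; apply: ae_forall_countable => o.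
have mC : measurable (~` A) by exact: measurableC.
have C0 : P (Z o @^-1` (~` A)) = 0%E.
  rewrite (idZ o None mC); apply: (subset_measure0 _ mN _ N0) => //.
  exact: measurable_preimageT (mZ None) mC.
have mCo : measurable (Z o @^-1` (~` A)) by exact: measurable_preimageT (mZ o) mC.
by have := ae_eq0 mCo C0; apply: filterS => w /= /contrapT.
Qed.

Variables (r : 'rV[R]_d -> R) (M : R).
Hypotheses (M0 : 0 <= M) (mr : measurable_fun setT r)
  (YM : {ae P, forall w, `|(Z None w).2| <= M})
  (intr : P.-integrable setT (fun w => (r (query Z w))%:E))
  (rE : forall A : set 'rV[R]_d, measurable A ->
     (\int[P]_(w in query Z @^-1` A) ((Z None w).2)%:E =
      \int[P]_(w in query Z @^-1` A) (r (query Z w))%:E)%E).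

Let mq : measurable_fun setT (query Z).
Proof. exact: (measurableT_comp measurable_fst (mZ None)). Qed.

Let mY : measurable_fun setT (fun w => (Z None w).2).
Proof. exact: (measurableT_comp measurable_snd (mZ None)). Qed.

Let mcY : measurable_fun setT (fun w => clip M (Z None w).2).
Proof. exact: (measurableT_comp (measurable_clip M) mY). Qed.

Lemma clipped_label_integral (A : set 'rV[R]_d) : measurable A ->
  (\int[P]_(w in query Z @^-1` A) (clip M (Z None w).2)%:E =
   \int[P]_(w in query Z @^-1` A) (r (query Z w))%:E)%E.
Proof.
move=> mA; rewrite -rE//; have mqA := measurable_preimageT mq mA.
apply: ae_eq_integral => //.
- by apply/measurable_EFinP; exact: measurable_funTS.
- by apply/measurable_EFinP; exact: measurable_funTS.
- by move: YM; apply: filterS => w h _; rewrite clip_id.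
Qed.

Let icY (B : set Omega) : measurable B ->
  P.-integrable B (EFin \o (fun w => clip M (Z None w).2)).
Proof.
move=> mB; apply: (integrableS measurableT) => //.
by apply: (@bounded_integrable _ _ _ P _ M) => // w; exact: clip_norm.
Qed.

(** On the event that r(X) exceeds M, the integrals of the truncated label and of
    r(X) agree although the former is pointwise smaller, so the event is null;
    likewise below -M. *)
Lemma regression_bounded : {ae P, forall w, `|r (query Z w)| <= M}.
Proof.
have mlt (b : bool) (c : R) : measurable [set x | slt b c (r x)].
  by apply: measurable_slt => //; exact: measurable_cst.
have ir (B : set Omega) : measurable B -> P.-integrable B (EFin \o (r \o query Z)).
  by move=> mB; exact: (integrableS measurableT).
have hi : P (query Z @^-1` [set x | slt true M (r x)]) = 0%E.
  have mB := measurable_preimageT mq (mlt true M).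
  apply: (null_of_eq_integral mB (icY mB) (ir _ mB)).
    move=> w /= h; apply: le_lt_trans h.
    by have := clip_norm (Z None w).2 M0; rewrite ler_norml => /andP[].
  exact: clipped_label_integral.
have lo : P (query Z @^-1` [set x | slt false (- M) (r x)]) = 0%E.
  have mB := measurable_preimageT mq (mlt false (- M)).
  apply: (null_of_eq_integral mB (ir _ mB) (icY mB)).
    move=> w /= h; apply: (lt_le_trans h).
    by have := clip_norm (Z None w).2 M0; rewrite ler_norml => /andP[].
  by rewrite clipped_label_integral.
have := ae_eq0 (measurable_preimageT mq (mlt true M)) hi.
have := ae_eq0 (measurable_preimageT mq (mlt false (- M))) lo.
apply: filterS2 => w /= /negP h1 /negP h2.
by rewrite ler_norml; move: h1 h2; rewrite -!leNgt => -> ->.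
Qed.

(** Truncation changes nothing almost surely and makes the residual bounded
    everywhere. *)
Definition residual (z : T) : R := clip M z.2 - clip M (r z.1).

Lemma measurable_residual : measurable_fun setT residual.
Proof.
apply: measurable_funB; apply: (measurableT_comp (measurable_clip M)).
  exact: measurable_snd.
exact: (measurableT_comp mr measurable_fst).
Qed.

Lemma residual_bound z : `|residual z| <= M + M.
Proof.
by rewrite (le_trans (ler_normB _ _))// lerD// clip_norm.
Qed.

(** This is the defining property of the regression function, applied to the set
    of positions S. *)
Lemma residual_centered o (S : set 'rV[R]_d) : measurable S ->
  (\int[P]_w (\1_S (Z o w).1 * residual (Z o w))%:E = 0)%E.
Proof.
move=> mS; have m1S : measurable_fun setT (fun z : T => \1_S z.1 : R).
  exact: (measurableT_comp (measurable_indic mS) measurable_fst).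
rewrite (@integral_same_law (fun z => \1_S z.1 * residual z) (M + M) o None); last 2 first.
- by apply: measurable_funM => //; exact: measurable_residual.
- move=> z; rewrite normrM indicE; case: (_ \in _); rewrite ?normr1 ?mul1r ?residual_bound//.
  by rewrite normr0 mul0r addr_ge0.
have mqS := measurable_preimageT mq mS.
have mcr : measurable_fun setT (fun w => clip M (r (query Z w))).
  by apply: (measurableT_comp (measurable_clip M)); exact: measurableT_comp.
transitivity (\int[P]_(w in query Z @^-1` S)
   ((clip M (Z None w).2)%:E - (clip M (r (query Z w)))%:E))%E.
  rewrite [RHS]integral_mkcond; apply: eq_integral => w _.
  rewrite /patch indicE; case: ifPn => wS.
    by rewrite (_ : _ \in S) ?mul1r ?EFinB//; move: wS; rewrite !inE.
  rewrite (_ : (_ \in S) = false) ?mul0r//; apply/negbTE; apply: contra wS.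
  by rewrite !inE.
rewrite integralB//; last 2 first.
- exact: icY.
- apply: (integrableS measurableT) => //.
  by apply: (@bounded_integrable _ _ _ P _ M) => // w; exact: clip_norm.
rewrite clipped_label_integral//.
have -> : (\int[P]_(w in query Z @^-1` S) (r (query Z w))%:E =
    \int[P]_(w in query Z @^-1` S) (clip M (r (query Z w)))%:E)%E.
  apply: ae_eq_integral => //.
  - by apply/measurable_EFinP; apply: measurable_funTS; exact: measurableT_comp.
  - by apply/measurable_EFinP; exact: measurable_funTS.
  - by have := regression_bounded; apply: filterS => w h _; rewrite clip_id.
rewrite subee//; apply: integrable_fin_num => //; apply: (integrableS measurableT) => //.
by apply: (@bounded_integrable _ _ _ P _ M) => // w; exact: clip_norm.
Qed.

End regression.

(** * Consistency in mean of order p *)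

Section consistency.
Context {R : realType} {disp : measure_display} {Omega : measurableType disp}
  {d : nat} (P : probability Omega R).
Local Notation T := ('rV[R]_d * R)%type.
Variable Z : option nat -> Omega -> T.
Hypotheses (d0 : (0 < d)%N) (mZ : forall o, measurable_fun setT (Z o))
  (indZ : mutually_independent P Z)
  (idZ : forall o o' (A : set T), measurable A -> P (Z o @^-1` A) = P (Z o' @^-1` A))
  (dZ : has_density P (query Z)).
Variables (r : 'rV[R]_d -> R) (M : R) (k : nat -> nat).
Hypotheses (M0 : 0 <= M) (mr : measurable_fun setT r)
  (YM : {ae P, forall w, `|(Z None w).2| <= M})
  (intr : P.-integrable setT (fun w => (r (query Z w))%:E))
  (rE : forall A : set 'rV[R]_d, measurable A ->
     (\int[P]_(w in query Z @^-1` A) ((Z None w).2)%:E =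
      \int[P]_(w in query Z @^-1` A) (r (query Z w))%:E)%E)
  (cr : {ae P, forall w, {for query Z w, continuous r}})
  (k_range : forall n, (d <= n)%N -> (1 <= k n <= n)%N)
  (k_oo : k @ \oo --> \oo)
  (k_small : ((k n)%:R / n%:R : R) @[n --> \oo] --> (0 : R)).

Lemma general_position_ext (u v : nat -> 'rV[R]_d) :
  (forall i, (i < d)%N -> u i = v i) -> general_position u -> general_position v.
Proof.
by move=> uv [i ni]; exists i; rewrite /normal -(minor_cof_ext _ uv).
Qed.

(** The almost sure event on which truncation changes nothing and the signs of the
    side functions determine the empirical distances. *)
Definition typical w : Prop :=
  (forall o, `|(Z o w).2| <= M /\ `|r (Z o w).1| <= M) /\
  (forall s : seq nat, uniq s -> size s = d ->
     general_position (fun j => sample Z w (nth 0%N s j))).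

Lemma typical_ae : {ae P, forall w, typical w}.
Proof.
have bnd : {ae P, forall w, forall o, `|(Z o w).2| <= M /\ `|r (Z o w).1| <= M}.
  apply: (ae_same_law mZ idZ (A := [set z : T | `|z.2| <= M /\ `|r z.1| <= M])).
    apply: measurableI; apply: measurable_le_set => //; apply: measurableT_comp => //.
    exact: (measurableT_comp mr measurable_fst).
  have := regression_bounded mZ M0 mr YM intr rE; move: YM.
  by apply: filterS2 => w.
have gp : {ae P, forall w, forall s : seq nat, uniq s -> size s = d ->
     general_position (fun j => sample Z w (nth 0%N s j))}.
  apply: ae_forall_countable => s.
  have [/andP[us /eqP sd]|nus] := boolP (uniq s && (size s == d)); last first.
    by apply: aeW => w us sd; rewrite us sd eqxx in nus.
  pose e (j : 'I_d) : option nat := Some (nth 0%N s j).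
  have e_inj : injective e.
    move=> i j [] /eqP; rewrite nth_uniq ?sd// => /eqP; exact: val_inj.
  have := general_position_ae d0 mZ indZ (point_ac idZ dZ) e_inj.
  apply: filterS => w + _ _; apply: general_position_ext => i id.
  by rewrite -[i]/(val (Ordinal id)) pointsE mxE.
by apply: filterS2 bnd gp => w.
Qed.

Definition sample_index n (i : 'I_n.+1) : option nat :=
  if (i < n)%N then Some (val i) else None.

Lemma sample_index_inj n : injective (@sample_index n).
Proof.
move=> i j; rewrite /sample_index; case: ltnP => ni; case: ltnP => nj //.
  by move=> [] /val_inj.
by move=> _; apply: val_inj; apply/eqP; rewrite eqn_leq
  (leq_trans (ltn_ord i : (i <= n)%N) nj) (leq_trans (ltn_ord j : (j <= n)%N) ni).
Qed.

Lemma sample_index_widen n (i : 'I_n) : sample_index (widen_ord (leqnSn n) i) = Some (val i).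
Proof. by rewrite /sample_index /= ltn_ord. Qed.

Definition residual_sum n w : R :=
  \sum_(i < n) (val i \in nearest_by_sides (k n) (block Z (@sample_index n) w))%:R *
    residual r M (Z (Some (val i)) w).

Lemma residual_sum_vanishes (t : R) : 0 < t ->
  vanishes P (fun n => [set w | (d <= n)%N /\ (k n)%:R * t <= `|residual_sum n w|]).
Proof.
move=> t0 eta eta0.
have mres := measurable_residual (d := d) M mr.
pose c := (M + M) ^+ 2 / (eta * t ^+ 2).
have c0 : 0 <= c by rewrite divr_ge0 ?sqr_ge0// mulr_ge0 ?sqr_ge0// ltW.
have /k_oo[n0 _ kn0] : \oo%classic [set m | (Num.truncn c < m)%N].
  by exists (Num.truncn c).+1.
exists (maxn n0 d) => n; rewrite geq_max => /andP[n0n dn].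
have ck : c < (k n)%:R.
  by rewrite (lt_le_trans (truncnS_gt c))// ler_nat; exact: kn0.
exists [set w | (k n)%:R * t <= `|residual_sum n w|]; split.
- apply: measurable_le_set => //; apply: measurableT_comp => //.
  apply: measurable_sum => i.
  pose g (v : 'rV[T]_n.+1) := (val i \in nearest_by_sides (k n) v)%:R *
    residual r M (v 0 (widen_ord (leqnSn n) i)).
  apply: (eq_measurable_fun (g \o block Z (@sample_index n))).
    by move=> w _; rewrite /g /= mxE sample_index_widen.
  apply: measurableT_comp; last exact: measurable_block.
  exact: measurable_nearest_term.
- by move=> w [].
- have := nearest_average_deviation mZ indZ mres (residual_bound r M0)
    (residual_centered mZ idZ M0 mr YM intr rE) (@sample_index_inj n) (k_range dn) t0.
  under eq_set do under eq_bigr do rewrite sample_index_widen.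
  move=> /le_trans; apply; rewrite lee_fin.
  have kn_gt0 : 0 < (k n)%:R :> R by exact: le_lt_trans ck.
  rewrite ler_pdivrMr ?mulr_gt0 ?exprn_gt0//.
  have : c * (eta * t ^+ 2) <= (k n)%:R * (eta * t ^+ 2).
    by rewrite ler_wpM2r ?ltW// mulr_gt0// exprn_gt0.
  rewrite /c divfK ?gt_eqF// ?mulr_gt0 ?exprn_gt0// => /le_trans; apply.
  by rewrite mulrCA.
Qed.

Lemma typical_nearest n w : typical w -> (d <= n)%N ->
  nearest_sample Z k n w = nearest_by_sides (k n) (block Z (@sample_index n) w).
Proof.
move=> [_ gp] dn.
have pE (i : 'I_n) : points (block Z (@sample_index n) w) i = sample Z w i.
  by rewrite -[i : nat]/(val (widen_ord (leqnSn n) i)) pointsE mxE sample_index_widen.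
apply: nearest_by_sidesE => //.
  by rewrite -[n in points _ n]/(val (@ord_max n)) pointsE mxE /sample_index /= ltnn.
move=> J Jd; apply: general_position_ext (gp [seq val i | i <- enum J] _ _).
- move=> j jd; rewrite -/(member J j).
  by rewrite -(pE (Ordinal (@member_lt d n J (Ordinal jd) Jd))).
- by rewrite map_inj_uniq ?enum_uniq//; exact: val_inj.
- by rewrite size_map -cardE.
Qed.

Definition estimate n w : R :=
  knn_estimate (sample Z w) (fun i => (Z (Some i) w).2) n (k n) (query Z w).

Lemma estimate_nearest n w : (d <= n)%N ->
  estimate n w = (k n)%:R^-1 * \sum_(i <- nearest_sample Z k n w) (Z (Some i) w).2.
Proof.
by move=> dn; rewrite /estimate knn_estimateE//; have /andP[] := k_range dn.
Qed.

Lemma mean_nearest_le n w (F : nat -> R) (c : R) : (d <= n)%N ->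
  (forall i, i \in nearest_sample Z k n w -> `|F i| <= c) ->
  `|(k n)%:R^-1 * \sum_(i <- nearest_sample Z k n w) F i| <= c.
Proof.
move=> dn Fc; have /andP[k1 kn] := k_range dn.
have k0 : 0 < (k n)%:R :> R by rewrite ltr0n.
rewrite normrM ger0_norm ?invr_ge0 ?(ltW k0)// mulrC ler_pdivrMr//.
rewrite (le_trans (ler_norm_sum _ _ _))//.
apply: (@le_trans _ _ (\sum_(i <- nearest_sample Z k n w) c)).
  by rewrite big_seq [leRHS]big_seq; apply: ler_sum => i; exact: Fc.
by rewrite big_const_seq count_predT size_nearest// iter_addr_0 mulr_natr.
Qed.

Lemma estimate_error n w (t : R) : typical w -> (d <= n)%N ->
  ~ ((k n)%:R * t <= `|residual_sum n w|) ->
  (forall i, i \in nearest_sample Z k n w ->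
     `|r (sample Z w i) - r (query Z w)| <= t) ->
  `|estimate n w - r (query Z w)| <= t + t.
Proof.
move=> typ dn res bias; have /andP[k1 kn] := k_range dn.
have k0 : 0 < (k n)%:R :> R by rewrite ltr0n.
have -> : estimate n w - r (query Z w) =
    (k n)%:R^-1 * \sum_(i <- nearest_sample Z k n w) residual r M (Z (Some i) w) +
    (k n)%:R^-1 * \sum_(i <- nearest_sample Z k n w) (r (sample Z w i) - r (query Z w)).
  rewrite -mulrDr -big_split/=.
  rewrite (eq_bigr (fun i => (Z (Some i) w).2 - r (query Z w))); last first.
    move=> i _; rewrite /residual !clip_id; last 2 first.
    - by have [/(_ (Some i))[]] := typ.
    - by have [/(_ (Some i))[]] := typ.
    by rewrite addrA subrK.
  rewrite sumrB mulrBr -estimate_nearest//; congr (_ - _).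
  rewrite big_const_seq count_predT size_nearest// iter_addr_0 -(mulr_natl (r (query Z w))) mulKf//.
  by rewrite gt_eqF.
rewrite (le_trans (ler_normD _ _))// lerD//; last exact: mean_nearest_le.
rewrite normrM ger0_norm ?invr_ge0 ?(ltW k0)// mulrC ler_pdivrMr// mulrC.
move/negP : res; rewrite -ltNge => /ltW; apply: le_trans.
rewrite le_eqVlt; apply/orP; left; apply/eqP; congr (`| _ |).
rewrite typical_nearest// big_nearest big_mkcond/=; apply: eq_bigr => i _.
by case: (_ \in _); rewrite ?mul1r ?mul0r.
Qed.

(** An atypical sample, a large sum of residuals or a selected point at which r is
    far from r(X) are the only causes of a large error. *)
Lemma estimate_error_vanishes (t : R) : 0 < t ->
  vanishes P (fun n => [set w | ~ (`|estimate n w - r (query Z w)| <= t + t)]).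
Proof.
move=> t0.
apply: (vanishes_sub (n0 := d) _ (vanishes_U (vanishes_null typical_ae)
  (vanishes_U (residual_sum_vanishes t0) (bias_vanishes d0 mZ indZ idZ dZ cr k_small t0)))).
move=> n dn w /= err; apply: contrapT => /not_orP[/contrapT typ /not_orP[res bias]].
apply: err; apply: (estimate_error typ dn) => [h|i iN]; first exact: res.
by apply: contrapT => ni; apply: bias; exists i.
Qed.

Lemma estimate_error_bounded n w : typical w -> (d <= n)%N ->
  `|estimate n w - r (query Z w)| <= M + M.
Proof.
move=> typ dn; rewrite (le_trans (ler_normB _ _))// lerD//; last first.
  by have [/(_ None)[]] := typ.
rewrite estimate_nearest//; apply: mean_nearest_le => // i _.
by have [/(_ (Some i))[]] := typ.
Qed.

Lemma estimate_Lp_cvg (p : R) : 1 <= p ->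
  (\int[P]_w (`|estimate n w - r (query Z w)| `^ p)%:E)%E @[n --> \oo] --> 0%E.
Proof.
move=> p1; have p0 : 0 <= p by exact: le_trans p1.
pose f n w : R := `|estimate n w - r (query Z w)| `^ p.
have f0 n w : 0 <= f n w by exact: powR_ge0.
have If0 n : (0 <= \int[P]_w (f n w)%:E)%E.
  by apply: integral_ge0 => w _; rewrite lee_fin.
pose b := (M + M) `^ p; have b0 : 0 <= b by exact: powR_ge0.
have small (eps : R) : 0 < eps -> exists n0, forall n, (n0 <= n)%N ->
    (\int[P]_w (f n w)%:E <= eps%:E)%E.
  (* As tau <= 1 and 1 <= p, the p-th power of tau is at most tau. *)
  move=> eps0; pose tau := Num.min 1 (eps / 2).
  have tau0 : 0 < tau by rewrite lt_min ltr01 divr_gt0.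
  have tau1 : tau <= 1 by rewrite ge_min lexx.
  pose eta := eps / 2 / (b + 1).
  have b1 : 0 < b + 1 by rewrite ltr_wpDl.
  have eta0 : 0 < eta by rewrite !divr_gt0.
  have t0 : 0 < tau / 2 by rewrite divr_gt0.
  have [n0 h] := estimate_error_vanishes t0 eta0.
  have [N [mN N0 hN]] := typical_ae.
  exists (maxn n0 d) => n; rewrite geq_max => /andP[n0n dn].
  have [E [mE BE PE]] := h _ n0n.
  apply: (le_trans (integral_le_off_event (a := tau) (b := b) mE PE mN N0 _ b0 (f0 n) _ _)).
  - exact: ltW.
  - move=> w nN; have typ : typical w by apply: contrapT => nt; exact/nN/hN.
    by apply: ge0_ler_powR; rewrite ?nnegrE ?addr_ge0//; exact: estimate_error_bounded.
  - move=> w nN nE; have e : `|estimate n w - r (query Z w)| <= tau.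
      by rewrite [leRHS]splitr; apply: contrapT => ne; apply: nE; exact: BE.
    apply: (@le_trans _ _ (tau `^ p)).
      by apply: ge0_ler_powR; rewrite ?nnegrE// ltW.
    by apply: ge1r_powR; rewrite ?tau0.
  rewrite lee_fin [leRHS]splitr lerD//; first by rewrite ge_min lexx orbT.
  by rewrite /eta mulrA ler_pdivrMr// mulrDr mulr1 [_ * b]mulrC lerDl divr_ge0// ltW.
apply/fine_cvgP; split.
  have [n0 h] := small 1 ltr01; exists n0 => // n n0n.
  rewrite ge0_fin_numE; last exact: If0.
  exact: le_lt_trans (h _ n0n) (ltry _).
apply/cvgrPdist_le => eps eps0; have [n0 h] := small _ eps0; exists n0 => // n n0n.
have Ifin : (\int[P]_w (f n w)%:E)%E \is a fin_num.
  by rewrite ge0_fin_numE ?If0// (le_lt_trans (h _ n0n) (ltry _)).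
rewrite /= sub0r normrN ger0_norm; last by apply: fine_ge0; exact: If0.
by rewrite -lee_fin fineK//; exact: h.
Qed.

End consistency.

Theorem corollary2p1 (R : realType) (d : nat) (disp : measure_display)
    (Omega : measurableType disp) (P : probability Omega R)
    (X : {RV P >-> 'rV[R]_d}) (Y : {RV P >-> R})
    (Xs : nat -> {RV P >-> 'rV[R]_d}) (Ys : nat -> {RV P >-> R})
    (r : 'rV[R]_d -> R) :
  (0 < d)%N ->
  (forall i, identically_distributed P
     (fun w => (Xs i w, Ys i w)) (fun w => (X w, Y w))) ->
  mutually_independent P (fun (o : option nat) w =>
     if o is Some i then (Xs i w, Ys i w) else (X w, Y w)) ->
  has_density P X ->
  (exists M : R, {ae P, forall w, `|Y w| <= M}) ->
  is_regression_function P X Y r ->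
  {ae distribution P X, forall x, {for x, continuous r}} ->
  forall (p : R) (k : nat -> nat),
    1 <= p ->
    (forall n, (d <= n)%N -> (1 <= k n <= n)%N) ->
    k @ \oo --> \oo ->
    ((k n)%:R / n%:R : R) @[n --> \oo] --> (0 : R) ->
    'E_P[fun w => (`|knn_estimate (Xs ^~ w) (Ys ^~ w) n (k n) (X w) - r (X w)|
                     `^ p)%R]%E @[n --> \oo] --> 0%E.
Proof.
move=> d0 XYid XYind dX [M0 YM0] [mr intr rE] cr p k p1 k_range k_oo k_small.
pose Z (o : option nat) w : 'rV[R]_d * R := if o is Some i then (Xs i w, Ys i w) else (X w, Y w).
have mZ o : measurable_fun setT (Z o).
  by case: o => [i|]; apply: measurable_fun_pair; exact: measurable_funP.
have idZ o o' (A : set ('rV[R]_d * R)) : measurable A -> P (Z o @^-1` A) = P (Z o' @^-1` A).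
  have h o1 : measurable A -> P (Z o1 @^-1` A) = P (Z None @^-1` A).
    by move=> mA; case: o1 => [i|//]; exact: XYid.
  by move=> mA; rewrite !h.
have YM : {ae P, forall w, `|(Z None w).2| <= `|M0|}.
  by move: YM0; apply: filterS => w /le_trans; apply; exact: ler_norm.
have crX : {ae P, forall w, {for query Z w, continuous r}}.
  have [N [mN N0 hN]] := cr.
  exists (X @^-1` N); split => //; first by apply: measurable_preimageT mN; exact: measurable_funP.
  by move=> w hw; apply: hN => /= c; exact: hw.
have := estimate_Lp_cvg d0 mZ XYind idZ dX (normr_ge0 M0) mr YM intr rE crX k_range k_oo k_small p1.
by rewrite unlock.
Qed.
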